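(* Let $G$ be a countable directed graph. Then the upper triangular nest representations of $\mathfrak L_G$ separate points (that is, for every non-zero $A\in\mathfrak L_G$ there is an upper triangular nest representation $\psi$ of $\mathfrak L_G$ with $\psi(A)\neq0$) if and only if every vertex $x\in\mathcal V(G)$ which supports a cycle of positive length also supports at least one loop edge.
   Context: A countable directed graph $G=(\mathcal V(G),\mathcal E(G),r,s)$ consists of a countable set $\mathcal V(G)$ of vertices, a countable set $\mathcal E(G)$ of edges, and range and source maps $r,s:\mathcal E(G)\to\mathcal V(G)$. A path is a finite sequence of edges $p=e_k\cdots e_2e_1$ with $r(e_i)=s(e_{i+1})$ for $1\le i<k$; its length is $|p|=k$, $s(p)=s(e_1)$, $r(p)=r(e_k)$. Each vertex $x$ is a path of length $0$ with $s(x)=r(x)=x$. $\mathbb F^+(G)$ is the set of all paths (including vertices); the product $pq$ is defined when $r(q)=s(p)$. A cycle is a path $p$ with $r(p)=s(p)$; a loop edge is an edge $e$ with $r(e)=s(e)$. A vertex $x$ supports a cycle (resp. loop edge) $p$ if $r(p)=s(p)=x$. Let $\mathcal H_G=\ell^2(\mathbb F^+(G))$ with orthonormal basis $\{\xi_w:w\in\mathbb F^+(G)\}$. For $p\in\mathbb F^+(G)$ let $L_p\xi_w=\xi_{pw}$ if $s(p)=r(w)$ and $L_p\xi_w=0$ otherwise. The free semigroupoid algebra $\mathfrak L_G$ is the algebra generated by $\{L_p:p\in\mathbb F^+(G)\}$, closed in the weak operator topology. An upper triangular nest representation of $\mathfrak L_G$ is a norm-continuous algebra homomorphism of $\mathfrak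 L_G$ onto the algebra $\mathcal T_n$ of upper triangular $n\times n$ matrices (with respect to a fixed orthonormal basis $h_1,\dots,h_n$ of an $n$-dimensional Hilbert space), for some $n\ge1$. *)

(* Defs.v *)
From HB Require Import structures.
From mathcomp Require Import all_boot all_order all_algebra.
From mathcomp Require Import complex ring.
From mathcomp Require Import all_classical all_reals all_analysis.

Set Implicit Arguments.
Unset Strict Implicit.
Unset Printing Implicit Defensive.

Import Order.TTheory GRing.Theory Num.Theory.
Import Normc.

Local Open Scope classical_set_scope.
Local Open Scope ring_scope.
Local Open Scope complex_scope.

Record digraph := Digraph {
  vertex : countType;
  edge : countType;
  erng : edge -> vertex;
  esrc : edge -> vertex }.

Section Paths.
Variable G : digraph.

(* The path e_k ... e_2 e_1 is stored as its source vertex together with the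
   sequence [:: e_k; ...; e_2; e_1], in this (right-to-left) order; the vertex
   x is stored as (x, [::]). *)
Definition end_of (x : vertex G) (es : seq (edge G)) : vertex G :=
  if es is e :: _ then erng e else x.

Fixpoint composable (x : vertex G) (es : seq (edge G)) : bool :=
  if es is e :: es' then (esrc e == end_of x es') && composable x es' else true.

Record gpath := GPath {
  gpath_val : vertex G * seq (edge G);
  _ : composable gpath_val.1 gpath_val.2 }.
HB.instance Definition _ := [isSub for gpath_val].
HB.instance Definition _ := [Countable of gpath by <:].

Definition psrc (p : gpath) : vertex G := (val p).1.
Definition pedges (p : gpath) : seq (edge G) := (val p).2.
Definition prng (p : gpath) : vertex G := end_of (psrc p) (pedges p).
Definition plen (p : gpath) : nat := size (pedges p).

Definition supports_cycle (x : vertex G) (p : gpath) : Prop :=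
  prng p = x /\ psrc p = x.

Definition supports_loop_edge (x : vertex G) (e : edge G) : Prop :=
  erng e = x /\ esrc e = x.

(* pprod p q is Some pq if s(p) = r(q) (see pprodP), and None otherwise. *)
Definition pprod (p q : gpath) : option gpath :=
  if psrc p == prng q then insub (psrc q, pedges p ++ pedges q) else None.

(* lquo p v is Some w if v = pw (see lquoP), and None if there is no such w. *)
Definition lquo (p v : gpath) : option gpath :=
  obind (fun w => if pprod p w == Some v then Some w else None)
        (insub (psrc v, drop (plen p) (pedges v))).

Lemma gpath_eq (p q : gpath) : psrc p = psrc q -> pedges p = pedges q -> p = q.
Proof.
move=> h1 h2; apply: val_inj.
by rewrite [LHS]surjective_pairing [RHS]surjective_pairing; congr pair.
Qed.

Lemma composable_cat x es fs : composable x (es ++ fs) =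
  composable (end_of x fs) es && composable x fs.
Proof.
elim: es => //= e es ->; rewrite andbA; congr (_ && _ && _).
by case: es.
Qed.

Lemma pprodP (p q : gpath) : psrc p = prng q ->
  exists2 v, pprod p q = Some v &
    psrc v = psrc q /\ pedges v = pedges p ++ pedges q.
Proof.
move=> pq; have cv : composable (psrc q) (pedges p ++ pedges q).
  by rewrite composable_cat -/(prng q) -pq (valP p) (valP q).
rewrite /pprod pq eqxx.
case: insubP => [v _ vE|]; last by rewrite /= cv.
by exists v; rewrite // /psrc /pedges vE.
Qed.

Lemma pprodN (p q : gpath) : psrc p <> prng q -> pprod p q = None.
Proof. by move=> /eqP/negbTE h; rewrite /pprod h. Qed.

Lemma pprod_Some (p q v : gpath) : pprod p q = Some v ->
  [/\ psrc p = prng q, psrc v = psrc q & pedges v = pedges p ++ pedges q].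
Proof.
have [/eqP pq|/eqP pq] := boolP (psrc p == prng q); last by rewrite pprodN.
by have [u -> [h1 h2]] := pprodP pq; case=> <-.
Qed.

Lemma lquoP (p v w : gpath) : lquo p v = Some w <-> pprod p w = Some v.
Proof.
rewrite /lquo; split.
  by case: insubP => //= u _ _; case: eqP => // h [<-].
move=> h; have [_ hs he] := pprod_Some h.
have -> : (psrc v, drop (plen p) (pedges v)) = val w.
  by rewrite hs he /plen drop_size_cat // -surjective_pairing.
by rewrite valK /= h eqxx.
Qed.

End Paths.

Section L2.
Variables (R : realType) (W : choiceType).

Definition square_summable (f : W -> R[i]) : Prop :=
  (\esum_(w in [set: W]) ((normc (f w)) ^+ 2)%:E < +oo)%E.

Definition l2_pred : {pred W -> R[i]} := fun f => `[< square_summable f >].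

Lemma normcD_sq (x y : R[i]) :
  normc (x + y) ^+ 2 <= (normc x ^+ 2 + normc x ^+ 2) +
                        (normc y ^+ 2 + normc y ^+ 2).
Proof.
case: x y => [a b] [c d] /=.
rewrite !sqr_sqrtr ?addr_ge0 ?sqr_ge0 // -subr_ge0.
have -> : (a ^+ 2 + b ^+ 2) + (a ^+ 2 + b ^+ 2) +
    ((c ^+ 2 + d ^+ 2) + (c ^+ 2 + d ^+ 2)) -
    ((a + c) ^+ 2 + (b + d) ^+ 2) = (a - c) ^+ 2 + (b - d) ^+ 2.
  by ring.
by rewrite addr_ge0 ?sqr_ge0.
Qed.

Lemma esum_fin_le (F H : W -> R) : (forall w, 0 <= H w <= F w) ->
  (\esum_(w in [set: W]) (F w)%:E < +oo)%E ->
  (\esum_(w in [set: W]) (H w)%:E < +oo)%E.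
Proof.
move=> HF; apply: le_lt_trans; apply: le_esum => w _.
by rewrite lee_fin; case/andP: (HF w).
Qed.

Lemma esum_finD (F H : W -> R) : (forall w, 0 <= F w) -> (forall w, 0 <= H w) ->
  (\esum_(w in [set: W]) (F w)%:E < +oo)%E ->
  (\esum_(w in [set: W]) (H w)%:E < +oo)%E ->
  (\esum_(w in [set: W]) (F w + H w)%:E < +oo)%E.
Proof.
move=> F0 H0 Ff Hf.
rewrite (eq_esum (b := fun w => ((F w)%:E + (H w)%:E)%E)) //.
by rewrite esumD ?lte_add_pinfty // => w _; rewrite lee_fin.
Qed.

Lemma l2_submod_closed : submod_closed l2_pred.
Proof.
have nn (f : W -> R[i]) w : 0 <= normc (f w) ^+ 2 by rewrite sqr_ge0.
split=> [|a f g /asboolP Sf /asboolP Sg]; apply/asboolP.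
  rewrite /square_summable esum1 ?ltry // => w _.
  by rewrite [X in normc X](_ : _ = 0) // normc0 expr0n.
have Saf : square_summable (fun w => a * f w).
  have [n an] : exists n : nat, normc a ^+ 2 <= n%:R.
    exists (Num.bound (normc a ^+ 2)).
    by apply/ltW/archi_boundP/sqr_ge0.
  have : (\esum_(w in [set: W]) (n%:R * normc (f w) ^+ 2)%:E < +oo)%E.
    elim: n {an} => [|n IHn].
      by rewrite esum1 ?ltry // => w _; rewrite mul0r.
    rewrite (eq_esum
      (b := fun w => (n%:R * normc (f w) ^+ 2 + normc (f w) ^+ 2)%:E)).
      by apply: esum_finD => // w; rewrite mulr_ge0.
    by move=> w _; rewrite -natr1 mulrDl mul1r.
  apply: esum_fin_le => w; rewrite sqr_ge0 normcM exprMn /=.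
  exact: ler_wpM2r.
have H := esum_finD (fun w => addr_ge0 (nn _ w) (nn _ w))
  (fun w => addr_ge0 (nn _ w) (nn _ w))
  (esum_finD (nn _) (nn _) Saf Saf) (esum_finD (nn _) (nn _) Sg Sg).
apply: esum_fin_le H => w; rewrite nn /=; exact: normcD_sq.
Qed.

HB.instance Definition _ :=
  GRing.isSubmodClosed.Build R[i] (W -> R[i]) l2_pred l2_submod_closed.

Record l2 := L2 { l2_val :> W -> R[i]; _ : l2_val \in l2_pred }.
HB.instance Definition _ := [isSub for l2_val].
HB.instance Definition _ := [Choice of l2 by <:].
HB.instance Definition _ := [SubChoice_isSubLmodule of l2 by <:].

Definition l2norm (f : l2) : R :=
  Num.sqrt (fine (\esum_(w in [set: W]) ((normc (f w)) ^+ 2)%:E)).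

(* Unordered sums; meaningful only for absolutely summable families, which is
   the case in inner. *)
Definition rsum (a : W -> R) : R :=
  fine (\esum_(w in [set: W]) (Num.max (a w) 0)%:E) -
  fine (\esum_(w in [set: W]) (Num.max (- a w) 0)%:E).

Definition csum (a : W -> R[i]) : R[i] :=
  rsum (fun w => complex.Re (a w)) +i* rsum (fun w => complex.Im (a w)).

Definition inner (f g : l2) : R[i] := csum (fun w => f w * ((g w)^*)%C).

Definition xi_fun (v : W) : W -> R[i] := fun w => (w == v)%:R.

Lemma xi_l2 (v : W) : xi_fun v \in l2_pred.
Proof.
apply/asboolP; rewrite /square_summable.
rewrite (esumID [set v]); last by move=> w _; rewrite lee_fin sqr_ge0.
rewrite setTI esum_set1 ?lee_fin ?sqr_ge0 // esum1 ?adde0 ?ltry //.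
by move=> w [_ /= wv]; rewrite /xi_fun; move/eqP/negbTE: wv => ->;
  rewrite normc0 expr0n.
Qed.

Definition xi (v : W) : l2 := L2 (xi_l2 v).

(* B(H), H = l2: operators are functions l2 -> l2, added and scaled pointwise
   and multiplied by composition. *)
Definition bounded_operator : set (l2 -> l2) :=
  [set A | linear A /\ exists M : R, forall f, l2norm (A f) <= M * l2norm f].

Definition opnorm (A : l2 -> l2) : R :=
  sup [set l2norm (A f) | f in [set f | l2norm f <= 1]].

(* Closure in B(H) for the weak operator topology, whose basic neighbourhoods
   of A are the sets of those B such that |<(B - A)f, g>| < eps for finitely
   many pairs (f, g). *)
Definition wot_closure (S : set (l2 -> l2)) : set (l2 -> l2) :=
  [set A | bounded_operator A /\
    forall (fgs : seq (l2 * l2)) (eps : R), 0 < eps ->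
      exists2 B, S B /\ bounded_operator B &
        forall fg, fg \in fgs -> normc (inner ((B - A) fg.1) fg.2) < eps].

(* Not required to be unital: G may have infinitely many vertices. *)
Definition operator_algebra (S : set (l2 -> l2)) : Prop :=
  [/\ S 0, (forall A B, S A -> S B -> S (A + B)),
      (forall (c : R[i]) A, S A -> S (c *: A)) &
      (forall A B, S A -> S B -> S (A \o B))].

End L2.

Section FreeSemigroupoidAlgebra.
Variables (R : realType) (G : digraph).
Local Notation H := (l2 R (gpath G)).

Lemma left_creation_le (p : gpath G) (f : H) :
  (\esum_(v in [set: gpath G]) (normc (oapp f 0 (lquo p v)) ^+ 2)%:E <=
   \esum_(w in [set: gpath G]) (normc (f w) ^+ 2)%:E)%E.
Proof.
pose P : set (gpath G) := [set w | psrc p = prng w].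
pose Q : set (gpath G) := [set v | lquo p v].
have e_of w : P w -> pprod p w = Some (odflt w (pprod p w)).
  by move=> Pw; have [v -> _] := pprodP Pw.
rewrite (esumID Q); last by move=> v _; rewrite lee_fin sqr_ge0.
rewrite [X in (_ + X)%E]esum1; last first.
  move=> v [_]; rewrite /Q /=; case: (lquo p v) => [w /(_ isT) //|_ /=].
  by rewrite expr0n /= addr0 sqrtr0 expr0n.
rewrite adde0 setTI (@reindex_esum _ _ _ P _ (fun w => odflt w (pprod p w))).
- rewrite (@esum_mkcond _ _ P); apply: le_esum => w _.
  case: ifPn => [/set_mem Pw|_]; last by rewrite lee_fin sqr_ge0.
  by have/lquoP -> := e_of w Pw.
- split.
  + by move=> w Pw; rewrite /Q /=; have/lquoP -> := e_of w Pw.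
  + move=> w1 w2 /set_mem P1 /set_mem P2 e12.
    have/lquoP h1 := e_of _ P1; have/lquoP := e_of _ P2.
    by rewrite -e12 h1 => -[].
  + move=> v; rewrite /Q /=; case E : (lquo p v) => [w|//] _; exists w.
      by have/lquoP/pprod_Some[] := E.
    by move/lquoP: E => ->.
Qed.

Lemma left_creation_l2 (p : gpath G) (f : H) :
  (fun v => oapp f 0 (lquo p v)) \in @l2_pred R (gpath G).
Proof.
apply/asboolP; apply: le_lt_trans (left_creation_le p f) _.
by move/asboolP: (valP f).
Qed.

(* The operator L_p: the v-th coordinate of L_p f is f w if v = pw and 0 if v is
   not of this form. *)
Definition left_creation (p : gpath G) (f : H) : H :=
  L2 (left_creation_l2 p f).

Lemma left_creation_xi (p w : gpath G) :
  left_creation p (xi R w) = oapp (@xi R _) 0 (pprod p w).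
Proof.
apply: val_inj; apply/funext => v /=.
case E: (pprod p w) => [u|] /=; rewrite /xi_fun.
  case F: (lquo p v) => [w'|] /=.
    congr ((_ : bool)%:R); apply/eqP/eqP => [h|h].
      by move/lquoP: F; rewrite h E => -[].
    by move/lquoP: E; rewrite -h F => -[].
  case: eqP => // h; by move/lquoP: E; rewrite -h F.
case F: (lquo p v) => [w'|] //=.
by case: eqP => // h; move/lquoP: F; rewrite h E.
Qed.

Lemma left_creation_bounded (p : gpath G) :
  bounded_operator (left_creation p).
Proof.
split=> [c f g|].
  apply: val_inj; apply/funext => v.
  rewrite /= [RHS]/(_ + _) /= [X in _ = X + _]/(_ *: _) /=.
  case: (lquo p v) => [w|] //=.
  by rewrite mulr0 addr0.
exists 1 => f; rewrite mul1r /l2norm ler_wsqrtr // fine_le //.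
- rewrite ge0_fin_numE; first by move/asboolP: (valP (left_creation p f)).
  by apply: esum_ge0 => w _; rewrite lee_fin sqr_ge0.
- rewrite ge0_fin_numE; first by move/asboolP: (valP f).
  by apply: esum_ge0 => w _; rewrite lee_fin sqr_ge0.
- exact: left_creation_le.
Qed.

Definition free_semigroupoid_algebra : set (H -> H) :=
  wot_closure (smallest (@operator_algebra R (gpath G)) (range left_creation)).

(* Matrices act on columns, in the basis h_1, ..., h_n; is_trig_mx is lower
   triangularity.  Continuity is from the operator norm to the entrywise
   topology of the n x n matrices. *)
Record nest_representation (n : nat) (psi : (H -> H) -> 'M[R[i]]_n) : Prop :=
  NestRepresentation {
    nest_rep_add : forall A B, free_semigroupoid_algebra A ->
      free_semigroupoid_algebra B -> psi (A + B) = psi A + psi B;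
    nest_rep_scale : forall (c : R[i]) A, free_semigroupoid_algebra A ->
      psi (c *: A) = c *: psi A;
    nest_rep_mul : forall A B, free_semigroupoid_algebra A ->
      free_semigroupoid_algebra B -> psi (A \o B) = psi A *m psi B;
    nest_rep_continuous : forall A, free_semigroupoid_algebra A ->
      forall eps : R, 0 < eps -> exists2 delta : R, 0 < delta &
        forall B, free_semigroupoid_algebra B -> opnorm (B - A) < delta ->
          forall i j, normc (psi B i j - psi A i j) < eps;
    nest_rep_onto :
      psi @` free_semigroupoid_algebra = [set M | is_trig_mx M^T] }.

Definition nest_representations_separate_points : Prop :=
  forall A, free_semigroupoid_algebra A -> A <> 0 ->
    exists n (psi : (H -> H) -> 'M[R[i]]_n),
      [/\ (0 < n)%N, nest_representation psi & psi A <> 0].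

End FreeSemigroupoidAlgebra.

(* Main.v *)
Require Import Defs.
From mathcomp Require Import all_boot all_order all_algebra.
From mathcomp Require Import complex finmap ring lra zify.
From mathcomp Require Import all_classical all_reals all_analysis.

Set Implicit Arguments.
Unset Strict Implicit.
Unset Printing Implicit Defensive.

Import Order.TTheory GRing.Theory Num.Theory.
Import Normc.

Local Open Scope classical_set_scope.
Local Open Scope ring_scope.
Local Open Scope complex_scope.

(** Let R_u be the right creation xi_w |-> xi_(wu). Operators of the free
    semigroupoid algebra commute with every R_u, so such an A is determined by its
    symbol, the function q |-> <A xi_s(q), xi_q>. Conversely every bounded
    operator commuting with the R_u lies in the algebra ([algebra_commutant]): the
    Fejer means of its symbol, over larger and larger finite sets of edges, are
    bounded by its norm.

    Sufficiency ([loops_separate]). Choose a loop f_x at every vertex x that has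
    one, and let A have a nonzero coefficient at a path q. Deleting the chosen
    loops from q leaves a skeleton e_k ... e_1 through vertices x_0, ..., x_k. For
    scalars l_0, ..., l_k put v_0 = xi_(x_0), v_i = L_(e_i) u_(i-1), and let u_i
    solve u_i = v_i + l_i L_f u_i for the loop f chosen at x_i (u_i = v_i if there
    is none). The adjoint of every L_p sends u_i into the span of u_0, ..., u_i,
    so the matrix coefficients of A against the u_i form a triangular
    representation of size k + 1. It maps onto all triangular matrices when the
    l_i are distinct: the chosen loop at x acts on the positions i with x_i = x as
    a diagonal matrix with the distinct entries l_i, and it exists as soon as
    there are two such positions, for then x lies on a cycle; the edge e_i
    supplies the superdiagonal entry between u_i and u_(i-1). The corner entry <A
    xi_(x_0), u_k> is nonzero for suitable small l_i, since its expansion in the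
    l_i contains the coefficient of A at q ([skeleton_exists]).

    Necessity ([nest_kills_square]). Let p be a cycle at a vertex x without loops.
    Every nest representation psi kills L_p L_p, which is not 0. The diagonal
    entries of psi are characters; if the last nonzero entry of some column of psi
    (L_p Z), Z a contraction, lies in row r, then theta = psi(.)_rr satisfies
    theta (L_x) = 1 and |theta Y| <= C ||Y L_p||. By [character_value] such a
    theta is the constant coefficient chi. If psi (L_p L_p) were nonzero, the
    columns of psi (L_p) and psi (L_p L_p) would give two different rows with this
    property, while the diagonal entries of psi are independent because psi is
    onto.

    If only finitely many edges enter x, [character_value] is immediate: theta
    (L_e) = 0 for each of them, as e starts at another vertex, and an A with chi
    (A) = 0 whose range lies over x is a finite sum of operators L_e A_e. If there
    are infinitely many, that sum converges only weakly, while theta is only norm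
    continuous; the bound by ||Y L_p|| makes up for this. Let chi (A) = 0 and
    theta (A) <> 0. Removing from A the paths that begin with one of finitely many
    edges makes ||A xi_x|| as small as desired and keeps theta (A)
    ([small_symbol]). An outer operator F of the algebra then has chi (F) = 1,
    norm almost 1 and A F small ([outer_operator]), so theta (F) is small. A
    Moebius transform of F yields an approximate contraction B with chi (B) = 0
    and theta (B) close to 1. Removing from B the paths that begin with the
    leftmost edge of p gives D with the same value of theta and with range
    orthogonal to that of L_p. Hence Y = 1 + D + ... + D^m satisfies ||Y L_p||^2
    <= m + 1, but theta (Y) has order m + 1, which is impossible for large m
    ([character_zero]). *)

(** * Complex moduli and unordered sums *)

Section ComplexModulus.
Variable R : realType.
Implicit Types z w : R[i].

Lemma normc_ge0 z : 0 <= normc z.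
Proof. by case: z => a b; rewrite sqrtr_ge0. Qed.

Lemma normc_sqr z : normc z ^+ 2 = complex.Re z ^+ 2 + complex.Im z ^+ 2.
Proof. by case: z => a b; rewrite /= sqr_sqrtr // addr_ge0 ?sqr_ge0. Qed.

Lemma normc_conj z : normc (z^*)%C = normc z.
Proof. by case: z => a b; rewrite /= sqrrN. Qed.

Lemma mulc_conj z : z * (z^*)%C = (normc z ^+ 2)%:C.
Proof. by rewrite normc_sqr; case: z => a b; simpc; congr (_ +i* _); ring. Qed.

Lemma normc_real (a : R) : normc a%:C = `|a|.
Proof. by rewrite /normc /= expr0n addr0 sqrtr_sqr. Qed.

Lemma normc_eq0 z : (normc z == 0) = (z == 0).
Proof.
by apply/eqP/eqP => [/eq0_normc //|->]; rewrite normc0.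
Qed.

Lemma Re_le_normc z : `|complex.Re z| <= normc z.
Proof.
by case: z => a b /=; rewrite -sqrtr_sqr ler_wsqrtr // lerDl sqr_ge0.
Qed.

Lemma normc_le_ReIm z : normc z <= `|complex.Re z| + `|complex.Im z|.
Proof.
case: z => a b /=; rewrite -[leRHS]ger0_norm ?addr_ge0 // -sqrtr_sqr.
apply: ler_wsqrtr; rewrite sqrrD !real_normK ?num_real //.
by rewrite addrAC lerDl mulrn_wge0 // mulr_ge0.
Qed.

Lemma normcX z n : normc (z ^+ n) = normc z ^+ n.
Proof.
elim: n => [|n IHn]; first by rewrite !expr0 normc1.
by rewrite !exprS normcM IHn.
Qed.

Lemma normcB_sym z w : normc (z - w) = normc (w - z).
Proof. by rewrite -normcN opprB. Qed.

Lemma le_normcB z w : normc z - normc w <= normc (z - w).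
Proof. by rewrite lerBlDr -{1}(subrK w z) le_normcD. Qed.

Lemma le_normc_sum (I : Type) (s : seq I) (F : I -> R[i]) :
  normc (\sum_(i <- s) F i) <= \sum_(i <- s) normc (F i).
Proof.
elim/big_ind2: _ => [|a b c d h1 h2|i _]; rewrite ?normc0 //.
exact: le_trans (le_normcD _ _) (lerD h1 h2).
Qed.

Lemma normc_small z : (forall e : R, 0 < e -> normc z <= e) -> z = 0.
Proof.
move=> h; apply/eqP; rewrite -normc_eq0 eq_le normc_ge0 andbT.
by apply/ler_addgt0Pr => e /h; rewrite add0r.
Qed.

Lemma conjD z w : ((z + w)^*)%C = (z^*)%C + (w^*)%C.
Proof. exact: rmorphD. Qed.
Lemma conjM z w : ((z * w)^*)%C = (z^*)%C * (w^*)%C.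
Proof. exact: rmorphM. Qed.
Lemma conjN z : ((- z)^*)%C = - (z^*)%C.
Proof. exact: rmorphN. Qed.

Lemma realcD (a b : R) : (a + b)%:C = a%:C + b%:C.
Proof. exact: rmorphD. Qed.
Lemma realcM (a b : R) : (a * b)%:C = a%:C * b%:C.
Proof. exact: rmorphM. Qed.
Lemma realcN (a : R) : (- a)%:C = - a%:C.
Proof. exact: rmorphN. Qed.
Lemma realc_sum (I : Type) (s : seq I) (F : I -> R) :
  (\sum_(i <- s) F i)%:C = \sum_(i <- s) (F i)%:C.
Proof. exact: rmorph_sum. Qed.

End ComplexModulus.

Section NetSums.
Variables (R : realType) (W : choiceType).
Implicit Types (a b : W -> R[i]) (p : W -> R) (s : seq W).

(** The limit of the finite partial sums, directed by inclusion. The inner product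
    is a difference of sums of positive and negative parts, which does not
    compose; it is such a limit, and limits are additive, homogeneous and
    unique. *)
Definition net_sum a (z : R[i]) : Prop := forall e : R, 0 < e ->
  exists s, forall t, uniq t -> {subset s <= t} ->
    normc (\sum_(w <- t) a w - z) <= e.

Lemma net_sum_unique a z z' : net_sum a z -> net_sum a z' -> z = z'.
Proof.
move=> h h'; apply/eqP; rewrite -subr_eq0; apply/eqP; apply: normc_small => e e0.
have e20 : 0 < e / 2%:R by rewrite divr_gt0.
have [s hs] := h _ e20; have [s' hs'] := h' _ e20.
have u := undup_uniq (s ++ s').
have H1 : {subset s <= undup (s ++ s')}.
  by move=> w sw; rewrite mem_undup mem_cat sw.
have H2 : {subset s' <= undup (s ++ s')}.
  by move=> w sw; rewrite mem_undup mem_cat sw orbT.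
have := hs _ u H1; have := hs' _ u H2; set S := \sum_(w <- _) a w => le' le.
have -> : z - z' = (S - z') - (S - z) by ring.
apply: le_trans (le_normcD _ _) _; rewrite normcN [leRHS](splitr e).
exact: lerD.
Qed.

Lemma net_sum_eq a b z : a =1 b -> net_sum a z -> net_sum b z.
Proof.
move=> ab h e /h[s hs]; exists s => t ut st.
by rewrite -(eq_bigr _ (fun w _ => ab w)); exact: hs.
Qed.

Lemma net_sum_finite a s :
  uniq s -> (forall w, w \notin s -> a w = 0) -> net_sum a (\sum_(w <- s) a w).
Proof.
move=> us as0 e e0; exists s => t ut st.
rewrite (bigID (mem s)) /= [X in _ + X - _]big1; last by move=> w; exact: as0.
rewrite addr0 -big_filter (perm_big s) ?subrr ?normc0 ?ltW //.
apply: uniq_perm; rewrite ?filter_uniq // => w.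
by rewrite mem_filter; case: (boolP (w \in s)) => //= /st.
Qed.

Lemma net_sumD a b z z' :
  net_sum a z -> net_sum b z' -> net_sum (fun w => a w + b w) (z + z').
Proof.
move=> ha hb e e0; have e20 : 0 < e / 2%:R by rewrite divr_gt0.
have [s hs] := ha _ e20; have [s' hs'] := hb _ e20.
exists (s ++ s') => t ut st; rewrite big_split /= opprD addrACA.
apply: le_trans (le_normcD _ _) _; rewrite [leRHS](splitr e).
by apply: lerD; [apply: hs|apply: hs'] => // w hw; apply: st;
  rewrite mem_cat hw ?orbT.
Qed.

Lemma net_sumZ (c : R[i]) a z : net_sum a z -> net_sum (fun w => c * a w) (c * z).
Proof.
move=> h e e0; have c1 : 0 < normc c + 1 by rewrite ltr_wpDl ?normc_ge0.
have [s hs] := h (e / (normc c + 1)) (divr_gt0 e0 c1).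
exists s => t ut st; rewrite -mulr_sumr -mulrBr normcM.
have := hs _ ut st; rewrite ler_pdivlMr // mulrDr mulr1 => le_e.
by apply: le_trans le_e; rewrite mulrC lerDl normc_ge0.
Qed.

Lemma net_sum_conj a z : net_sum a z -> net_sum (fun w => (a w)^*%C) (z^*%C).
Proof.
move=> h e /h[s hs]; exists s => t ut st.
by rewrite -rmorph_sum -rmorphB normc_conj; exact: hs.
Qed.

Lemma fin_esum p : (forall w, 0 <= p w) ->
  (\esum_(w in [set: W]) (p w)%:E < +oo)%E ->
  ((fine (\esum_(w in [set: W]) (p w)%:E))%:E = \esum_(w in [set: W]) (p w)%:E)%E.
Proof.
move=> p0 fin; rewrite fineK // ge0_fin_numE //.
by apply: esum_ge0 => w _; rewrite lee_fin.
Qed.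

Lemma psum_le_esum p s : uniq s ->
  (((\sum_(w <- s) p w)%:E : \bar R) <= \esum_(w in [set: W]) (p w)%:E)%E.
Proof.
move=> us; apply: esum_ge; exists [set` s]; first by split.
by rewrite -fsbig_seq // sumEFin.
Qed.

Lemma esum_le_psum p (M : R) :
  (forall s, uniq s -> \sum_(w <- s) p w <= M) ->
  (\esum_(w in [set: W]) (p w)%:E <= M%:E)%E.
Proof.
move=> h; apply: ge_ereal_sup => _ /= [F [finF _] <-].
by rewrite fsbig_finite //= sumEFin lee_fin; apply: h; exact: fset_uniq.
Qed.

Lemma psum_approx p : (forall w, 0 <= p w) ->
  (\esum_(w in [set: W]) (p w)%:E < +oo)%E ->
  forall e : R, 0 < e -> exists2 s, uniq s &
    fine (\esum_(w in [set: W]) (p w)%:E) - e <= \sum_(w <- s) p w.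
Proof.
move=> p0 fin e e0; apply: contrapT => no.
have : (\esum_(w in [set: W]) (p w)%:E <=
        (fine (\esum_(w in [set: W]) (p w)%:E) - e)%:E)%E.
  apply: esum_le_psum => s us; rewrite leNgt; apply/negP => lt; apply: no.
  by exists s => //; exact: ltW.
rewrite -{1}fin_esum // lee_fin lerBrDr gerDl leNgt e0 //.
Qed.

Lemma psum_mono p s t : (forall w, 0 <= p w) -> uniq s -> uniq t ->
  {subset s <= t} -> \sum_(w <- s) p w <= \sum_(w <- t) p w.
Proof.
move=> p0 us ut st; rewrite [leRHS](bigID (mem s)) /=.
rewrite -[X in X + _]big_filter [X in X + _](perm_big s).
  by rewrite lerDl sumr_ge0.
apply: uniq_perm; rewrite ?filter_uniq // => w.
by rewrite mem_filter; case: (boolP (w \in s)) => //= /st.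
Qed.

Lemma net_sum_esum p : (forall w, 0 <= p w) ->
  (\esum_(w in [set: W]) (p w)%:E < +oo)%E ->
  net_sum (fun w => (p w)%:C) (fine (\esum_(w in [set: W]) (p w)%:E))%:C.
Proof.
move=> p0 fin e e0; have [s us hs] := psum_approx p0 fin e0.
exists s => t ut st; rewrite -rmorph_sum -rmorphB normc_real.
rewrite ler_norml; apply/andP; split; last first.
  rewrite lerBlDr (le_trans _ (_ : fine (\esum_(w in [set: W]) (p w)%:E) <= _)) //.
    by rewrite -lee_fin fin_esum // psum_le_esum.
  by rewrite lerDr ltW.
rewrite lerBrDl; apply: le_trans hs _; exact: psum_mono.
Qed.

(** Absolute convergence makes both the positive and the negative part a limit of
    finite sums, and their difference recovers the family. *)
Lemma net_sum_rsum (r : W -> R) :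
  (\esum_(w in [set: W]) `|r w|%:E < +oo)%E ->
  net_sum (fun w => (r w)%:C) (rsum r)%:C.
Proof.
move=> fin.
have m1 w : 0 <= Num.max (r w) 0 <= `|r w|.
  by rewrite le_max lexx orbT /= ge_max ler_norm normr_ge0.
have m2 w : 0 <= Num.max (- r w) 0 <= `|r w|.
  by rewrite le_max lexx orbT /= ge_max -normrN ler_norm normr_ge0.
have h1 := net_sum_esum (fun w => proj1 (andP (m1 w))) (esum_fin_le m1 fin).
have h2 := net_sum_esum (fun w => proj1 (andP (m2 w))) (esum_fin_le m2 fin).
rewrite /rsum rmorphB -mulN1r.
apply: net_sum_eq (net_sumD h1 (net_sumZ (-1) h2)) => w /=.
rewrite mulN1r -rmorphB /=; congr (_%:C).
case: (leP (r w) 0) => h; case: (leP (- r w) 0) => h'; lra.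
Qed.

Lemma net_sum_csum a : (\esum_(w in [set: W]) (normc (a w))%:E < +oo)%E ->
  net_sum a (csum a).
Proof.
move=> fin.
have hr w : 0 <= `|complex.Re (a w)| <= normc (a w).
  by rewrite normr_ge0 Re_le_normc.
have hi w : 0 <= `|complex.Im (a w)| <= normc (a w).
  rewrite normr_ge0 /=; case: (a w) => x y /=.
  by rewrite -sqrtr_sqr ler_wsqrtr // lerDr sqr_ge0.
have h1 := net_sum_rsum (esum_fin_le hr fin).
have h2 := net_sum_rsum (esum_fin_le hi fin).
have -> : csum a = (rsum (fun w => complex.Re (a w)))%:C +
    'i%C * (rsum (fun w => complex.Im (a w)))%:C.
  by rewrite [LHS]complexE.
apply: net_sum_eq (net_sumD h1 (net_sumZ 'i%C h2)) => w /=.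
by rewrite [a w in RHS]complexE.
Qed.

End NetSums.

(** * Geometry of the Hilbert space of square summable families *)

Section HermitianForm.
Variables (R : realType) (V : lmodType R[i]) (q : V -> V -> R[i]) (n : V -> R).
Hypothesis q_lin : forall (a : R[i]) f g h, q (a *: f + g) h = a * q f h + q g h.
Hypothesis q_conj : forall f g, q g f = (q f g)^*%C.
Hypothesis q_diag : forall f, q f f = (n f)%:C.

Lemma form_sqD (f k : V) (c : R[i]) :
  n (c *: k + f) = n f + 2 * complex.Re (c * q k f) + normc c ^+ 2 * n k.
Proof.
suff : (n (c *: k + f))%:C =
       (n f + 2 * complex.Re (c * q k f) + normc c ^+ 2 * n k)%:C by case.
rewrite -q_diag q_lin (q_conj (c *: k + f) k) (q_conj (c *: k + f) f).
rewrite !q_lin !q_diag (q_conj k f) normc_sqr.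
case: c (q k f) => a b [x y] /=; simpc.
by congr (_ +i* _); ring.
Qed.

Hypothesis n_ge0 : forall f, 0 <= n f.

(** If f nearly minimises the quadratic form along the line f + C k, its
    derivative along k nearly vanishes: insert the minimising point of the
    parabola. With mu = 0 this is the Cauchy-Schwarz inequality; with mu an
    infimum it yields the orthogonality relations satisfied by a minimiser. *)
Lemma form_near_min (f k : V) (mu : R) :
  (forall c : R[i], mu <= n (c *: k + f)) ->
  normc (q k f) ^+ 2 <= n k * (n f - mu).
Proof.
move=> mu_le; set z := q k f.
have key (s : R) : mu <= n f - 2 * s * normc z ^+ 2 +
    (s ^+ 2 * normc z ^+ 2) * n k.
  have := mu_le (- (s%:C * z^*%C)); rewrite form_sqD -/z normcN normcM normc_conj.
  have -> : - (s%:C * z^*%C) * z = (- (s * normc z ^+ 2))%:C.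
    by rewrite rmorphN rmorphM /= -mulc_conj; ring.
  rewrite normc_real exprMn real_normK ?num_real //=.
  by move=> h; apply: le_trans h _; rewrite le_eqVlt; apply/orP; left; apply/eqP; ring.
have := n_ge0 k; rewrite le_eqVlt => /orP[/eqP nk0|nk_gt0].
  rewrite -nk0 mul0r leNgt; apply/negP => z_gt0.
  (* on a null direction the form is affine, so it is bounded below only if z = 0 *)
  have := key ((n f - mu + 1) / (2 * normc z ^+ 2)).
  rewrite -nk0 mulr0 addr0.
  have -> : 2 * ((n f - mu + 1) / (2 * normc z ^+ 2)) * normc z ^+ 2 = n f - mu + 1.
    by field; apply: contraTneq z_gt0 => ->; rewrite expr0n ltxx.
  lra.
have := key (n k)^-1; rewrite -(ler_pM2l nk_gt0).
have -> : n k * (n f - 2 * (n k)^-1 * normc z ^+ 2 +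
    (n k)^-1 ^+ 2 * normc z ^+ 2 * n k) = n k * n f - normc z ^+ 2.
  by field; rewrite gt_eqF.
lra.
Qed.

Lemma form_CS (f g : V) : normc (q f g) ^+ 2 <= n f * n g.
Proof. by have := @form_near_min g f 0 (fun c => n_ge0 _); rewrite subr0. Qed.

End HermitianForm.

Section L2Geometry.
Variables (R : realType) (W : choiceType).
Local Notation H := (l2 R W).
Implicit Types (f g h : H) (w : W) (s t : seq W).

Lemma l2P f g : (forall w, f w = g w) -> f = g.
Proof. by move=> fg; apply: val_inj; apply/funext. Qed.
Lemma l2_DE f g w : (f + g) w = f w + g w. Proof. by []. Qed.
Lemma l2_NE f w : (- f) w = - f w. Proof. by []. Qed.
Lemma l2_ZE (c : R[i]) f w : (c *: f) w = c * f w. Proof. by []. Qed.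
Lemma l2_sumE (I : Type) (r : seq I) (P : pred I) (F : I -> H) w :
  (\sum_(i <- r | P i) F i) w = \sum_(i <- r | P i) F i w.
Proof. by elim/big_rec2: _ => // i a b _ <-. Qed.

Definition sqn f : R := fine (\esum_(w in [set: W]) ((normc (f w)) ^+ 2)%:E).

Lemma l2_fin f : (\esum_(w in [set: W]) ((normc (f w)) ^+ 2)%:E < +oo)%E.
Proof. by move/asboolP: (valP f). Qed.

Lemma sqn_ge0 f : 0 <= sqn f.
Proof. by apply: fine_ge0; apply: esum_ge0 => w _; rewrite lee_fin sqr_ge0. Qed.

Lemma psum_le_sqn f s : uniq s -> \sum_(w <- s) normc (f w) ^+ 2 <= sqn f.
Proof.
move=> us; rewrite -lee_fin /sqn fin_esum ?l2_fin //.
- exact: psum_le_esum.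
- by move=> w; rewrite sqr_ge0.
Qed.

Lemma coord_le_sqn f w : normc (f w) ^+ 2 <= sqn f.
Proof. by have := @psum_le_sqn f [:: w] isT; rewrite big_seq1. Qed.

Lemma sqn_le f (M : R) :
  (forall s, uniq s -> \sum_(w <- s) normc (f w) ^+ 2 <= M) -> sqn f <= M.
Proof.
move=> h; rewrite -lee_fin /sqn fin_esum ?l2_fin //; first exact: esum_le_psum.
by move=> w; rewrite sqr_ge0.
Qed.

Lemma l2_predP (F : W -> R[i]) (M : R) :
  (forall s, uniq s -> \sum_(w <- s) normc (F w) ^+ 2 <= M) ->
  F \in @l2_pred R W.
Proof.
move=> h; apply/asboolP; apply: (le_lt_trans (esum_le_psum h)); exact: ltry.
Qed.

Lemma inner_net_sum f g : net_sum (fun w => f w * ((g w)^*)%C) (inner f g).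
Proof.
apply: net_sum_csum.
apply: (@esum_fin_le _ _ (fun w => normc (f w) ^+ 2 + normc (g w) ^+ 2)).
  move=> w; rewrite normc_ge0 normcM normc_conj /=.
  have := sqr_ge0 (normc (f w) - normc (g w)); have := normc_ge0 (f w).
  have := normc_ge0 (g w); nra.
by apply: esum_finD => // [w|w||]; rewrite ?sqr_ge0 ?l2_fin.
Qed.

Lemma innerPl (a : R[i]) f g h : inner (a *: f + g) h = a * inner f h + inner g h.
Proof.
apply: net_sum_unique (inner_net_sum _ _) _.
apply: net_sum_eq (net_sumD (net_sumZ a (inner_net_sum f h)) (inner_net_sum g h)).
by move=> w; rewrite -[(a *: f + g) w]/(a * f w + g w); ring.
Qed.

Lemma innerC f g : inner g f = ((inner f g)^*)%C.
Proof.
apply: net_sum_unique (inner_net_sum _ _) _.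
apply: net_sum_eq (net_sum_conj (inner_net_sum f g)) => w /=.
by rewrite rmorphM /= conjcK mulrC.
Qed.

Lemma inner_diag f : inner f f = (sqn f)%:C.
Proof.
apply: net_sum_unique (inner_net_sum _ _) _.
apply: net_sum_eq (net_sum_esum _ (l2_fin f)) => w /=; last by rewrite sqr_ge0.
by rewrite mulc_conj.
Qed.

Lemma inner_CS f g : normc (inner f g) ^+ 2 <= sqn f * sqn g.
Proof. exact: form_CS innerPl innerC inner_diag sqn_ge0 f g. Qed.

Lemma innerDl f g h : inner (f + g) h = inner f h + inner g h.
Proof. by rewrite -[f]scale1r innerPl mul1r scale1r. Qed.
Lemma inner0l h : inner 0 h = 0.
Proof. by apply: (addrI (inner 0 h)); rewrite -innerDl !addr0. Qed.
Lemma innerZl (a : R[i]) f h : inner (a *: f) h = a * inner f h.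
Proof. by rewrite -[a *: f]addr0 innerPl inner0l addr0. Qed.
Lemma innerNl f h : inner (- f) h = - inner f h.
Proof. by rewrite -scaleN1r innerZl mulN1r. Qed.
Lemma innerBl f g h : inner (f - g) h = inner f h - inner g h.
Proof. by rewrite innerDl innerNl. Qed.
Lemma inner_suml (I : Type) (r : seq I) (P : pred I) (F : I -> H) h :
  inner (\sum_(i <- r | P i) F i) h = \sum_(i <- r | P i) inner (F i) h.
Proof.
exact: (big_morph (fun f => inner f h) (fun f g => innerDl f g h) (inner0l h)).
Qed.
Lemma innerDr f g h : inner f (g + h) = inner f g + inner f h.
Proof. by rewrite innerC innerDl conjD -!innerC. Qed.
Lemma inner0r f : inner f 0 = 0.
Proof. by rewrite innerC inner0l rmorph0. Qed.
Lemma innerZr (a : R[i]) f h : inner f (a *: h) = (a^*)%C * inner f h.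
Proof. by rewrite innerC innerZl conjM -innerC. Qed.
Lemma innerNr f h : inner f (- h) = - inner f h.
Proof. by rewrite innerC innerNl conjN -innerC. Qed.
Lemma innerBr f g h : inner f (g - h) = inner f g - inner f h.
Proof. by rewrite innerDr innerNr. Qed.
Lemma inner_sumr (I : Type) (r : seq I) (P : pred I) (F : I -> H) h :
  inner h (\sum_(i <- r | P i) F i) = \sum_(i <- r | P i) inner h (F i).
Proof.
exact: (big_morph (fun f => inner h f) (fun f g => innerDr h f g) (inner0r h)).
Qed.

Lemma xiE v w : xi R v w = (w == v)%:R. Proof. by []. Qed.

Lemma inner_xir f w : inner f (xi R w) = f w.
Proof.
apply: net_sum_unique (inner_net_sum _ _) _.
have := @net_sum_finite R W (fun v => f v * ((xi R w v)^*)%C) [:: w] isT.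
rewrite big_seq1 xiE eqxx rmorph1 mulr1; apply => v.
by rewrite inE xiE => /negbTE ->; rewrite rmorph0 mulr0.
Qed.
Lemma inner_xil f w : inner (xi R w) f = ((f w)^*)%C.
Proof. by rewrite innerC inner_xir. Qed.

Lemma sqn0 : sqn 0 = 0.
Proof. by have : (sqn 0)%:C = 0 :> R[i]; [rewrite -inner_diag inner0l|case]. Qed.
Lemma sqnZ (c : R[i]) f : sqn (c *: f) = normc c ^+ 2 * sqn f.
Proof.
suff : (sqn (c *: f))%:C = (normc c ^+ 2 * sqn f)%:C by case.
by rewrite -inner_diag innerZl innerZr mulrA mulc_conj inner_diag -realcM.
Qed.
Lemma sqnN f : sqn (- f) = sqn f.
Proof. by rewrite -scaleN1r sqnZ normcN normc1 expr1n mul1r. Qed.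
Lemma sqn_xi w : sqn (xi R w) = 1.
Proof.
suff : (sqn (xi R w))%:C = 1 :> R[i] by case.
by rewrite -inner_diag inner_xir xiE eqxx.
Qed.
Lemma sqnD f g : sqn (f + g) = sqn f + sqn g + 2 * complex.Re (inner f g).
Proof.
have := form_sqD innerPl innerC inner_diag f g 1.
rewrite scale1r normc1 expr1n !mul1r (addrC g) => ->; rewrite innerC.
by case: (inner f g) => a b /=; ring.
Qed.
Lemma sqn_eq0 f : sqn f = 0 -> f = 0.
Proof.
move=> f0; apply: l2P => w; apply/eqP; rewrite -normc_eq0 -sqrf_eq0.
by rewrite eq_le sqr_ge0 -f0 coord_le_sqn.
Qed.

Lemma l2norm_ge0 f : 0 <= l2norm f. Proof. exact: sqrtr_ge0. Qed.
Lemma l2norm_sqr f : l2norm f ^+ 2 = sqn f.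
Proof. by rewrite sqr_sqrtr ?sqn_ge0. Qed.
Lemma normc_inner_le f g : normc (inner f g) <= l2norm f * l2norm g.
Proof.
rewrite -(@ler_pXn2r _ 2) // ?nnegrE ?normc_ge0 ?mulr_ge0 ?l2norm_ge0 //.
by rewrite exprMn !l2norm_sqr inner_CS.
Qed.
Lemma l2norm0 : l2norm (0 : H) = 0.
Proof. by apply/eqP; rewrite -sqrf_eq0 l2norm_sqr sqn0. Qed.
Lemma l2normZ (c : R[i]) f : l2norm (c *: f) = normc c * l2norm f.
Proof.
apply/eqP; rewrite -(@eqrXn2 _ 2) ?mulr_ge0 ?normc_ge0 ?l2norm_ge0 //.
by rewrite exprMn !l2norm_sqr sqnZ.
Qed.
Lemma l2normN f : l2norm (- f) = l2norm f.
Proof. by rewrite -scaleN1r l2normZ normcN normc1 mul1r. Qed.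
Lemma le_l2normD f g : l2norm (f + g) <= l2norm f + l2norm g.
Proof.
rewrite -(@ler_pXn2r _ 2) // ?nnegrE ?addr_ge0 ?l2norm_ge0 //.
rewrite sqrrD !l2norm_sqr sqnD.
have := le_trans (ler_norm _) (Re_le_normc (inner f g)).
have := normc_inner_le f g; lra.
Qed.
Lemma l2norm_xi w : l2norm (xi R w) = 1.
Proof.
by apply/eqP; rewrite -(@eqrXn2 _ 2) ?l2norm_ge0 // l2norm_sqr sqn_xi expr1n.
Qed.
Lemma l2norm_eq0 f : l2norm f = 0 -> f = 0.
Proof. by move=> f0; apply: sqn_eq0; rewrite -l2norm_sqr f0 expr0n. Qed.
Lemma l2norm_le f (M : R) : 0 <= M -> (l2norm f <= M) = (sqn f <= M ^+ 2).
Proof. by move=> M0; rewrite -l2norm_sqr ler_pXn2r ?nnegrE ?l2norm_ge0. Qed.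

Lemma normc_coord_le f w : normc (f w) <= l2norm f.
Proof.
rewrite -(@ler_pXn2r _ 2) // ?nnegrE ?normc_ge0 ?l2norm_ge0 //.
by rewrite l2norm_sqr coord_le_sqn.
Qed.

Definition trunc s (c : W -> R[i]) : H := \sum_(w <- s) c w *: xi R w.

Lemma truncE s c w : uniq s -> trunc s c w = if w \in s then c w else 0.
Proof.
move=> us; rewrite l2_sumE; case: ifPn => ws.
  rewrite (bigD1_seq w) // l2_ZE xiE eqxx mulr1 big1; first exact: addr0.
  by move=> v vw; rewrite l2_ZE xiE eq_sym (negbTE vw) mulr0.
rewrite big_seq big1 // => v vs; rewrite l2_ZE xiE.
by case: eqP => [wv|]; [rewrite wv vs in ws|rewrite mulr0].
Qed.

Lemma truncD s c d : trunc s (fun w => c w + d w) = trunc s c + trunc s d.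
Proof. by rewrite -big_split; apply: eq_bigr => w _; exact: scalerDl. Qed.

Lemma inner_trunc s c g : inner (trunc s c) g = \sum_(w <- s) c w * ((g w)^*)%C.
Proof.
by rewrite inner_suml; apply: eq_bigr => w _; rewrite innerZl inner_xil.
Qed.

Lemma sqn_trunc s c : uniq s -> sqn (trunc s c) = \sum_(w <- s) normc (c w) ^+ 2.
Proof.
move=> us; suff : (sqn (trunc s c))%:C = (\sum_(w <- s) normc (c w) ^+ 2)%:C by case.
rewrite -inner_diag inner_trunc // realc_sum; apply: eq_big_seq => w ws.
by rewrite truncE // ws mulc_conj.
Qed.

Lemma l2norm_trunc_le s c : l2norm (trunc s c) <= \sum_(w <- s) normc (c w).
Proof.
rewrite /trunc; elim: s => [|w s IHs]; first by rewrite !big_nil l2norm0.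
rewrite !big_cons; apply: le_trans (le_l2normD _ _) _; apply: lerD => //.
by rewrite l2normZ l2norm_xi mulr1.
Qed.

Lemma sqn_sub_trunc s f : uniq s ->
  sqn (f - trunc s f) = sqn f - \sum_(w <- s) normc (f w) ^+ 2.
Proof.
move=> us; rewrite sqnD sqnN sqn_trunc // innerNr innerC inner_trunc //.
rewrite (_ : \sum_(w <- s) _ * _ = (\sum_(w <- s) normc (f w) ^+ 2)%:C).
  by rewrite conjc_real -realcN /=; ring.
by rewrite realc_sum; apply: eq_bigr => w _; rewrite mulc_conj.
Qed.

Lemma trunc_approx f (e : R) : 0 < e -> exists2 s, uniq s &
  forall t, uniq t -> {subset s <= t} -> l2norm (f - trunc t f) <= e.
Proof.
move=> e0; have e20 : 0 < e ^+ 2 by rewrite exprn_gt0.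
have [s us hs] := psum_approx (fun w => sqr_ge0 (normc (f w))) (l2_fin f) e20.
exists s => // t ut st; rewrite (l2norm_le _ (ltW e0)) sqn_sub_trunc // lerBlDl.
rewrite -lerBlDr; apply: le_trans hs _; apply: psum_mono => // w.
exact: sqr_ge0.
Qed.

End L2Geometry.

(** * Bounded operators and completeness *)

Section LinearMaps.
Variables (R : realType) (W : choiceType).
Local Notation H := (l2 R W).
Variable A : H -> H.
Hypothesis linA : linear A.

Lemma lin0 : A 0 = 0.
Proof. by have := linA (-1) 0 0; rewrite scaler0 addr0 scaleN1r addNr. Qed.
Lemma linD f g : A (f + g) = A f + A g.
Proof. by rewrite -[f]scale1r linA !scale1r. Qed.
Lemma linZ (c : R[i]) f : A (c *: f) = c *: A f.
Proof. by rewrite -[c *: f]addr0 linA lin0 addr0. Qed.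
Lemma linN f : A (- f) = - A f.
Proof. by rewrite -scaleN1r linZ scaleN1r. Qed.
Lemma linB f g : A (f - g) = A f - A g.
Proof. by rewrite linD linN. Qed.
Lemma lin_sum (I : Type) (r : seq I) (P : pred I) (F : I -> H) :
  A (\sum_(i <- r | P i) F i) = \sum_(i <- r | P i) A (F i).
Proof. exact: (big_morph A linD lin0). Qed.
End LinearMaps.

Lemma small_power (R : realType) (r e : R) : 0 <= r -> r < 1 -> 0 < e ->
  exists N : nat, forall n, (N <= n)%N -> r ^+ n <= e.
Proof.
move=> r0 r1 e0; have : `|r| < 1 by rewrite ger0_norm.
move=> /cvg_expr /cvgrPdist_le /(_ _ e0) [N _ hN]; exists N => n Nn.
by have := hN _ Nn; rewrite /= sub0r normrN ger0_norm // exprn_ge0.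
Qed.

(** The rate is part of the conclusion: a tail with oscillation at most e lies
    within e of the limit, without any loss in e. Applied to all coordinates at
    once, it yields estimates that are uniform in the coordinate. *)
Lemma real_cauchy_limit (R : realType) (a : nat -> R) :
  (forall e : R, 0 < e -> exists N : nat, forall n m, (N <= n)%N -> (N <= m)%N ->
     a n - a m <= e) ->
  exists x : R, forall (e : R) (N : nat), 0 <= e ->
    (forall n m, (N <= n)%N -> (N <= m)%N -> a n - a m <= e) ->
    forall n, (N <= n)%N -> `|a n - x| <= e.
Proof.
move=> cau; pose S := [set y : R | exists N : nat, forall n, (N <= n)%N -> y <= a n].
have inS (e : R) N n : (forall n m, (N <= n)%N -> (N <= m)%N -> a n - a m <= e) ->
    (N <= n)%N -> S (a n - e).
  by move=> h Nn; exists N => m Nm; have := h _ _ Nn Nm; lra.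
have ubS (e : R) N n : (forall n m, (N <= n)%N -> (N <= m)%N -> a n - a m <= e) ->
    (N <= n)%N -> ubound S (a n + e).
  move=> h Nn y [N' hy]; have := hy (maxn N N') (leq_maxr _ _).
  by have := h _ n (leq_maxl N N') Nn; lra.
have [N0 h0] := cau 1 ltr01.
have hs : has_sup S.
  by split; [exists (a N0 - 1); exact: inS h0 (leqnn _)|
    exists (a N0 + 1); exact: ubS h0 (leqnn _)].
exists (sup S) => e N e0 h n Nn; rewrite ler_norml; apply/andP; split.
  have : sup S <= a n + e by apply: ge_sup; [case: hs|apply: ubS h Nn].
  lra.
have : a n - e <= sup S by apply: ub_le_sup; [case: hs|apply: inS h Nn].
lra.
Qed.

Lemma damped_le (R : realType) (N X e : R) : 0 <= N -> 0 <= X -> 0 <= e ->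
  N * (e / (N * X + 1)) * X <= e.
Proof.
move=> N0 X0 e0; have D0 : 0 < N * X + 1 by rewrite ltr_wpDl // mulr_ge0.
have -> : N * (e / (N * X + 1)) * X = e * (N * X) / (N * X + 1).
  by field; rewrite gt_eqF.
by rewrite ler_pdivrMr // ler_wpM2l // lerDl.
Qed.

Section BoundedOperators.
Variables (R : realType) (W : choiceType).
Local Notation H := (l2 R W).
Implicit Types (A B T : H -> H) (f g : H) (w v : W) (s t : seq W).

Lemma bounded_linear A : bounded_operator A -> linear A.
Proof. by move=> [lA _]. Qed.

Lemma bounded_bound A : bounded_operator A ->
  exists2 M : R, 0 <= M & forall f, l2norm (A f) <= M * l2norm f.
Proof.
move=> [_ [M hM]]; exists `|M| => // f; apply: le_trans (hM f) _.
by rewrite ler_wpM2r ?l2norm_ge0 ?ler_norm.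
Qed.

Lemma bounded_of_sqn A (M : R) : linear A ->
  (forall f, sqn (A f) <= M * sqn f) -> bounded_operator A.
Proof.
move=> linA hM; split=> //; exists (Num.sqrt `|M|) => f.
rewrite l2norm_le ?mulr_ge0 ?sqrtr_ge0 ?l2norm_ge0 // exprMn sqr_sqrtr //.
rewrite l2norm_sqr; apply: le_trans (hM f) _.
by rewrite ler_wpM2r ?sqn_ge0 ?ler_norm.
Qed.

Lemma bounded0 : bounded_operator (0 : H -> H).
Proof.
split=> [c f g|]; first by rewrite scaler0 addr0.
by exists 0 => f; rewrite mul0r l2norm0.
Qed.
Lemma bounded_id : bounded_operator (id : H -> H).
Proof. by split=> [c f g //|]; exists 1 => f; rewrite mul1r. Qed.
Lemma boundedD A B : bounded_operator A -> bounded_operator B ->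
  bounded_operator (A + B).
Proof.
move=> [lA [M hM]] [lB [N hN]]; split=> [c f g|].
  rewrite -[(A + B) _]/(A _ + B _) lA lB -[(A + B) f]/(A f + B f).
  by rewrite -[(A + B) g]/(A g + B g) scalerDr addrACA.
exists (M + N) => f; apply: le_trans (le_l2normD _ _) _.
by rewrite mulrDl lerD.
Qed.
Lemma boundedZ (c : R[i]) A : bounded_operator A -> bounded_operator (c *: A).
Proof.
move=> [lA [M hM]]; split=> [d f g|].
  rewrite -[(c *: A) _]/(c *: A _) lA -[(c *: A) f]/(c *: A f).
  by rewrite -[(c *: A) g]/(c *: A g) scalerDr !scalerA mulrC.
exists (normc c * M) => f; rewrite -[(c *: A) f]/(c *: A f) l2normZ -mulrA.
by rewrite ler_wpM2l ?normc_ge0.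
Qed.
Lemma bounded_comp A B : bounded_operator A -> bounded_operator B ->
  bounded_operator (A \o B).
Proof.
move=> bA [lB [N hN]]; have [M M0 hM] := bounded_bound bA.
split=> [c f g|] /=; first by rewrite lB (bounded_linear bA).
exists (M * N) => f; apply: le_trans (hM _) _.
by rewrite -mulrA ler_wpM2l.
Qed.

(** Finitely supported vectors are dense and F is continuous. *)
Lemma functional_density (F : H -> R[i]) (M : R) :
  (forall (a : R[i]) f g, F (a *: f + g) = a * F f + F g) ->
  (forall f, normc (F f) <= M * l2norm f) ->
  (forall w, F (xi R w) = 0) -> forall f, F f = 0.
Proof.
move=> linF hM F0 f.
have F_0 : F 0 = 0.
  have := linF (-1) 0 0; rewrite scaler0 addr0 mulN1r addNr => h; exact: h.
have Ft s : F (trunc s f) = 0.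
  rewrite /trunc; elim: s => [|w s IHs]; first by rewrite big_nil.
  by rewrite big_cons linF F0 mulr0 add0r.
apply: normc_small => e e0.
have [s us /(_ s us (fun _ => id)) hs] := trunc_approx f
  (divr_gt0 e0 (ltr_wpDl (normr_ge0 M) ltr01)).
have -> : F f = F (f - trunc s f).
  by have := linF 1 (f - trunc s f) (trunc s f); rewrite Ft scale1r subrK mul1r addr0.
apply: le_trans (hM _) _.
rewrite ler_pdivlMr in hs; last by rewrite ltr_wpDl.
apply: le_trans hs; rewrite mulrC ler_wpM2l ?l2norm_ge0 //.
by apply: le_trans (ler_norm M) _; rewrite lerDl.
Qed.

Lemma operator_density A B : bounded_operator A -> bounded_operator B ->
  (forall w, A (xi R w) = B (xi R w)) -> A = B.
Proof.
move=> bA bB h; apply/funext => f; apply: l2P => w; apply/eqP.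
rewrite -subr_eq0; apply/eqP.
have [lA [M hM]] := bA; have [lB [N hN]] := bB.
apply: (@functional_density (fun f => A f w - B f w) (M + N)) => [a g k|g|v].
- by rewrite lA lB !l2_DE !l2_ZE; ring.
- apply: le_trans (le_normcD _ _) _; rewrite normcN mulrDl.
  by apply: lerD; apply: le_trans (normc_coord_le _ _) _.
- by rewrite h subrr.
Qed.

Lemma inner_trunc2 T s (c d : W -> R[i]) : linear T ->
  inner (T (trunc s c)) (trunc s d) =
  \sum_(w <- s) \sum_(v <- s) c w * ((d v)^*)%C * T (xi R w) v.
Proof.
move=> linT; rewrite (lin_sum linT) inner_suml; apply: eq_bigr => w _.
rewrite (linZ linT) innerZl inner_sumr mulr_sumr; apply: eq_bigr => v _.
by rewrite innerZr inner_xir; ring.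
Qed.

Lemma l2norm_trunc s f : uniq s -> l2norm (trunc s f) <= l2norm f.
Proof.
by move=> us; rewrite l2norm_le ?l2norm_ge0 // l2norm_sqr sqn_trunc // psum_le_sqn.
Qed.

Lemma trunc_approx2 f g (e : R) : 0 < e -> exists2 s, uniq s &
  l2norm (f - trunc s f) <= e /\ l2norm (g - trunc s g) <= e.
Proof.
move=> e0; have [s1 us1 h1] := trunc_approx f e0; have [s2 us2 h2] := trunc_approx g e0.
exists (undup (s1 ++ s2)); rewrite ?undup_uniq //.
by split; [apply: h1|apply: h2]; rewrite ?undup_uniq // => w ws;
  rewrite mem_undup mem_cat ws ?orbT.
Qed.

(** The error of replacing f and g by truncations is controlled by a norm bound
    for T alone, so it is the same for a whole bounded family of operators. *)
Lemma truncated_form_le T s f g (N e : R) : 0 <= N ->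
  (forall h, l2norm (T h) <= N * l2norm h) -> linear T -> uniq s ->
  l2norm (f - trunc s f) <= e -> l2norm (g - trunc s g) <= e ->
  normc (inner (T f) g - inner (T (trunc s f)) (trunc s g)) <=
  N * e * (l2norm f + l2norm g).
Proof.
move=> N0 hN linT us hf hg.
have -> : inner (T f) g - inner (T (trunc s f)) (trunc s g) =
    inner (T (f - trunc s f)) g + inner (T (trunc s f)) (g - trunc s g).
  by rewrite (linB linT) innerBl innerBr; ring.
have e0 : 0 <= e by apply: le_trans (l2norm_ge0 _) hf.
apply: le_trans (le_normcD _ _) _; rewrite mulrDr addrC; apply: lerD.
  apply: le_trans (normc_inner_le _ _) _.
  rewrite mulrAC; apply: ler_pM; rewrite ?l2norm_ge0 //.
  by apply: le_trans (hN _) _; rewrite ler_wpM2l // l2norm_trunc.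
apply: le_trans (normc_inner_le _ _) _; rewrite ler_wpM2r ?l2norm_ge0 //.
by apply: le_trans (hN _) _; rewrite ler_wpM2l.
Qed.

Lemma coord_limit (phi : R[i] -> R) (u : nat -> H) :
  (forall a b, phi a - phi b <= normc (a - b)) ->
  (forall e : R, 0 < e -> exists N : nat, forall n m, (N <= n)%N -> (N <= m)%N ->
     l2norm (u n - u m) <= e) ->
  exists x : W -> R, forall w (e : R) (N : nat), 0 <= e ->
    (forall n m, (N <= n)%N -> (N <= m)%N -> l2norm (u n - u m) <= e) ->
    forall n, (N <= n)%N -> `|phi (u n w) - x w| <= e.
Proof.
move=> phi1 cau; suff /choice[x hx] : forall w, exists x : R,
    forall (e : R) (N : nat), 0 <= e ->
    (forall n m, (N <= n)%N -> (N <= m)%N -> l2norm (u n - u m) <= e) ->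
    forall n, (N <= n)%N -> `|phi (u n w) - x| <= e by exists x.
move=> w; have sub (e : R) N :
    (forall n m, (N <= n)%N -> (N <= m)%N -> l2norm (u n - u m) <= e) ->
    forall n m, (N <= n)%N -> (N <= m)%N -> phi (u n w) - phi (u m w) <= e.
  move=> h n m Nn Nm; apply: le_trans (h _ _ Nn Nm).
  by apply: le_trans (normc_coord_le _ w); exact: phi1.
have [e e0|x hx] := @real_cauchy_limit R (fun n => phi (u n w)).
  by have [N /sub hN] := cau e e0; exists N.
by exists x => e N e0 /sub; exact: hx.
Qed.

Lemma small_finite_sum (a : nat -> W -> R[i]) s :
  (forall w (e : R), 0 < e -> exists N, forall n, (N <= n)%N -> normc (a n w) <= e) ->
  forall e : R, 0 < e ->
  exists N, forall n, (N <= n)%N -> \sum_(w <- s) normc (a n w) <= e.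
Proof.
move=> h; elim: s => [|w s IHs] e e0.
  by exists 0%N => n _; rewrite big_nil ltW.
have e20 : 0 < e / 2 by rewrite divr_gt0.
have [N hN] := IHs _ e20; have [N' hN'] := h w _ e20.
exists (maxn N N') => n; rewrite geq_max => /andP[Nn N'n].
by rewrite big_cons [leRHS](splitr e) lerD ?hN ?hN'.
Qed.

(** The coordinates converge. For fixed n the sums over finite sets of |u n - z|^2
    are limits of such sums for u n - u m, which bounds them by e^2 uniformly in
    the finite set; hence z is square summable and the convergence takes place in
    norm. *)
Lemma l2_complete (u : nat -> H) :
  (forall e : R, 0 < e -> exists N : nat, forall n m, (N <= n)%N -> (N <= m)%N ->
     l2norm (u n - u m) <= e) ->
  exists l, forall e : R, 0 < e -> exists N : nat, forall n, (N <= n)%N ->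
     l2norm (u n - l) <= e.
Proof.
move=> cau.
have [|x hx] := @coord_limit (@complex.Re R) u _ cau.
  by move=> [a b] [c d]; apply: le_trans (Re_le_normc _); exact: ler_norm.
have [|y hy] := @coord_limit (@complex.Im R) u _ cau.
  move=> [a b] [c d]; apply: le_trans (ler_norm _) _ => /=.
  by rewrite -sqrtr_sqr ler_wsqrtr // lerDr sqr_ge0.
pose z w := x w +i* y w.
have zlim w (e : R) : 0 < e -> exists N, forall n, (N <= n)%N -> normc (u n w - z w) <= e.
  move=> e0; have e20 : 0 < e / 2 by rewrite divr_gt0.
  have [N hN] := cau _ e20; exists N => n Nn.
  apply: le_trans (normc_le_ReIm _) _; rewrite [leRHS](splitr e).
  have := hx w _ _ (ltW e20) hN n Nn; have := hy w _ _ (ltW e20) hN n Nn.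
  by rewrite /z; case: (u n w) => a b /= h1 h2; apply: lerD.
have fin (e : R) N n s : 0 <= e ->
    (forall n m, (N <= n)%N -> (N <= m)%N -> l2norm (u n - u m) <= e) ->
    (N <= n)%N -> uniq s -> \sum_(w <- s) normc (u n w - z w) ^+ 2 <= e ^+ 2.
  move=> e0 hN Nn us; rewrite -(@sqn_trunc R W s (fun w => u n w - z w)) //.
  rewrite -(l2norm_le _ e0); apply/ler_addgt0Pr => eta eta0.
  have [N' hN'] := small_finite_sum s zlim eta0.
  pose m := maxn N N'.
  have -> : trunc s (fun w => u n w - z w) =
      trunc s (u n - u m) + trunc s (fun w => u m w - z w).
    rewrite -truncD; congr trunc; apply/funext => w.
    by rewrite -[(u n - u m) w]/(u n w - u m w) addrA subrK.
  apply: le_trans (le_l2normD _ _) _; apply: lerD.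
    apply: le_trans (hN n m Nn (leq_maxl _ _)); rewrite l2norm_le ?l2norm_ge0 //.
    by rewrite l2norm_sqr sqn_trunc // psum_le_sqn.
  by apply: le_trans (l2norm_trunc_le _ _) (hN' m (leq_maxr _ _)).
have [N1 hN1] := cau 1 ltr01.
have dP : (fun w => u N1 w - z w) \in @l2_pred R W.
  by apply: (@l2_predP _ _ _ (1 ^+ 2)) => s us; exact: fin ler01 hN1 (leqnn N1) us.
exists (u N1 - L2 dP) => e e0; have [N hN] := cau _ e0; exists N => n Nn.
rewrite (l2norm_le _ (ltW e0)); apply: sqn_le => s us.
apply: le_trans (fin _ _ n s (ltW e0) hN Nn us); rewrite le_eqVlt; apply/orP; left.
apply/eqP; apply: eq_bigr => w _; congr (normc _ ^+ 2).
by rewrite -[(u n - _) w]/(u n w - (u N1 w - (u N1 w - z w))); ring.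
Qed.

(** The Neumann series of T applied to v converges geometrically. *)
Lemma contraction_solve T (v : H) : linear T ->
  (forall f, l2norm (T f) <= 2^-1 * l2norm f) ->
  exists2 u, u = v + T u & l2norm u <= 2 * l2norm v.
Proof.
move=> linT hT; pose u := fix u n := if n is n'.+1 then v + T (u n') else 0.
have ub n : l2norm (u n) <= 2 * l2norm v.
  elim: n => [|n IHn] /=; first by rewrite l2norm0 mulr_ge0 ?l2norm_ge0.
  by apply: le_trans (le_l2normD _ _) _; have := hT (u n); lra.
have diff n k : l2norm (u (n + k)%N - u n) <= 2^-1 ^+ n * (2 * l2norm v).
  elim: n => [|n IHn]; first by rewrite subr0 expr0 mul1r add0n.
  rewrite addSn /= opprD addrACA subrr add0r -(linB linT) exprS -mulrA.
  by apply: le_trans (hT _) _; rewrite ler_wpM2l.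
have d0 n m N (e : R) : (N <= n)%N -> (N <= m)%N ->
    2^-1 ^+ N * (2 * l2norm v) <= e / 2 -> l2norm (u n - u m) <= e.
  move=> Nn Nm le; rewrite -(subnKC Nn) -(subnKC Nm).
  have -> : u (N + (n - N))%N - u (N + (m - N))%N =
     (u (N + (n - N))%N - u N) - (u (N + (m - N))%N - u N).
    by rewrite opprB addrA subrK.
  apply: le_trans (le_l2normD _ _) _; rewrite l2normN [leRHS](splitr e).
  by apply: lerD; apply: le_trans (diff _ _) _.
have cau (e : R) : 0 < e -> exists N : nat, forall n m,
    (N <= n)%N -> (N <= m)%N -> l2norm (u n - u m) <= e.
  move=> e0; have c0 : 0 < 2 * l2norm v + 1.
    by rewrite ltr_wpDl ?mulr_ge0 ?l2norm_ge0.
  have [|||N hN] := @small_power R 2^-1 (e / 2 / (2 * l2norm v + 1)).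
  - by rewrite invr_ge0.
  - by rewrite invf_lt1 // ltr1n.
  - by rewrite !divr_gt0.
  exists N => n m Nn Nm; apply: d0 Nn Nm _.
  have := hN N (leqnn N); rewrite ler_pdivlMr // mulrDr mulr1.
  apply: le_trans; rewrite lerDl exprn_ge0 // invr_ge0 //.
have [l hl] := l2_complete cau; exists l.
  apply/eqP; rewrite -subr_eq0; apply/eqP; apply: l2norm_eq0; apply/eqP.
  rewrite eq_le l2norm_ge0 andbT; apply/ler_addgt0Pr => e e0; rewrite add0r.
  have [N hN] := hl _ (divr_gt0 e0 (ltr0n _ 2 : 0 < 2)).
  have -> : l - (v + T l) = - (u N.+1 - l) + T (u N - l).
    by rewrite /= (linB linT) opprB !opprD !addrA subrK.
  apply: le_trans (le_l2normD _ _) _; rewrite l2normN.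
  have := hN _ (leqnSn N); have := hN _ (leqnn N); have := hT (u N - l).
  have := l2norm_ge0 (u N - l); lra.
apply/ler_addgt0Pr => e e0; have [N hN] := hl e e0.
have -> : l = u N - (u N - l) by rewrite opprB addrCA subrr addr0.
apply: le_trans (le_l2normD _ _) _; rewrite l2normN.
by apply: lerD; [exact: ub|exact: hN].
Qed.

End BoundedOperators.

(** * Construction of operators, and weighted minimisation *)

Section Synthesis.
Variables (R : realType) (W : choiceType).
Local Notation H := (l2 R W).
Implicit Types (f g h : H) (w v : W) (s t : seq W).

(** A bound on finite sums of squares passes to limits of the summands. *)
Lemma finsum_limit (c : W -> R[i]) s (K : R) : 0 <= K -> uniq s ->
  (forall e : R, 0 < e -> exists2 d : W -> R[i],
     \sum_(w <- s) normc (c w - d w) <= e &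
     \sum_(w <- s) normc (d w) ^+ 2 <= K) ->
  \sum_(w <- s) normc (c w) ^+ 2 <= K.
Proof.
move=> K0 us h; rewrite -(@sqn_trunc R W s) // -(sqr_sqrtr K0).
rewrite -l2norm_le ?sqrtr_ge0 //; apply/ler_addgt0Pr => e /h[d cd dK].
have -> : trunc s c = trunc s d + trunc s (fun w => c w - d w).
  by rewrite -truncD; congr trunc; apply/funext => w; rewrite addrC subrK.
apply: le_trans (le_l2normD _ _) _; apply: lerD.
  by rewrite l2norm_le ?sqrtr_ge0 // sqr_sqrtr // sqn_trunc.
by apply: le_trans (l2norm_trunc_le _ _) _.
Qed.

Section OperatorOfImages.
Variables (b : W -> H) (M : R).
Hypothesis M0 : 0 <= M.
Hypothesis b_le : forall s (c : W -> R[i]), uniq s ->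
  sqn (\sum_(w <- s) c w *: b w) <= M * \sum_(w <- s) normc (c w) ^+ 2.

(** Test the bound on the combination whose coefficients are the conjugates of the
    row: its v-th coordinate is the sum of squares S of the row, so S^2 <= M S. *)
Lemma image_row_l2 v : (fun w => ((b w v)^*)%C) \in @l2_pred R W.
Proof.
apply: (@l2_predP _ _ _ M) => s us.
under eq_bigr do rewrite normc_conj.
set S := \sum_(w <- s) _; have := b_le (fun w => ((b w v)^*)%C) us.
under [X in _ <= _ * X -> _]eq_bigr do rewrite normc_conj.
move=> /(le_trans (coord_le_sqn _ v)).
rewrite l2_sumE (_ : \sum_(i <- s) _ = S%:C); last first.
  by rewrite realc_sum; apply: eq_bigr => w _; rewrite l2_ZE mulrC mulc_conj.
have S0 : 0 <= S by apply: sumr_ge0 => w _; rewrite sqr_ge0.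
rewrite normc_real ger0_norm // -/S.
move: S0; rewrite le_eqVlt => /orP[/eqP <- //|S_gt0].
by rewrite expr2 ler_pM2r.
Qed.

(** The conjugated v-th row of the matrix with columns b w, so that the inner
    product of f with it is the v-th coordinate of the image of f. Defining the
    operator row by row makes its linearity evident. *)
Definition image_row v : H := L2 (image_row_l2 v).

Lemma inner_image_row s (c : W -> R[i]) v :
  inner (trunc s c) (image_row v) = (\sum_(w <- s) c w *: b w) v.
Proof.
rewrite inner_trunc l2_sumE; apply: eq_bigr => w _.
by rewrite l2_ZE; congr (_ * _); rewrite /= conjcK.
Qed.

Lemma image_op_le f s : uniq s ->
  \sum_(v <- s) normc (inner f (image_row v)) ^+ 2 <= M * sqn f.
Proof.
move=> us; apply: finsum_limit => // [|e e0]; first by rewrite mulr_ge0 ?sqn_ge0.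
pose K := \sum_(v <- s) l2norm (image_row v).
have K0 : 0 <= K by apply: sumr_ge0 => v _; exact: l2norm_ge0.
have [t ut /(_ t ut (fun _ => id)) ht] := trunc_approx f
  (divr_gt0 e0 (ltr_wpDl K0 ltr01)).
exists (fun v => inner (trunc t f) (image_row v)).
  under eq_bigr do rewrite -innerBl.
  apply: (@le_trans _ _ (\sum_(v <- s) l2norm (f - trunc t f) * l2norm (image_row v))).
    by apply: ler_sum => v _; exact: normc_inner_le.
  rewrite -mulr_sumr -/K; rewrite ler_pdivlMr in ht; last by rewrite ltr_wpDl.
  by apply: le_trans ht; rewrite ler_wpM2l ?l2norm_ge0 // lerDl.
under eq_bigr do rewrite inner_image_row.
apply: le_trans (psum_le_sqn _ us) _; apply: le_trans (b_le _ ut) _.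
by rewrite ler_wpM2l // psum_le_sqn.
Qed.

Lemma image_op_l2 f : (fun v => inner f (image_row v)) \in @l2_pred R W.
Proof. by apply: (@l2_predP _ _ _ (M * sqn f)) => s us; exact: image_op_le. Qed.

(** A family b of vectors is the family of images of the basis under a bounded
    operator as soon as the bound holds on finite combinations. *)
Lemma operator_of_images : exists F : H -> H,
  [/\ bounded_operator F, forall w, F (xi R w) = b w &
      forall f, sqn (F f) <= M * sqn f].
Proof.
pose F f := L2 (image_op_l2 f).
have F_le f : sqn (F f) <= M * sqn f.
  by apply: sqn_le => s us; exact: image_op_le.
exists F; split=> //.
  apply: (bounded_of_sqn (M := M)) => // c f g; apply: l2P => v.
  by rewrite l2_DE l2_ZE; exact: innerPl.
move=> w; apply: l2P => v; have := inner_image_row [:: w] (fun=> 1) v.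
by rewrite /trunc !big_seq1 !scale1r.
Qed.

End OperatorOfImages.

Section PullBack.
Variable h : W -> option W.
Hypothesis h_inj : forall v v' w, h v = Some w -> h v' = Some w -> v = v'.

Lemma pull_le f s : uniq s ->
  \sum_(v <- s) normc (oapp f 0 (h v)) ^+ 2 <= sqn f.
Proof.
move=> us; have -> : \sum_(v <- s) normc (oapp f 0 (h v)) ^+ 2 =
    \sum_(w <- pmap h s) normc (f w) ^+ 2.
  elim: (s) => [|v r IHr]; first by rewrite !big_nil.
  have -> : pmap h (v :: r) = oapp (cons^~ (pmap h r)) (pmap h r) (h v) by [].
  rewrite big_cons IHr; case: (h v) => [w|].
    by rewrite [oapp (cons^~ _) _ _]/= big_cons.
  by rewrite [oapp (cons^~ _) _ _]/= normc0 expr0n add0r.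
apply: psum_le_sqn; elim: s us => //= v s IHs /andP[vs us].
case hv : (h v) => [w|] /=; last exact: IHs.
rewrite IHs // andbT mem_pmap; apply: contra vs => /mapP[v' v's].
by move=> /esym hv'; rewrite (h_inj hv hv').
Qed.

Lemma pull_l2 f : (fun v => oapp f 0 (h v)) \in @l2_pred R W.
Proof. by apply: (@l2_predP _ _ _ (sqn f)) => s us; exact: pull_le. Qed.

(** The pullback along an injective partial map of the index set is a contraction.
    Left and right creations and their adjoints are all of this form. *)
Definition pull f : H := L2 (pull_l2 f).

Lemma pullE f v : pull f v = oapp f 0 (h v). Proof. by []. Qed.

Lemma sqn_pull f : sqn (pull f) <= sqn f.
Proof. by apply: sqn_le => s us; exact: pull_le. Qed.

Lemma l2norm_pull f : l2norm (pull f) <= l2norm f.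
Proof. by rewrite l2norm_le ?l2norm_ge0 // l2norm_sqr sqn_pull. Qed.

Lemma pull_linear : linear pull.
Proof.
move=> c f g; apply: l2P => v; rewrite l2_DE l2_ZE !pullE.
by case: (h v) => [w|] //=; rewrite mulr0 addr0.
Qed.

Lemma pull_bounded : bounded_operator pull.
Proof.
split; first exact: pull_linear.
by exists 1 => f; rewrite mul1r l2norm_pull.
Qed.

End PullBack.

End Synthesis.

Section WeightedMinimum.
Variables (R : realType) (W : choiceType).
Local Notation H := (l2 R W).
Variables (A : H -> H) (kappa : R) (w0 : W) (P : set W).
Hypotheses (bA : bounded_operator A) (k0 : 0 <= kappa) (P0 : P w0).

(** The inner product of the graph of A, with weight kappa on the second
    component. *)
Definition graph_form (f g : H) : R[i] :=
  inner f g + kappa%:C * inner (A f) (A g).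
Definition graph_sqn (f : H) : R := sqn f + kappa * sqn (A f).
Local Notation Q := graph_form.
Local Notation N := graph_sqn.

Lemma graph_form_lin (a : R[i]) f g h : Q (a *: f + g) h = a * Q f h + Q g h.
Proof. by rewrite /Q (bounded_linear bA) !innerPl; ring. Qed.
Lemma graph_form_conj f g : Q g f = ((Q f g)^*)%C.
Proof. by rewrite /Q conjD conjM conjc_real -!innerC. Qed.
Lemma graph_form_diag f : Q f f = (N f)%:C.
Proof. by rewrite /Q !inner_diag /N realcD realcM. Qed.
Lemma graph_sqn_ge0 f : 0 <= N f.
Proof. by rewrite addr_ge0 ?mulr_ge0 ?sqn_ge0. Qed.

Let adm (f : H) := f w0 = 1 /\ forall w, ~ P w -> f w = 0.
Let dir (f : H) := f w0 = 0 /\ forall w, ~ P w -> f w = 0.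

(** The minimiser of |f|^2 + kappa |A f|^2 among the vectors with coordinate 1 at
    w0 and support in P; a minimising sequence is Cauchy by the parallelogram law,
    and orthogonality to the admissible directions is the Euler-Lagrange equation
    of the problem. *)
Lemma graph_minimum : exists g : H,
  [/\ g w0 = 1, (forall w, ~ P w -> g w = 0) &
      forall k : H, k w0 = 0 -> (forall w, ~ P w -> k w = 0) -> Q k g = 0].
Proof.
pose V := [set N f | f in adm].
have admxi : adm (xi R w0).
  by split=> [|w Pw]; rewrite xiE ?eqxx //; case: eqP => // e; rewrite e in Pw.
have infV : has_inf V.
  split; first by exists (N (xi R w0)), (xi R w0).
  by exists 0 => _ [f _ <-]; exact: graph_sqn_ge0.
set mu := inf V.
have mu_le f : adm f -> mu <= N f.
  by move=> af; apply: ge_inf; [case: infV|exists f].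
have /choice[u hu] n : exists f, adm f /\ N f <= mu + (n.+1%:R)^-1.
  have [|x [f af <-] lt] := inf_adherent (_ : 0 < (n.+1%:R)^-1) infV.
    by rewrite invr_gt0.
  by exists f; split=> //; exact: ltW.
have near n (k : H) : dir k -> normc (Q k (u n)) ^+ 2 <= N k * (n.+1%:R)^-1.
  move=> [k1 k2]; have [[u1 u2] un] := hu n.
  apply: (@le_trans _ _ (N k * (N (u n) - mu))).
    apply: (form_near_min graph_form_lin graph_form_conj graph_form_diag graph_sqn_ge0).
    move=> c; apply: mu_le; split=> [|w Pw]; first by rewrite l2_DE l2_ZE k1 u1 mulr0 add0r.
    by rewrite l2_DE l2_ZE k2 ?u2 // mulr0 addr0.
  by rewrite ler_wpM2l ?graph_sqn_ge0 // lerBlDl.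
have dirB n m : dir (u n - u m).
  have [[u1 u2] _] := hu n; have [[v1 v2] _] := hu m.
  split=> [|w Pw]; first by rewrite l2_DE l2_NE u1 v1 subrr.
  by rewrite l2_DE l2_NE u2 // v2 // subrr.
(* the midpoint of two near-minimisers is admissible: parallelogram law *)
have half n m : mu <= N (2^-1%:C *: (u n - u m) + u m).
  have [[u1 u2] _] := hu n; have [[v1 v2] _] := hu m.
  apply: mu_le; split=> [|w Pw]; rewrite l2_DE l2_ZE l2_DE l2_NE.
    by rewrite u1 v1 subrr mulr0 add0r.
  by rewrite u2 // v2 // subrr mulr0 addr0.
have cau_sqn n m : sqn (u n - u m) <= 2 * (n.+1%:R)^-1 + 2 * (m.+1%:R)^-1.
  have [_ un] := hu n; have [_ um] := hu m.
  have := half n m; set d := u n - u m.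
  have eun : u n = 1 *: d + u m by rewrite scale1r subrK.
  rewrite (form_sqD graph_form_lin graph_form_conj graph_form_diag).
  move: un; rewrite {1}eun (form_sqD graph_form_lin graph_form_conj graph_form_diag).
  rewrite !normc_real normr1 mul1r => un hal.
  have kd : 0 <= kappa * sqn (A d) by rewrite mulr_ge0 ?sqn_ge0.
  have ReZ (z : R[i]) : complex.Re (2^-1%:C * z) = 2^-1 * complex.Re z.
    by case: z => a b /=; rewrite mul0r subr0.
  move: hal un um; rewrite ReZ /graph_sqn -/d.
  rewrite ger0_norm ?invr_ge0 // expr1n !mul1r.
  have -> : (2^-1 : R) ^+ 2 = 4^-1 by rewrite exprVn -natrX.
  move: (n.+1%:R^-1) (m.+1%:R^-1) => X Y; move: kd.
  move: (kappa * sqn (A d)) (kappa * sqn (A (u m))) => kd km.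
  move: (complex.Re _) (sqn d) (sqn (u m)) => x y z *; lra.
have cau (e : R) : 0 < e -> exists M : nat, forall n m,
    (M <= n)%N -> (M <= m)%N -> l2norm (u n - u m) <= e.
  move=> e0; have e40 : 0 < e ^+ 2 / 4 by rewrite divr_gt0 ?exprn_gt0.
  have [M hM] : exists M : nat, forall n, (M <= n)%N -> (n.+1%:R : R)^-1 <= e ^+ 2 / 4.
    exists (Num.bound (e ^+ 2 / 4)^-1) => n Mn.
    rewrite -[leRHS]invrK lef_pV2 ?posrE ?invr_gt0 //.
    apply: ltW; apply: lt_trans (archi_boundP _) _; first by rewrite invr_ge0 ltW.
    by rewrite ltr_nat ltnS.
  exists M => n m Mn Mm; rewrite (l2norm_le _ (ltW e0)).
  apply: le_trans (cau_sqn n m) _; have := hM n Mn; have := hM m Mm.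
  by move: (n.+1%:R^-1) (m.+1%:R^-1) => X Y; lra.
have [g hg] := l2_complete cau; exists g.
have coord w (z : R[i]) : (forall n, u n w = z) -> g w = z.
  move=> uz; apply/eqP; rewrite -subr_eq0; apply/eqP; apply: normc_small => e.
  move=> /hg[n /(_ n (leqnn n)) hn]; rewrite normcB_sym -(uz n).
  by apply: le_trans hn; apply: (normc_coord_le (u n - g)).
split=> [|w Pw|k k1 k2]; first by apply: coord => n; have [[]] := hu n.
  by apply: coord => n; have [[_ ->]] := hu n.
apply: normc_small => e e0.
have [M M0 hM] := bounded_bound bA.
have K0 : 0 < l2norm k + kappa * (M * l2norm k) * M + 1.
  by rewrite ltr_wpDl // addr_ge0 ?mulr_ge0 ?l2norm_ge0.
pose Kk := N k + 1.
have Kk0 : 0 < Kk by rewrite ltr_wpDl ?graph_sqn_ge0.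
have e20 : 0 < e / 2 by rewrite divr_gt0.
have [n1 hn1] := hg _ (divr_gt0 e20 K0).
have [n2 hn2] : exists M : nat, forall n, (M <= n)%N ->
    (n.+1%:R : R)^-1 <= (e / 2) ^+ 2 / Kk.
  exists (Num.bound ((e / 2) ^+ 2 / Kk)^-1) => n Mn.
  have X0 : 0 < (e / 2) ^+ 2 / Kk by rewrite divr_gt0 ?exprn_gt0.
  rewrite -[leRHS]invrK lef_pV2 ?posrE ?invr_gt0 //.
  apply: ltW; apply: lt_trans (archi_boundP _) _; first by rewrite invr_ge0 ltW.
  by rewrite ltr_nat ltnS.
pose n := maxn n1 n2.
have -> : Q k g = Q k (u n) - Q k (u n - g).
  by rewrite /graph_form (linB (bounded_linear bA)) !innerBr; ring.
apply: le_trans (le_normcD _ _) _; rewrite normcN [leRHS](splitr e); apply: lerD.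
  rewrite -(@ler_pXn2r _ 2) ?nnegrE ?normc_ge0 ?(ltW e20) //.
  apply: le_trans (near n k (conj k1 k2)) _.
  have := hn2 n (leq_maxr _ _); rewrite ler_pdivlMr // => le1.
  apply: le_trans le1; rewrite mulrC ler_wpM2l ?invr_ge0 //.
  by rewrite lerDl.
have := hn1 n (leq_maxl _ _); rewrite ler_pdivlMr // => le1.
apply: le_trans le1; rewrite /graph_form; set d := u n - g.
apply: le_trans (le_normcD _ _) _; rewrite normcM normc_real ger0_norm //.
have h1 := normc_inner_le k d; have h2 := normc_inner_le (A k) (A d).
have h3 : l2norm (A k) * l2norm (A d) <= M * l2norm k * (M * l2norm d).
  by rewrite ler_pM ?l2norm_ge0.
have := le_trans h2 h3; move=> h4.
have := ler_wpM2l k0 h4; have := l2norm_ge0 d; lra.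
Qed.

End WeightedMinimum.

(** * Paths, creation operators and the algebra they generate *)

Section PathCombinatorics.
Variable G : digraph.
Implicit Types (p q u v w : gpath G) (x y : vertex G) (e : edge G).

Definition vpath x : gpath G := @GPath G (x, [::]) isT.

Lemma epath_composable e : composable (esrc e, [:: e]).1 (esrc e, [:: e]).2.
Proof. by rewrite /= eqxx. Qed.
Definition epath e : gpath G := GPath (epath_composable e).

Lemma option_ext (T : Type) (a b : option T) :
  (forall t, a = Some t <-> b = Some t) -> a = b.
Proof.
case: a b => [t|] [t'|] h //; first by apply/esym/h.
- by have := proj1 (h t) erefl.
- by have := proj2 (h t') erefl.
Qed.

Lemma pprodE p q v : pprod p q = Some v <->
  [/\ psrc p = prng q, psrc v = psrc q & pedges v = pedges p ++ pedges q].
Proof.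
split=> [/pprod_Some //|[pq hs he]].
have [v' -> [hs' he']] := pprodP pq; congr Some.
by apply: gpath_eq; rewrite ?hs ?hs' ?he ?he'.
Qed.

Lemma prng_pprod p q v : pprod p q = Some v -> prng v = prng p.
Proof.
move=> /pprod_Some[pq hs he]; rewrite /prng hs he pq; by case: (pedges p).
Qed.

Lemma pprodA p q u :
  obind (fun v => pprod v u) (pprod p q) = obind (pprod p) (pprod q u).
Proof.
apply: option_ext => t.
have lhs : obind (fun v => pprod v u) (pprod p q) = Some t <->
    [/\ psrc p = prng q, psrc q = prng u, psrc t = psrc u &
        pedges t = pedges p ++ pedges q ++ pedges u].
  split.
    case pq : (pprod p q) => [v|] //= /pprodE[h1 h2 h3].
    have [h4 h5 h6] := pprod_Some pq.
    by rewrite -h5 h3 h6 catA.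
  move=> [h1 h2 h3 h4]; have [v vE [v1 v2]] := pprodP h1; rewrite vE /=.
  by apply/pprodE; rewrite v1 v2 -catA.
have rhs : obind (pprod p) (pprod q u) = Some t <->
    [/\ psrc p = prng q, psrc q = prng u, psrc t = psrc u &
        pedges t = pedges p ++ pedges q ++ pedges u].
  split.
    case qu : (pprod q u) => [v|] //= /pprodE[h1 h2 h3].
    have [h4 h5 h6] := pprod_Some qu.
    by rewrite -(prng_pprod qu) -h5 -h6.
  move=> [h1 h2 h3 h4]; have [v vE [v1 v2]] := pprodP h2; rewrite vE /=.
  by apply/pprodE; rewrite v1 v2 (prng_pprod vE).
by rewrite lhs rhs.
Qed.

Lemma end_of_cat x (es fs : seq (edge G)) :
  end_of x (es ++ fs) = end_of (end_of x fs) es.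
Proof. by case: es. Qed.

(** The mirror image of lquo: the w with v = w u, if it exists. *)
Definition rquo u v : option (gpath G) :=
  obind (fun w => if pprod w u == Some v then Some w else None)
    (insub (prng u, take (size (pedges v) - size (pedges u)) (pedges v))).

Lemma rquoP u v w : rquo u v = Some w <-> pprod w u = Some v.
Proof.
rewrite /rquo; split.
  by case: insubP => //= t _ _; case: eqP => // h [<-].
move=> h; have [hs h1 he] := pprod_Some h.
have -> : (prng u, take (size (pedges v) - size (pedges u)) (pedges v)) = val w.
  by rewrite he size_cat addnK take_size_cat // -hs -surjective_pairing.
by rewrite valK /= h eqxx.
Qed.

Lemma rquo_inj u v v' w : rquo u v = Some w -> rquo u v' = Some w -> v = v'.
Proof. by move=> /rquoP h /rquoP; rewrite h => -[]. Qed.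

Lemma lquo_inj p v v' w : lquo p v = Some w -> lquo p v' = Some w -> v = v'.
Proof. by move=> /lquoP h /lquoP; rewrite h => -[]. Qed.

Lemma pprod_injr p v v' w : pprod p v = Some w -> pprod p v' = Some w -> v = v'.
Proof. by move=> /lquoP h /lquoP; rewrite h => -[]. Qed.

Lemma pprod_injl u v v' w : pprod v u = Some w -> pprod v' u = Some w -> v = v'.
Proof. by move=> /rquoP h /rquoP; rewrite h => -[]. Qed.

Lemma lquo_rquo p u v : obind (lquo p) (rquo u v) = obind (rquo u) (lquo p v).
Proof.
apply: option_ext => q; split.
  case vu : (rquo u v) => [t|] //= /lquoP pq; move/rquoP: vu => tu.
  have := pprodA p q u; rewrite pq /= tu; case qu : (pprod q u) => [s|] //= ps.
  by have/lquoP -> := esym ps; apply/rquoP.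
case pv : (lquo p v) => [t|] //= /rquoP qu; move/lquoP: pv => pt.
have := pprodA p q u; rewrite qu /= pt; case pq : (pprod p q) => [s|] //= su.
by have/rquoP -> := su; apply/lquoP.
Qed.

Lemma pprod_vpathl x w : pprod (vpath x) w = if prng w == x then Some w else None.
Proof.
case: eqP => [<-|h]; first by apply/pprodE; split.
by rewrite pprodN // => /esym.
Qed.

Lemma pprod_vpathr x w : pprod w (vpath x) = if psrc w == x then Some w else None.
Proof.
case: eqP => [<-|h]; last by rewrite pprodN.
by apply/pprodE; rewrite cats0.
Qed.

Lemma size0_path w : pedges w = [::] -> w = vpath (psrc w).
Proof. by move=> h; apply: gpath_eq. Qed.

End PathCombinatorics.

Section CreationOperators.
Variables (R : realType) (G : digraph).
Local Notation H := (l2 R (gpath G)).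
Local Notation L p := (@left_creation R G p).
Local Notation LG := (@free_semigroupoid_algebra R G).
Local Notation xi := (@xi R (gpath G)).
Implicit Types (p q u v w : gpath G) (x y : vertex G) (e : edge G) (f g : H).

(** The operator xi_w |-> xi_(wu). *)
Definition right_creation u : H -> H := pull (@rquo_inj G u).
(** The adjoint of the left creation: xi_(pw) |-> xi_w, and xi_v |-> 0 if v does
    not begin with p. *)
Definition left_annihilation p : H -> H := pull (@pprod_injr G p).
Local Notation Rc u := (right_creation u).
Local Notation La p := (left_annihilation p).

Lemma left_creationE p f v : left_creation p f v = oapp f 0 (lquo p v).
Proof. by []. Qed.
Lemma right_creationE u f v : Rc u f v = oapp f 0 (rquo u v).
Proof. by []. Qed.
Lemma left_annihilationE p f v : La p f v = oapp f 0 (pprod p v).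
Proof. by []. Qed.

Lemma left_creation_linear p : linear (L p).
Proof. by have [] := left_creation_bounded R p. Qed.
Lemma right_creation_linear u : linear (Rc u). Proof. exact: pull_linear. Qed.

Lemma l2norm_left_creation p f : l2norm (L p f) <= l2norm f.
Proof.
have -> : L p f = pull (@lquo_inj G p) f by apply: l2P.
exact: l2norm_pull.
Qed.

Lemma right_creation_xi u w : Rc u (xi w) = oapp xi 0 (pprod w u).
Proof.
apply: l2P => v; rewrite right_creationE.
case wu : (pprod w u) => [t|] /=; case vu : (rquo u v) => [s|] //=; rewrite /xi_fun.
- move/rquoP: vu => su; congr ((_ : bool)%:R); apply/eqP/eqP => [h|h].
    by move: su; rewrite h wu => -[].
  by apply: (pprod_injl su); rewrite h.
- by case: eqP => // h; move/rquoP: wu; rewrite -h vu.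
- by case: eqP => // h; move/rquoP: vu; rewrite h wu.
Qed.

Lemma right_creation_range w : Rc w (xi (vpath (prng w))) = xi w.
Proof. by rewrite right_creation_xi pprod_vpathl eqxx. Qed.

Lemma inner_left_creation p f g : inner (L p f) g = inner f (La p g).
Proof.
apply/eqP; rewrite -subr_eq0; apply/eqP; move: f.
apply: (@functional_density _ _ _ (l2norm g + l2norm (La p g))) => [a f h|f|w].
- by rewrite left_creation_linear !innerPl; ring.
- apply: le_trans (le_normcD _ _) _; rewrite normcN mulrDl; apply: lerD.
    apply: le_trans (normc_inner_le _ _) _.
    by rewrite mulrC ler_wpM2l ?l2norm_ge0 ?l2norm_left_creation.
  by apply: le_trans (normc_inner_le _ _) _; rewrite mulrC.
- rewrite left_creation_xi [inner (xi w) _]inner_xil left_annihilationE.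
  case: (pprod p w) => [v|]; first by rewrite [oapp _ _ _]/= inner_xil subrr.
  by rewrite inner0l [oapp _ _ _]/= conjc0 subrr.
Qed.

Lemma left_creation_comp p q f :
  L p (L q f) = oapp (fun v => L v f) 0 (pprod p q).
Proof.
have hb : bounded_operator (L p \o L q) by apply: bounded_comp; exact: left_creation_bounded.
have hb' : bounded_operator (oapp (fun v => L v) 0 (pprod p q)).
  by case: (pprod p q) => [v|]; [exact: left_creation_bounded|exact: bounded0].
have : L p \o L q = oapp (fun v => L v) 0 (pprod p q).
  apply: operator_density => // w /=; rewrite left_creation_xi.
  case qw : (pprod q w) => [s|]; have := pprodA p q w; rewrite qw.
    rewrite [oapp _ _ (Some s)]/= left_creation_xi => /= <-.
    by case: (pprod p q) => [v|] //=; rewrite left_creation_xi.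
  rewrite /= (lin0 (left_creation_linear p)).
  by case: (pprod p q) => [v|] //= vw; rewrite left_creation_xi vw.
by move=> /(congr1 (fun T => T f)) /= ->; case: (pprod p q).
Qed.

(** Associativity of the product: p and u are attached at opposite ends. *)
Lemma left_right_commute p u f : L p (Rc u f) = Rc u (L p f).
Proof.
apply: l2P => v; rewrite left_creationE right_creationE.
have := lquo_rquo p u v; case: (lquo p v) (rquo u v) => [s|] [t|] //= h.
- by rewrite -[LHS]/(oapp f 0 (rquo u s)) -h.
- by rewrite -[LHS]/(oapp f 0 (rquo u s)) -h.
- by rewrite -[RHS]/(oapp f 0 (lquo p t)) h.
Qed.

Definition path_algebra : set (H -> H) :=
  smallest (@operator_algebra R (gpath G)) (range (fun p => L p)).

Lemma path_algebra_operator_algebra : operator_algebra path_algebra.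
Proof.
split.
- by move=> S [[S0 _ _ _] _].
- by move=> A B hA hB S hS; have [[_ SD _ _] _] := hS; apply: SD; [apply: hA|apply: hB].
- by move=> c A hA S hS; have [[_ _ SZ _] _] := hS; apply: SZ; apply: hA.
- by move=> A B hA hB S hS; have [[_ _ _ SM] _] := hS; apply: SM; [apply: hA|apply: hB].
Qed.

Lemma path_algebra_creation p : path_algebra (L p).
Proof. by move=> S [_ hS]; apply: hS; exists p. Qed.

Definition path_poly (s : seq (R[i] * gpath G)) : H -> H :=
  fun f => \sum_(cp <- s) cp.1 *: L cp.2 f.

(** Linear combinations of the L_p form an algebra, since a product of two of them
    is zero or another one. *)
Lemma path_algebra_poly B : path_algebra B -> exists s, B = path_poly s.
Proof.
move=> hB; apply: (hB [set B | exists s, B = path_poly s]); split; last first.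
  by move=> _ [p _ <-]; exists [:: (1, p)]; apply/funext => f;
    rewrite /path_poly big_seq1 scale1r.
split.
- by exists [::]; apply/funext => f; rewrite /path_poly big_nil.
- move=> _ _ [s ->] [t ->]; exists (s ++ t); apply/funext => f.
  by rewrite /path_poly big_cat.
- move=> c _ [s ->]; exists [seq (c * cp.1, cp.2) | cp <- s]; apply/funext => f.
  rewrite /path_poly big_map -[LHS]/(c *: \sum_(cp <- s) _) scaler_sumr.
  by apply: eq_bigr => cp _; rewrite scalerA.
- move=> _ _ [s ->] [t ->].
  exists [seq (if pprod cp.2 dq.2 is Some v then (cp.1 * dq.1, v) else (0, cp.2))
         | cp <- s, dq <- t].
  apply/funext => f; rewrite /path_poly /= big_allpairs_dep /=.
  apply: eq_bigr => cp _; rewrite (lin_sum (left_creation_linear _)) scaler_sumr.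
  apply: eq_bigr => dq _; rewrite (linZ (left_creation_linear _)) scalerA.
  rewrite left_creation_comp; case: (pprod cp.2 dq.2) => [v|] //=.
  by rewrite scaler0 scale0r.
Qed.

Lemma path_poly_bounded s : bounded_operator (path_poly s).
Proof.
elim: s => [|cp s IHs].
  have -> : path_poly [::] = 0 by apply/funext => f; rewrite /path_poly big_nil.
  exact: bounded0.
have -> : path_poly (cp :: s) = cp.1 *: L cp.2 + path_poly s.
  by apply/funext => f; rewrite /path_poly big_cons.
by apply: boundedD => //; apply: boundedZ; exact: left_creation_bounded.
Qed.

Lemma path_poly_algebra s : path_algebra (path_poly s).
Proof.
have [S0 SD SZ SM] := path_algebra_operator_algebra.
elim: s => [|cp s IHs].
  have -> // : path_poly [::] = 0 by apply/funext => f; rewrite /path_poly big_nil.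
have -> : path_poly (cp :: s) = cp.1 *: L cp.2 + path_poly s.
  by apply/funext => f; rewrite /path_poly big_cons.
by apply: SD => //; apply: SZ; exact: path_algebra_creation.
Qed.

Lemma path_algebra_bounded B : path_algebra B -> bounded_operator B.
Proof. by move=> /path_algebra_poly[s ->]; exact: path_poly_bounded. Qed.

Lemma path_algebra_sub B : path_algebra B -> LG B.
Proof.
move=> hB; have bB := path_algebra_bounded hB; split=> // fgs e e0.
exists B => // fg _; rewrite -[(B - B) _]/(B fg.1 - B fg.1) subrr inner0l normc0 //.
Qed.

Lemma creation_in_algebra p : LG (L p).
Proof. exact: path_algebra_sub (path_algebra_creation p). Qed.

Lemma algebra_bounded A : LG A -> bounded_operator A. Proof. by case. Qed.

(** An identity between finitely many matrix coefficients is preserved by linear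
    combinations and by weak operator limits, so the whole algebra inherits it
    from the L_p. *)
Lemma wot_extension (fgs : seq (H * H)) :
  (forall p, \sum_(fg <- fgs) inner (L p fg.1) fg.2 = 0) ->
  forall A, LG A -> \sum_(fg <- fgs) inner (A fg.1) fg.2 = 0.
Proof.
move=> hL A [bA hA]; apply: normc_small => e e0.
have d0 : 0 < e / (size fgs).+1%:R by rewrite divr_gt0.
have [B [/path_algebra_poly[s ->] _] hB] := hA fgs _ d0.
have h0 : \sum_(fg <- fgs) inner (path_poly s fg.1) fg.2 = 0.
  under eq_bigr do rewrite inner_suml.
  rewrite exchange_big big1 // => cp _.
  under eq_bigr do rewrite innerZl.
  by rewrite -mulr_sumr hL mulr0.
have -> : \sum_(fg <- fgs) inner (A fg.1) fg.2 =
    \sum_(fg <- fgs) (inner (A fg.1) fg.2 - inner (path_poly s fg.1) fg.2).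
  by rewrite sumrB h0 subr0.
apply: le_trans (le_normc_sum _ _) _.
apply: (@le_trans _ _ (\sum_(fg <- fgs) e / (size fgs).+1%:R)).
  rewrite !big_seq; apply: ler_sum => fg /hB; rewrite normcB_sym -innerBl => /ltW.
  exact.
rewrite big_const_seq count_predT iter_addr_0 -[leLHS]mulr_natr mulrAC ler_pdivrMr //.
by apply: ler_wpM2l; [exact: ltW|rewrite ler_nat].
Qed.

Definition right_commuting (F : H -> H) : Prop :=
  bounded_operator F /\ forall u f, F (Rc u f) = Rc u (F f).

(** Commutation with R_u is an identity between two matrix coefficients: that of A
    R_u f at v and that of A f at the w with v = w u. *)
Lemma algebra_right_commuting A : LG A -> right_commuting A.
Proof.
move=> hA; have bA := algebra_bounded hA; split=> // u f; apply: l2P => v.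
rewrite right_creationE -inner_xir; case vu : (rquo u v) => [q|] /=.
  apply/eqP; rewrite -subr_eq0 -(inner_xir (A f)) -innerNl -(linN (bounded_linear bA)).
  have := @wot_extension [:: (Rc u f, xi v); (- f, xi q)] _ A hA.
  rewrite !big_cons big_nil addr0 /= => -> // p.
  rewrite !big_cons big_nil addr0 /= (linN (left_creation_linear p)) innerNl.
  by rewrite !inner_xir left_right_commute right_creationE vu /= subrr.
have := @wot_extension [:: (Rc u f, xi v)] _ A hA.
rewrite big_seq1 /= => -> // p.
by rewrite big_seq1 /= inner_xir left_right_commute right_creationE vu.
Qed.

End CreationOperators.

(** * Fejer means and the commutant of the right creations *)

Section Fejer.
Variables (R : realType) (G : digraph).
Local Notation H := (l2 R (gpath G)).
Local Notation L p := (@left_creation R G p).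
Local Notation xi := (@xi R (gpath G)).
Implicit Types (p q u v w : gpath G) (x y : vertex G) (e : edge G) (f g : H).

Section Words.
Variables (El : seq (edge G)) (Vl : seq (vertex G)).

Fixpoint words n : seq (seq (edge G)) :=
  if n is n'.+1 then [::] :: [seq e :: es | e <- El, es <- words n'] else [:: [::]].

Lemma words_mem n es : all (mem El) es -> (size es <= n)%N -> es \in words n.
Proof.
elim: n es => [|n IHn] [|e es] //= /andP[eE aE] sz.
by rewrite inE /=; apply/allpairsP; exists (e, es); split => //=; exact: IHn.
Qed.

Definition short_paths n : seq (gpath G) :=
  undup (pmap insub [seq (y, es) | y <- Vl, es <- words n]).

Lemma short_paths_mem n q : all (mem El) (pedges q) -> psrc q \in Vl ->
  (size (pedges q) <= n)%N -> q \in short_paths n.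
Proof.
move=> aE sV sz; rewrite mem_undup mem_pmap; apply/mapP; exists (val q).
  apply/allpairsP; exists (psrc q, pedges q); split => //=; first exact: words_mem.
  exact: surjective_pairing.
by rewrite valK.
Qed.

Definition alien_pos w := find (predC (mem El)) (pedges w).
(** What remains of w after its longest beginning (read from the left) over El.
    Left multiplication by q preserves it exactly when all edges of q lie in
    El. *)
Definition alien_tail w := (psrc w, drop (alien_pos w) (pedges w)).

Lemma alien_prod q w v : pprod q w = Some v ->
  (alien_tail v == alien_tail w) = all (mem El) (pedges q) /\
  (all (mem El) (pedges q) -> alien_pos v = (size (pedges q) + alien_pos w)%N).
Proof.
move=> /pprodE[_ hs he]; rewrite /alien_tail /alien_pos hs he find_cat.
have has_all : has (predC (mem El)) (pedges q) = ~~ all (mem El) (pedges q).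
  by rewrite has_predC.
rewrite has_all; case: (boolP (all _ _)) => aE /=; split=> //.
  apply/eqP; congr pair; rewrite drop_cat ltnNge leq_addr /=.
  by rewrite addKn.
apply/negP => /eqP[/(congr1 size)]; rewrite !size_drop size_cat.
have : (find (predC (mem El)) (pedges q) < size (pedges q))%N.
  by rewrite -has_find has_all.
move: (find _ _) (find _ _) (size _) (size _) => a b c d; lia.
Qed.

End Words.

Variables (F : H -> H) (M : R).
Hypotheses (cF : right_commuting F) (M0 : 0 <= M).
Hypothesis F_le : forall f, l2norm (F f) <= M * l2norm f.

(** The Fourier coefficient of A at q. *)
Definition symbol (A : H -> H) q : R[i] := A (xi (vpath (psrc q))) q.

(** The vector xi w is the image of a vertex vector under R_w, so a commuting
    operator is determined by its symbol. *)
Lemma commuting_coef (A : H -> H) w v : right_commuting A ->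
  A (xi w) v = oapp (symbol A) 0 (rquo w v).
Proof.
move=> [_ cA]; rewrite -[in LHS]right_creation_range cA right_creationE.
case wv : (rquo w v) => [q|] //=; rewrite /symbol.
by move/rquoP: wv => /pprodE[-> _ _].
Qed.

Section Approximant.
Variables (El : seq (edge G)) (Vl : seq (vertex G)) (K : nat).
Hypothesis K_gt0 : (0 < K)%N.

(** Only finitely many paths have a nonzero weight, and each weight increases to 1
    as El, Vl and K grow. The cutoff by the edges in El is needed besides the one
    by length, since there may be infinitely many paths of a given length. *)
Definition fejer_weight q : R :=
  if all (mem El) (pedges q) && (psrc q \in Vl) then (K - size (pedges q))%:R / K%:R
  else 0.
Definition fejer : H -> H :=
  path_poly [seq ((fejer_weight q)%:C * symbol F q, q) | q <- short_paths El Vl K].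

Lemma fejer_coef w v :
  fejer (xi w) v = oapp (fun q => (fejer_weight q)%:C * symbol F q) 0 (rquo w v).
Proof.
rewrite /fejer /path_poly big_map l2_sumE.
under eq_bigr do rewrite l2_ZE left_creation_xi.
case wv : (rquo w v) => [q|] /=; last first.
  rewrite big1 // => q _; case qw : (pprod q w) => [t|] /=; last by rewrite mulr0.
  rewrite /xi_fun; case: eqP => [vt|]; last by rewrite mulr0.
  by move/rquoP: qw; rewrite -vt wv.
move/rquoP: wv => qw.
have other t : t != q -> (oapp xi 0 (pprod t w)) v = 0.
  move=> tq; case tw : (pprod t w) => [s|] //=; rewrite /xi_fun; case: eqP => // vs.
  by move: tq; rewrite (pprod_injl (_ : pprod t w = Some v) qw) ?eqxx // tw vs.
case: (boolP (q \in short_paths El Vl K)) => qQ.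
  rewrite (bigD1_seq q) ?undup_uniq // big1; last first.
    by move=> t tq; rewrite other // mulr0.
  rewrite qw -[l2_val _ v]/((v == v)%:R) eqxx mulr1; exact: addr0.
rewrite big_seq big1 => [|t tQ]; last first.
  by rewrite other ?mulr0 //; apply: contraNneq qQ => <-.
rewrite /fejer_weight; case: ifP => [/andP[aE sV]|]; last by rewrite mul0r.
case: (leqP (size (pedges q)) K) => [sz|/ltnW sz].
  by rewrite short_paths_mem in qQ.
by move: sz; rewrite -subn_eq0 => /eqP ->; rewrite !mul0r.
Qed.

Section FiniteVectors.
Variables (s : seq (gpath G)) (us : uniq s).

Let tails := undup [seq alien_tail El w | w <- s].
Let len := (\max_(w <- s) (alien_pos El w + K))%N.

(** The w with a given tail over El whose beginning over El has its length in a
    window of K consecutive values. Every w in s lies in exactly K windows, and w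
    and q w lie together in K - |q| of them if q is a path over El, in none
    otherwise. *)
Definition window (a : (vertex G * seq (edge G)) * 'I_len) w : bool :=
  (alien_tail El w == a.1) && (alien_pos El w <= a.2 < alien_pos El w + K)%N.

Lemma window_count n m : (n + K <= len)%N ->
  (\sum_(l < len) ((n <= l < n + K) && (n + m <= l < n + m + K)))%N = (K - m)%N.
Proof.
move=> nl.
rewrite (eq_bigr (fun l : 'I_len => nat_of_bool (n + m <= l < n + K)%N)); last first.
  by move=> l _; congr nat_of_bool; lia.
rewrite -(big_mkord xpredT (fun l => nat_of_bool (n + m <= l < n + K)%N)).
case: (leqP m K) => mK; last first.
  rewrite big1 ?(eqP (ltnW mK)) // => l _; case: andP => //; lia.
rewrite (@big_cat_nat _ _ _ (n + m)) ?(leq_trans _ nl) ?leq_add2l //=.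
rewrite [X in (_ + X)%N](@big_cat_nat _ _ _ (n + K)) ?leq_add2l //=.
rewrite big_nat big1 => [|l hl]; last first.
  by rewrite (_ : (_ <= l < _)%N = false) //; lia.
rewrite [X in (_ + (_ + X))%N]big_nat [X in (_ + (_ + X))%N]big1 => [|l hl]; last first.
  by rewrite (_ : (_ <= l < _)%N = false) //; lia.
rewrite addn0 add0n big_nat (eq_bigr (fun=> 1%N)) => [|l hl]; last first.
  by rewrite (_ : (_ <= l < _)%N = true) //; lia.
by rewrite -big_nat sum_nat_const_nat muln1 subnDl.
Qed.

Lemma window_pair w v : w \in s ->
  (\sum_(r <- tails) \sum_(l < len) (window (r, l) w && window (r, l) v))%N =
  if alien_tail El v == alien_tail El w then
    (\sum_(l < len) ((alien_pos El w <= l < alien_pos El w + K) &&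
                     (alien_pos El v <= l < alien_pos El v + K)))%N
  else 0%N.
Proof.
move=> ws; have rt : alien_tail El w \in tails by rewrite mem_undup map_f.
rewrite (bigD1_seq _ rt) ?undup_uniq //= [X in (_ + X)%N]big1 => [|r rw]; last first.
  by rewrite big1 // => l _; rewrite /window /= eq_sym (negbTE rw).
rewrite addn0; case: ifPn => vw.
  by apply: eq_bigr => l _; rewrite /window /= eqxx vw.
by rewrite big1 // => l _; rewrite /window /= (negbTE vw) andbF.
Qed.

Lemma len_ge w : w \in s -> (alien_pos El w + K <= len)%N.
Proof.
move=> ws; rewrite /len (bigD1_seq w) //=; exact: leq_maxl.
Qed.

Lemma window_total w : w \in s ->
  (\sum_(r <- tails) \sum_(l < len) window (r, l) w)%N = K.
Proof.
move=> ws; have := window_pair w ws; rewrite eqxx.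
have := window_count 0 (len_ge ws); rewrite addn0 subn0 => ->.
by move=> <-; apply: eq_bigr => r _; apply: eq_bigr => l _; rewrite andbb.
Qed.

(** Hence K times the Fejer mean is the sum over all windows of the compressions
    of F to them. *)
Lemma fejer_kernel w v : w \in s -> prng w \in Vl ->
  K%:R * fejer (xi w) v = \sum_(r <- tails) \sum_(l < len)
    ((window (r, l) w)%:R * (window (r, l) v)%:R) * F (xi w) v.
Proof.
move=> ws wV; rewrite fejer_coef (commuting_coef _ _ cF).
under eq_bigr do rewrite -mulr_suml.
rewrite -mulr_suml.
have -> : \sum_(r <- tails) \sum_(l < len)
      (window (r, l) w)%:R * (window (r, l) v)%:R =
    ((\sum_(r <- tails) \sum_(l < len) (window (r, l) w && window (r, l) v))%N)%:R
    :> R[i].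
  rewrite natr_sum; apply: eq_bigr => r _; rewrite natr_sum; apply: eq_bigr => l _.
  by rewrite -natrM mulnb.
case wv : (rquo w v) => [q|] /=; last by rewrite !mulr0.
move/rquoP: wv => qw; have [h1 h2] := alien_prod El qw.
rewrite mulrA (window_pair v ws) h1 /fejer_weight.
have [_ hs _] := pprod_Some qw; have -> : psrc q = prng w by have [] := pprod_Some qw.
rewrite wV andbT; case: ifP => aE; last by rewrite mulr0 !mul0r.
rewrite h2 // (addnC (size _)) window_count ?len_ge //; congr (_ * _).
have Kn0 : (K%:R : R) != 0 by rewrite pnatr_eq0 -lt0n.
rewrite -(rmorph_nat (real_complex R)) -realcM mulrC divfK //.
by rewrite rmorph_nat.
Qed.

(** Compressions do not increase the norm, and each basis vector lies in exactly K
    windows; so the average over the windows has the bound of F. The sum of two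
    squares on the right is used because it is additive over the windows; scaling
    both vectors to norm 1 turns the estimate into the operator bound. *)
Lemma fejer_le_trunc (c d : gpath G -> R[i]) :
  normc (inner (fejer (trunc s c)) (trunc s d)) <=
  M / 2 * (\sum_(w <- s) normc (c w) ^+ 2 + \sum_(w <- s) normc (d w) ^+ 2).
Proof.
pose c' w := if prng w \in Vl then c w else 0.
have linF := bounded_linear (proj1 cF).
have linB : linear fejer := bounded_linear (path_poly_bounded _).
have c'_le : \sum_(w <- s) normc (c' w) ^+ 2 <= \sum_(w <- s) normc (c w) ^+ 2.
  apply: ler_sum => w _; rewrite /c'; case: ifP => // _.
  by rewrite normc0 expr0n sqr_ge0.
pose f r l := trunc s (fun w => c' w * (window (r, l) w)%:R).
pose g r l := trunc s (fun w => d w * (window (r, l) w)%:R).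
have key : K%:R * inner (fejer (trunc s c)) (trunc s d) =
    \sum_(r <- tails) \sum_(l < len) inner (F (f r l)) (g r l).
  rewrite (inner_trunc2 s c d linB) mulr_sumr.
  under [RHS]eq_bigr do under eq_bigr do rewrite (inner_trunc2 _ _ _ linF).
  under [RHS]eq_bigr do rewrite exchange_big.
  rewrite [RHS]exchange_big; apply: eq_big_seq => w ws.
  under [RHS]eq_bigr do rewrite exchange_big.
  rewrite [RHS]exchange_big mulr_sumr; apply: eq_bigr => v _ /=.
  case: (boolP (prng w \in Vl)) => wV.
    rewrite mulrCA (fejer_kernel v ws wV) mulr_sumr; apply: eq_bigr => r _.
    rewrite mulr_sumr; apply: eq_bigr => l _; rewrite conjM /c' wV.
    by rewrite conjc_nat; ring.
  rewrite fejer_coef big1 => [|r _]; last first.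
    by rewrite big1 // => l _; rewrite /c' (negbTE wV) !mul0r.
  case wv : (rquo w v) => [q|] /=; last by rewrite !mulr0.
  move/rquoP: wv => /pprod_Some[qw _ _].
  by rewrite /fejer_weight qw (negbTE wV) andbF !mul0r !mulr0.
have total (a : gpath G -> R[i]) :
    \sum_(r <- tails) \sum_(l < len) sqn (trunc s (fun w => a w * (window (r, l) w)%:R))
    = K%:R * \sum_(w <- s) normc (a w) ^+ 2.
  under eq_bigr do under eq_bigr do rewrite sqn_trunc //.
  under eq_bigr do rewrite exchange_big.
  rewrite exchange_big mulr_sumr; apply: eq_big_seq => w ws.
  transitivity (\sum_(r <- tails) \sum_(l < len) (window (r, l) w)%:R * normc (a w) ^+ 2).
    apply: eq_bigr => r _; apply: eq_bigr => l _; rewrite normcM exprMn mulrC.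
    congr (_ * _); case: (window _ _); rewrite ?normc1 ?normc0 ?expr1n ?expr0n //.
  under eq_bigr do rewrite -mulr_suml -natr_sum.
  by rewrite -mulr_suml -natr_sum window_total.
have K0 : 0 < (K%:R : R) by rewrite ltr0n.
rewrite -(ler_pM2l K0).
have -> : K%:R * normc (inner (fejer (trunc s c)) (trunc s d)) =
    normc (K%:R * inner (fejer (trunc s c)) (trunc s d)).
  by rewrite normcM -(rmorph_nat (real_complex R)) normc_real ger0_norm ?ltW.
rewrite key; apply: le_trans (le_normc_sum _ _) _.
apply: (@le_trans _ _ (\sum_(r <- tails) \sum_(l < len)
    M / 2 * (sqn (f r l) + sqn (g r l)))).
  apply: ler_sum => r _; apply: le_trans (le_normc_sum _ _) _.
  apply: ler_sum => l _; apply: le_trans (normc_inner_le _ _) _.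
  apply: (@le_trans _ _ (M * (l2norm (f r l) * l2norm (g r l)))).
    by rewrite mulrA ler_wpM2r ?l2norm_ge0.
  rewrite -mulrA ler_wpM2l // -!l2norm_sqr.
  have := sqr_ge0 (l2norm (f r l) - l2norm (g r l)).
  by move: (l2norm _) (l2norm _) => x y; lra.
under eq_bigr do rewrite -mulr_sumr big_split.
rewrite -mulr_sumr big_split /= !total mulrCA ler_wpM2l ?divr_ge0 //.
by rewrite -mulrDr ler_wpM2l ?lerD2r // ltW.
Qed.

End FiniteVectors.
Lemma fejer_bounded : bounded_operator fejer.
Proof. exact: path_poly_bounded. Qed.

Lemma fejer_form_le f g :
  normc (inner (fejer f) g) <= M / 2 * (sqn f + sqn g).
Proof.
apply/ler_addgt0Pr => e e0; have [N N0 hN] := bounded_bound fejer_bounded.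
have D0 : 0 < N * (l2norm f + l2norm g) + 1.
  by rewrite ltr_wpDl // mulr_ge0 // addr_ge0 ?l2norm_ge0.
have [s us [hf hg]] := trunc_approx2 f g (divr_gt0 e0 D0).
have := truncated_form_le N0 hN (bounded_linear fejer_bounded) us hf hg.
move=> le1; have le2 := fejer_le_trunc us f g.
have -> : inner (fejer f) g = inner (fejer (trunc s f)) (trunc s g) +
   (inner (fejer f) g - inner (fejer (trunc s f)) (trunc s g)) by ring.
apply: le_trans (le_normcD _ _) _; apply: lerD.
  apply: le_trans le2 _; rewrite ler_wpM2l ?divr_ge0 //.
  by apply: lerD; exact: psum_le_sqn.
by apply: le_trans le1 _; apply: damped_le; rewrite ?addr_ge0 ?l2norm_ge0 ?(ltW e0).
Qed.

Lemma fejer_le f : l2norm (fejer f) <= M * l2norm f.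
Proof.
have form g : normc (inner (fejer f) g) <= M * l2norm f * l2norm g.
  have := l2norm_ge0 f; rewrite le_eqVlt => /orP[/eqP f0|f0].
    rewrite -f0 (l2norm_eq0 (esym f0)) (lin0 (bounded_linear fejer_bounded)).
    by rewrite inner0l normc0 mulr0 mul0r.
  have := l2norm_ge0 g; rewrite le_eqVlt => /orP[/eqP g0|g0].
    by rewrite -g0 (l2norm_eq0 (esym g0)) inner0r normc0 mulr0.
  have := fejer_form_le ((l2norm f)^-1%:C *: f) ((l2norm g)^-1%:C *: g).
  rewrite (linZ (bounded_linear fejer_bounded)) innerZl innerZr conjc_real.
  rewrite !normcM !sqnZ !normc_real !ger0_norm ?invr_ge0 ?l2norm_ge0 //.
  rewrite -!l2norm_sqr -!exprMn !mulVf ?gt_eqF // expr1n -[1 + 1]/(2).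
  rewrite divfK ?pnatr_eq0 // mulrA -invfM mulrC ler_pdivrMr ?mulr_gt0 //.
  by rewrite mulrA.
have := form (fejer f); rewrite inner_diag normc_real ger0_norm ?sqn_ge0 //.
rewrite -l2norm_sqr expr2; have := l2norm_ge0 (fejer f).
rewrite le_eqVlt => /orP[/eqP <- _|B0]; first by rewrite mulr_ge0 ?l2norm_ge0.
by rewrite ler_pM2r.
Qed.

End Approximant.

Lemma fejer_sub_coef s K w v : (0 < K)%N -> w \in s -> v \in s ->
  normc (fejer (flatten (map (@pedges G) s)) (map (@prng G) s) K (xi w) v - F (xi w) v)
  <= (size (pedges v))%:R / K%:R * normc (F (xi w) v).
Proof.
move=> K0 ws vs; rewrite fejer_coef // (commuting_coef _ _ cF).
case wv : (rquo w v) => [q|]; last by rewrite ![oapp _ _ None]/= subrr !normc0 mulr0.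
rewrite ![oapp _ _ (Some q)]/=.
move/rquoP: wv => /pprod_Some[qw hs he].
have aE : all (mem (flatten (map (@pedges G) s))) (pedges q).
  apply/allP => e eq; apply/flattenP; exists (pedges v); first exact: map_f.
  by rewrite he mem_cat eq.
rewrite /fejer_weight aE qw map_f //= -[X in _ - X]mul1r -mulrBl normcM.
rewrite ler_wpM2r ?normc_ge0 //.
have -> : (1 : R[i]) = (1 : R)%:C by [].
have Kr0 : 0 < (K%:R : R) by rewrite ltr0n.
rewrite -realcN -realcD normc_real ler_pdivlMr // -[X in _ * X](ger0_norm (ltW Kr0)).
rewrite -normrM mulrBl mul1r divfK ?gt_eqF // he size_cat.
case: (leqP (size (pedges q)) K) => sz.
  rewrite natrB // [_ - _ - _]addrAC subrr add0r normrN ger0_norm // natrD lerDl //.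
rewrite (eqP (ltnW sz)) sub0r normrN (ger0_norm (ltW Kr0)) ler_nat.
by rewrite (leq_trans (ltnW sz)) // leq_addr.
Qed.

Lemma fejer_approx f g (e : R) : 0 < e -> exists s0 : seq (gpath G),
  forall s, uniq s -> {subset s0 <= s} -> exists K0, forall K, (K0 <= K)%N ->
  (0 < K)%N ->
  normc (inner ((fejer (flatten (map (@pedges G) s)) (map (@prng G) s) K - F) f) g) < e.
Proof.
move=> e0; have e20 : 0 < e / 2 by rewrite divr_gt0.
have D0 : 0 < (M + M) * (l2norm f + l2norm g) + 1.
  by rewrite ltr_wpDl // mulr_ge0 ?addr_ge0 ?l2norm_ge0.
have et0 := divr_gt0 e20 D0.
have [s1 us1 h1] := trunc_approx f et0; have [s2 us2 h2] := trunc_approx g et0.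
exists (s1 ++ s2) => s us ss.
have hf : l2norm (f - trunc s f) <= e / 2 / ((M + M) * (l2norm f + l2norm g) + 1).
  by apply: h1 => // w ws; apply: ss; rewrite mem_cat ws.
have hg : l2norm (g - trunc s g) <= e / 2 / ((M + M) * (l2norm f + l2norm g) + 1).
  by apply: h2 => // w ws; apply: ss; rewrite mem_cat ws orbT.
pose C := \sum_(w <- s) \sum_(v <- s) normc (f w) * normc (g v) *
  ((size (pedges v))%:R * normc (F (xi w) v)).
have C0 : 0 <= C.
  by apply: sumr_ge0 => w _; apply: sumr_ge0 => v _; rewrite !mulr_ge0 ?normc_ge0.
exists (Num.bound (C / (e / 2))) => K hK K0; have Kr0 : 0 < (K%:R : R) by rewrite ltr0n.
set B := fejer _ _ _.
have bB : bounded_operator B by exact: path_poly_bounded.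
have BF_le h : l2norm ((B - F) h) <= (M + M) * l2norm h.
  apply: le_trans (le_l2normD _ _) _; rewrite mulrDl; apply: lerD.
    exact: fejer_le.
  by rewrite -[(- F) h]/(- F h) l2normN.
have linBF : linear (B - F).
  apply: bounded_linear; apply: boundedD => //; rewrite -scaleN1r; apply: boundedZ.
  by case: cF.
have := truncated_form_le (addr_ge0 M0 M0) BF_le linBF us hf hg; move=> le1.
have le2 : normc (inner ((B - F) (trunc s f)) (trunc s g)) <= C / K%:R.
  rewrite (inner_trunc2 s f g linBF) mulr_suml.
  apply: le_trans (le_normc_sum _ _) _; rewrite big_seq [leRHS]big_seq.
  apply: ler_sum => w ws; rewrite mulr_suml.
  apply: le_trans (le_normc_sum _ _) _; rewrite big_seq [leRHS]big_seq.
  apply: ler_sum => v vs; rewrite !normcM normc_conj -mulrA -[leRHS]mulrA.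
  rewrite -[X in _ <= X]mulrA; apply: ler_wpM2l; first exact: normc_ge0.
  apply: ler_wpM2l; first exact: normc_ge0.
  rewrite -[((B - F) (xi w)) v]/(B (xi w) v - F (xi w) v) mulrAC.
  exact: fejer_sub_coef.
have le3 : C / K%:R < e / 2.
  rewrite ltr_pdivrMr // mulrC -ltr_pdivrMr //.
  apply: lt_le_trans (archi_boundP _) _; first by rewrite divr_ge0 // ltW.
  by rewrite ler_nat.
have -> : inner ((B - F) f) g = (inner ((B - F) f) g -
    inner ((B - F) (trunc s f)) (trunc s g)) +
    inner ((B - F) (trunc s f)) (trunc s g) by ring.
apply: le_lt_trans (le_normcD _ _) _; rewrite [ltRHS](splitr e).
apply: ler_ltD; last exact: le_lt_trans le2 le3.
apply: le_trans le1 _; apply: damped_le; rewrite ?addr_ge0 ?l2norm_ge0 //.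
exact: ltW.
Qed.

Lemma fejer_approx_seq (fgs : seq (H * H)) (e : R) : 0 < e ->
  exists s0 : seq (gpath G),
  forall s, uniq s -> {subset s0 <= s} -> exists K0, forall K, (K0 <= K)%N ->
  (0 < K)%N -> forall fg, fg \in fgs -> normc (inner
    ((fejer (flatten (map (@pedges G) s)) (map (@prng G) s) K - F) fg.1) fg.2) < e.
Proof.
move=> e0; elim: fgs => [|[f g] fgs [s0 h0]].
  by exists [::] => s _ _; exists 0%N.
have [s1 h1] := fejer_approx f g e0; exists (s0 ++ s1) => s us ss.
have [|K0 hK0] := h0 s us; first by move=> w ws; apply: ss; rewrite mem_cat ws.
have [|K1 hK1] := h1 s us; first by move=> w ws; apply: ss; rewrite mem_cat ws orbT.
exists (maxn K0 K1) => K; rewrite geq_max => /andP[K0K K1K] Kpos fg.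
by rewrite inE => /orP[/eqP ->|]; [apply: hK1|apply: hK0].
Qed.

(** The Fejer means are uniformly bounded and converge entrywise, hence converge
    weakly. *)
Lemma commuting_approx (fgs : seq (H * H)) (e : R) : 0 < e ->
  exists2 B, @path_algebra R G B /\ bounded_operator B &
  forall fg, fg \in fgs -> normc (inner ((B - F) fg.1) fg.2) < e.
Proof.
move=> e0; have [s0 h0] := fejer_approx_seq fgs e0.
have [||K0 hK] := h0 (undup s0).
- exact: undup_uniq.
- by move=> w; rewrite mem_undup.
exists (fejer (flatten (map (@pedges G) (undup s0))) (map (@prng G) (undup s0)) K0.+1).
  by split; [exact: path_poly_algebra|exact: path_poly_bounded].
by move=> fg; apply: hK.
Qed.

End Fejer.

(** Operators obtained from adjoints or from a minimisation are not limits of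
    polynomials in the L_p by construction; for them, membership in the algebra is
    checked through commutation. *)
Theorem algebra_commutant (R : realType) (G : digraph)
    (F : l2 R (gpath G) -> l2 R (gpath G)) :
  free_semigroupoid_algebra F <-> right_commuting F.
Proof.
split; first exact: algebra_right_commuting.
move=> cF; have bF := proj1 cF; have [M M0 hM] := bounded_bound bF.
by split=> // fgs e e0; exact: commuting_approx cF M0 hM fgs e e0.
Qed.

(** * Skeleton vectors *)

Section Skeleton.
Variables (R : realType) (G : digraph).
Local Notation H := (l2 R (gpath G)).
Local Notation L p := (@left_creation R G p).
Local Notation La p := (@left_annihilation R G p).
Local Notation LG := (@free_semigroupoid_algebra R G).
Local Notation xi := (@xi R (gpath G)).
Implicit Types (p q u v w t : gpath G) (x y z : vertex G) (e : edge G) (f g : H).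

Variable loop : vertex G -> option (edge G).
Hypothesis loopP : forall x e, loop x = Some e -> supports_loop_edge x e.

(** The solution u of u = v + l L_e u, where e is the loop chosen at x. The bound
    on its norm is uniform in l, as needed for the limit l -> 0. *)
Definition resolvent x (l : R) (v : H) : H :=
  if loop x is Some e then
    xget 0 [set h | h = v + l%:C *: L (epath e) h /\ l2norm h <= 2 * l2norm v]
  else v.

Lemma resolventP x (l : R) (v : H) : 0 <= l <= 2^-1 ->
  resolvent x l v = v +
    (if loop x is Some e then l%:C *: L (epath e) (resolvent x l v) else 0) /\
  l2norm (resolvent x l v) <= 2 * l2norm v.
Proof.
move=> /andP[l0 l1]; rewrite /resolvent; case: (loop x) => [e|]; last first.
  by rewrite addr0; split=> //; rewrite ler_peMl ?l2norm_ge0 // ler1n.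
set S := [set h | _]; have [||h hE hle] := @contraction_solve R (gpath G)
   (fun h => l%:C *: L (epath e) h) v.
- move=> c f g; rewrite left_creation_linear scalerDr !scalerA mulrC //.
- move=> f; rewrite l2normZ normc_real ger0_norm //.
  by rewrite ler_pM ?l2norm_ge0 ?l2norm_left_creation.
by have [] := @xgetPex _ 0 S (ex_intro _ h (conj hE hle)).
Qed.

Section FixedSkeleton.
Variables (y : vertex G) (l0 : R).
Implicit Type ls : seq (edge G * R).

Definition sk_vertex ls := end_of y (unzip1 ls).
Definition sk_scalar ls := if ls is (_, l) :: _ then l else l0.
(** The list ls holds the skeleton edges from the last to the first, each with the
    scalar used at its range; l0 is the scalar at the starting vertex y. The
    result is the vector u_k of the representation. *)
Fixpoint sk_vector ls : H :=
  if ls is (e, l) :: ls' then resolvent (erng e) l (L (epath e) (sk_vector ls'))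
  else resolvent y l0 (xi (vpath y)).
(** The inhomogeneous term v_k of the equation that defines u_k. *)
Definition sk_seed ls : H :=
  if ls is (e, _) :: ls' then L (epath e) (sk_vector ls') else xi (vpath y).
Definition sk_path ls : gpath G := odflt (vpath y) (insub (y, unzip1 ls)).

Definition sk_small ls := all (fun l : R => 0 <= l <= 2^-1) (rcons (unzip2 ls) l0).
Definition sk_skips ls := all (fun e => loop (erng e) != Some e) (unzip1 ls).

Lemma sk_small_cons e l ls : sk_small ((e, l) :: ls) -> sk_small ls.
Proof. by move=> /andP[]. Qed.

Lemma sk_vectorE ls : sk_small ls ->
  sk_vector ls = sk_seed ls +
    (if loop (sk_vertex ls) is Some e
     then (sk_scalar ls)%:C *: L (epath e) (sk_vector ls) else 0).
Proof.
case: ls => [|[e l] ls] /andP[sm _].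
  by have [] := resolventP y (xi (vpath y)) sm.
by have [] := resolventP (erng e) (L (epath e) (sk_vector ls)) sm.
Qed.

Lemma lquo_epath e e' w t : pprod (epath e) w = Some t ->
  lquo (epath e') t = if e' == e then Some w else None.
Proof.
move=> ew; case: eqP => [->|ne]; first by apply/lquoP.
case lq : (lquo _ _) => [s|] //; move/lquoP: lq => /pprod_Some[_ _ h1].
by move/pprod_Some: ew h1 => [_ _ ->] [] /esym.
Qed.

Lemma lquo_vpath e x : lquo (epath e) (vpath x) = None.
Proof. by case lq : (lquo _ _) => [s|] //; move/lquoP: lq => /pprod_Some[_ _]. Qed.

Lemma path_cons t e es : pedges t = e :: es ->
  exists2 w, pprod (epath e) w = Some t & pedges w = es.
Proof.
move=> te; have := valP t; rewrite /= -[(val t).2]/(pedges t) te /= => /andP[/eqP es1 cw].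
exists (@GPath G (psrc t, es) cw) => //; apply/pprodE; split=> //.
Qed.

Lemma sk_vector_vertex ls x : sk_small ls ->
  sk_vector ls (vpath x) = ((ls == [::]) && (x == y))%:R.
Proof.
move=> sm; rewrite (sk_vectorE sm) l2_DE.
have -> : (if loop (sk_vertex ls) is Some e
     then (sk_scalar ls)%:C *: L (epath e) (sk_vector ls) else 0) (vpath x) = 0.
  case: (loop _) => [e|] //; by rewrite l2_ZE left_creationE lquo_vpath mulr0.
rewrite addr0; case: ls {sm} => [|[e l] ls] /=.
  by rewrite /xi_fun; congr (_ : bool)%:R; apply/eqP/eqP => [[]|->].
by rewrite lquo_vpath.
Qed.

(** The coordinate at a path e w either comes from a chosen loop, which stays at
    the same place of the skeleton, or uses up the last skeleton edge. *)
Lemma sk_vector_cons ls e w t : sk_small ls -> pprod (epath e) w = Some t ->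
  sk_vector ls t =
    (if loop (sk_vertex ls) == Some e then (sk_scalar ls)%:C else 0) * sk_vector ls w +
    (if ls is (e', _) :: ls' then (e == e')%:R * sk_vector ls' w else 0).
Proof.
move=> sm et; rewrite {1}(sk_vectorE sm) l2_DE addrC; congr (_ + _).
  case: (loop _) => [e'|]; last by rewrite mul0r.
  rewrite l2_ZE left_creationE (lquo_epath _ et).
  rewrite -[Some e' == Some e]/(e' == e).
  by case: eqP => _ /=; rewrite ?mulr0 ?mul0r.
case: ls {sm} => [|[e' l] ls] /=.
  rewrite /xi_fun; case: eqP => // ty.
  by move/pprod_Some: et => [_ _]; rewrite ty.
by rewrite (lquo_epath _ et) eq_sym; case: eqP => _ /=; rewrite ?mul1r ?mul0r.
Qed.

(** The equation u = v + l L_f u keeps u over the range of v, because f is a loop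
    there. By induction on the path, whose leftmost edge is a loop or a skeleton
    edge. *)
Lemma sk_vector_range ls w : sk_small ls -> sk_vector ls w != 0 ->
  prng w = sk_vertex ls.
Proof.
move=> sm; case ew : (pedges w) => [|e es].
  rewrite (size0_path ew) sk_vector_vertex //.
  by case: ls sm => [|[e l] ls] _ /=; case: (eqVneq (psrc w) y); rewrite ?eqxx.
have [s sw _] := path_cons ew; rewrite (sk_vector_cons sm sw).
have -> : prng w = erng e by rewrite /prng ew.
case: (loop _ =P _) => [lp _|_]; first by have [] := loopP lp.
rewrite mul0r add0r; case: ls sm {sw} => [|[e' l] ls] _; first by rewrite eqxx.
by case: (e =P e') => [-> //|_]; rewrite mul0r eqxx.
Qed.

(** The adjoint of L_e acts on the vectors of the skeleton by an eigenvalue l,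
    when e is the chosen loop, plus one step down the skeleton, when e is its last
    edge. This is why these vectors give a triangular representation. *)
Lemma left_annihilation_edge ls e : sk_small ls -> composable y (unzip1 ls) ->
  La (epath e) (sk_vector ls) =
    (if loop (sk_vertex ls) == Some e then (sk_scalar ls)%:C else 0) *: sk_vector ls +
    (if ls is (e', _) :: ls' then (e == e')%:R *: sk_vector ls' else 0).
Proof.
move=> sm cm; apply: l2P => w; rewrite left_annihilationE l2_DE l2_ZE.
have lsE : (if ls is (e', _) :: ls' then (e == e')%:R *: sk_vector ls' else 0) w =
    (if ls is (e', _) :: ls' then (e == e')%:R * sk_vector ls' w else 0).
  by case: (ls) => [|[e' l] ls'].
rewrite lsE; case ew : (pprod (epath e) w) => [t|].
  by rewrite [LHS]/= (sk_vector_cons sm ew).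
have ne : esrc e != prng w.
  apply/eqP => h; have := @pprodP _ (epath e) w h.
  by rewrite ew => -[].
rewrite [LHS]/=; apply/esym.
have z0 l' : sk_small l' -> sk_vertex l' = esrc e -> sk_vector l' w = 0.
  move=> sm' v'; apply/eqP/negP => /negP/(sk_vector_range sm') h.
  by rewrite h v' eqxx in ne.
case: eqP => [lp|_].
  rewrite z0 ?mulr0 ?add0r //; last by have [_ ->] := loopP lp.
  case: ls sm cm lsE lp => [|[e' l] ls] //= sm /andP[/eqP c1 _] _ _.
  by case: eqP => [e'E|_]; rewrite ?mul0r // z0 ?mulr0 ?e'E //; move: sm => /andP[].
rewrite mul0r add0r; case: ls sm cm lsE => [|[e' l] ls] //= sm /andP[/eqP c1 _] _.
by case: eqP => [e'E|_]; rewrite ?mul0r // z0 ?mulr0 ?e'E //; move: sm => /andP[].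
Qed.

Lemma left_annihilation_vertex ls x : sk_small ls ->
  La (vpath x) (sk_vector ls) = (sk_vertex ls == x)%:R *: sk_vector ls.
Proof.
move=> sm; apply: l2P => w; rewrite left_annihilationE l2_ZE pprod_vpathl.
have [w0|w0] := eqVneq (sk_vector ls w) 0.
  by rewrite w0 mulr0; case: ifP.
by rewrite (sk_vector_range sm w0); case: eqP => _ /=; rewrite ?mul1r ?mul0r.
Qed.

Lemma sk_pathE ls : composable y (unzip1 ls) ->
  psrc (sk_path ls) = y /\ pedges (sk_path ls) = unzip1 ls.
Proof.
by move=> cm; rewrite /sk_path insubT /psrc /pedges /=.
Qed.

(** Skeleton edges are not chosen loops, so a path of skeleton edges is reached by
    the recursion without using any loop: these paths and the vectors u_i are
    biorthogonal. *)
Lemma sk_vector_path ls1 ls2 : sk_small ls1 -> composable y (unzip1 ls2) ->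
  sk_skips ls2 ->
  sk_vector ls1 (sk_path ls2) = (unzip1 ls1 == unzip1 ls2)%:R.
Proof.
elim: ls2 ls1 => [|[e l] ls2 IHls] ls1 sm cm sk.
  have -> : sk_path [::] = vpath y by have [h1 h2] := sk_pathE cm; apply: gpath_eq.
  by rewrite sk_vector_vertex // eqxx andbT; case: (ls1) => [|[]].
move: cm sk => /= cm0 /andP[sk1 sk2]; have /andP[/eqP c1 c2] := cm0.
have [h1 h2] := @sk_pathE ((e, l) :: ls2) cm0; have [h3 h4] := sk_pathE c2.
have et : pprod (epath e) (sk_path ls2) = Some (sk_path ((e, l) :: ls2)).
  by apply/pprodE; rewrite h1 h2 h3 h4 /prng h3 h4; split.
rewrite (sk_vector_cons sm et).
have -> : (loop (sk_vertex ls1) == Some e) = false.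
  apply/negP => /eqP lp; move: sk1; have [-> _] := loopP lp.
  by rewrite lp eqxx.
rewrite mul0r add0r; case: ls1 sm => [|[e' l'] ls1] sm //=.
rewrite (IHls ls1) ?(sk_small_cons sm) // -natrM mulnb eqseq_cons [e == _]eq_sym.
by [].
Qed.

End FixedSkeleton.
End Skeleton.

(** * Choosing a skeleton on which an operator does not vanish *)

Section SkeletonExistence.
Variables (R : realType) (G : digraph).
Local Notation H := (l2 R (gpath G)).
Local Notation L p := (@left_creation R G p).
Local Notation La p := (@left_annihilation R G p).
Local Notation xi := (@xi R (gpath G)).
Variable loop : vertex G -> option (edge G).
Hypothesis loopP : forall x e, loop x = Some e -> supports_loop_edge x e.

Lemma avoid_finite (d : R) (s : seq R) : 0 < d ->
  exists l, [/\ 0 < l, l <= d & l \notin s].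
Proof.
elim: s d => [|a s IHs] d d0; first by exists d.
have [a0|a0] := ltP 0 a.
  have [|l [l0 ld ls]] := IHs (Num.min d (a / 2)).
    by rewrite lt_min d0 divr_gt0.
  exists l; move: ld; rewrite le_min => /andP[ld la]; split=> //.
  by rewrite inE negb_or ls andbT; apply/eqP => e; rewrite e in la; lra.
have [l [l0 ld ls]] := IHs d d0; exists l; split=> //.
by rewrite inE negb_or ls andbT; apply/eqP => e; rewrite e in l0; lra.
Qed.

(** As l tends to 0 the resolvent tends to v, so it stays off the hyperplane
    orthogonal to f; finitely many values of l can be avoided on the way. *)
Lemma small_scalar x (f v : H) (s : seq R) : inner f v != 0 ->
  exists l : R, [/\ 0 < l, l <= 2^-1, l \notin s & inner f (resolvent loop x l v) != 0].
Proof.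
move=> fv; have b0 : 0 < normc (inner f v) by rewrite lt_def normc_eq0 fv normc_ge0.
pose K := l2norm f * (2 * l2norm v) + 1.
have K0 : 0 < K by rewrite ltr_wpDl ?mulr_ge0 ?l2norm_ge0.
have [|l [l_gt0 ld ls]] := @avoid_finite (Num.min 2^-1 (normc (inner f v) / K)) s.
  by rewrite lt_min invr_gt0 ltr0n divr_gt0.
move: ld; rewrite le_min => /andP[l_le lK]; exists l; split=> //.
have [|uE ule] := @resolventP R G loop x l v; first by rewrite ltW.
set u := resolvent _ _ _ _ in uE ule *; rewrite uE.
case: (loop x) => [e|]; last by rewrite addr0.
rewrite innerDr innerZr conjc_real.
have small : normc (l%:C * inner f (L (epath e) u)) < normc (inner f v).
  rewrite normcM normc_real gtr0_norm //.
  apply: (@le_lt_trans _ _ (l * (l2norm f * (2 * l2norm v)))).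
    rewrite ler_pM2l //; apply: le_trans (normc_inner_le _ _) _.
    rewrite ler_wpM2l ?l2norm_ge0 //.
    by apply: le_trans ule; apply: l2norm_left_creation.
  by rewrite ler_pdivlMr // /K mulrDr mulr1 in lK; apply: lt_le_trans lK; rewrite ltrDl.
apply: contraTneq small => /eqP; rewrite addr_eq0 => /eqP ->.
by rewrite normcN ltxx.
Qed.

Definition sk_positive (l0 : R) (ls : seq (edge G * R)) :=
  all (fun l : R => 0 < l) (rcons (unzip2 ls) l0).

Lemma sk_positive_cons l0 e l ls : sk_positive l0 ((e, l) :: ls) -> sk_positive l0 ls.
Proof. by move=> /andP[]. Qed.

Lemma inner_left_annihilation p (f g : H) : inner (La p f) g = inner f (L p g).
Proof. by rewrite innerC -inner_left_creation -innerC. Qed.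

(** By induction on the path t, whose leftmost edge e is removed by passing from f
    to the adjoint of L_e applied to f. If e is not a chosen loop, it is added to
    the skeleton with a small new scalar. If it is, the skeleton found for the
    shorter path is kept: either <f, v> = 0 for its seed v, and then <f, u> = l
    <f, L_e u> is nonzero by induction; or <f, v> is nonzero, and the last scalar
    is replaced by a small one. *)
Lemma skeleton_exists y es (f : H) (t : gpath G) :
  pedges t = es -> psrc t = y -> f t != 0 ->
  exists l0 ls, [/\ sk_small l0 ls && sk_positive l0 ls,
    composable y (unzip1 ls) && sk_skips loop ls,
    uniq (rcons (unzip2 ls) l0), sk_vertex y ls = prng t &
    inner f (sk_vector loop y l0 ls) != 0].
Proof.
elim: es f t => [|e es IHes] f t te ty ft.
  have tE : t = vpath y by rewrite -ty; exact: size0_path.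
  have [|l [l_gt0 l_le _ fl]] := @small_scalar y f (xi (vpath y)) [::].
    by rewrite inner_xir -tE.
  exists l, [::]; rewrite /sk_small /sk_positive /= l_gt0 l_le (ltW l_gt0) tE.
  by split.
have [w ew wes] := path_cons te.
have [h1 h2 h3] := pprod_Some ew.
have [||l0 [ls [/andP[sm ps] /andP[cm sk] un vs nz]]] := IHes (La (epath e) f) w wes.
- by rewrite -h2.
- by rewrite left_annihilationE ew.
have et : esrc e = sk_vertex y ls by rewrite vs.
have rt : prng t = erng e by rewrite (prng_pprod ew).
rewrite inner_left_annihilation in nz.
case: (loop (erng e) =P Some e) => [lp|lp]; last first.
  have [l [l_gt0 l_le ls_l fl]] := @small_scalar (erng e) f _ (rcons (unzip2 ls) l0) nz.
  exists l0, ((e, l) :: ls); split=> //.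
  - by move: sm ps; rewrite /sk_small /sk_positive /= l_gt0 l_le (ltW l_gt0) => -> ->.
  - by rewrite /sk_skips /= et eqxx cm; apply/and3P; split=> //; apply/eqP.
  - by rewrite /= ls_l.
have [_ se] := loopP lp.
have [fs|fs] := eqVneq (inner f (sk_seed loop y l0 ls)) 0.
  exists l0, ls; split; rewrite ?sm ?cm //.
    by rewrite rt -se et.
  rewrite (sk_vectorE loop y sm) innerDr fs add0r -et se lp innerZr conjc_real.
  rewrite mulf_neq0 //; apply: contraTneq ps => h.
  have l_0 : sk_scalar l0 ls = 0 by move: h => [].
  rewrite /sk_positive; case: (ls) l_0 => [|[e' l'] ls'] /= ->; by rewrite ltxx.
have [l [l_gt0 l_le ls_l fl]] := @small_scalar (erng e) f _
  (if ls is _ :: ls' then rcons (unzip2 ls') l0 else [::]) fs.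
case: ls sm ps cm sk un vs nz et fs ls_l fl => [|[e' l'] ls].
  move=> sm ps cm sk un vs nz et fs ls_l fl.
  exists l, [::]; split=> //.
  - by rewrite /sk_small /sk_positive /= l_gt0 l_le (ltW l_gt0).
  - by rewrite rt -se et.
  - by move: fl; rewrite -se et.
move=> /sk_small_cons sm /sk_positive_cons ps cm sk /andP[_ un] vs nz et fs ls_l fl.
exists l0, ((e', l) :: ls); split; rewrite ?cm //.
- by move: sm ps; rewrite /sk_small /sk_positive /= l_gt0 l_le (ltW l_gt0) => -> ->.
- by rewrite /= ls_l.
- by rewrite rt -se et.
- by move: fl; rewrite -se et.
Qed.

End SkeletonExistence.

(** * The nest representation of a skeleton, and sufficiency *)

Section SkeletonRepresentation.
Variables (R : realType) (G : digraph).
Local Notation H := (l2 R (gpath G)).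
Local Notation L p := (@left_creation R G p).
Local Notation La p := (@left_annihilation R G p).
Local Notation LG := (@free_semigroupoid_algebra R G).
Local Notation xi := (@xi R (gpath G)).
Variable loop : vertex G -> option (edge G).
Hypothesis loopP : forall x e, loop x = Some e -> supports_loop_edge x e.
Hypothesis loop_cycle : forall x p, (0 < plen p)%N -> supports_cycle x p ->
  exists e, loop x = Some e.
Variables (y : vertex G) (l0 : R) (ls : seq (edge G * R)).
Hypotheses (sm : sk_small l0 ls) (cm : composable y (unzip1 ls))
  (sk : sk_skips loop ls) (un : uniq (rcons (unzip2 ls) l0)).

Let n := (size ls).+1.

Definition sk_covector (i : 'I_n) : H := sk_vector loop y l0 (drop i ls).
Definition sk_unit (i : 'I_n) : H := xi (sk_path y (drop i ls)).
(** Up to conjugation, the coefficients of the vectors U j in the expansion of the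
    adjoint of A applied to U i, read off with the biorthogonal family Z j. *)
Definition sk_rep (A : H -> H) : 'M[R[i]]_n :=
  \matrix_(i, j) inner (A (sk_unit j)) (sk_covector i).
Local Notation U := sk_covector.
Local Notation Z := sk_unit.
Local Notation psi := sk_rep.

Lemma sk_small_drop i : sk_small l0 (drop i ls).
Proof.
elim: i ls sm => [|i IHi] [|[e l] s] //= h; apply: IHi; exact: sk_small_cons h.
Qed.
Lemma composable_drop i : composable y (unzip1 (drop i ls)).
Proof.
elim: i ls cm => [|i IHi] [|[e l] s] //= /andP[_ h]; exact: IHi.
Qed.
Lemma sk_skips_drop i : sk_skips loop (drop i ls).
Proof.
elim: i ls sk => [|i IHi] [|[e l] s] //= /andP[_ h]; exact: IHi.
Qed.

Lemma inner_ZU i j : inner (Z j) (U i) = (i == j)%:R.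
Proof.
rewrite /sk_unit inner_xil sk_vector_path ?sk_small_drop ?composable_drop ?sk_skips_drop //.
rewrite conjc_nat; congr (_ : bool)%:R; apply/eqP/eqP => [h|-> //].
have := congr1 size h; rewrite !size_map !size_drop => h'; apply: val_inj => /=.
by move: h' (ltn_ord i) (ltn_ord j); rewrite /n; lia.
Qed.

(** The adjoint of T maps U i to the combination of the U j with the conjugates of
    c i j as coefficients, only j >= i occurring. The form with a test vector g
    extends to weak limits. *)
Definition upper_on (T : H -> H) (c : 'M[R[i]]_n) : Prop :=
  (forall i j : 'I_n, (j < i)%N -> c i j = 0) /\
  forall g i, inner (T g) (U i) = \sum_j c i j * inner g (U j).

Lemma upper_on_rep T c : upper_on T c -> c = psi T.
Proof.
move=> [_ h]; apply/matrixP => i j; rewrite mxE h (bigD1 j) //= inner_ZU eqxx mulr1.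
by rewrite big1 ?addr0 // => k kj; rewrite inner_ZU (negbTE kj) mulr0.
Qed.

Lemma upper_on_comp T T' c c' : upper_on T c -> upper_on T' c' ->
  upper_on (T \o T') (c *m c').
Proof.
move=> [u1 h1] [u2 h2]; split=> [i j ji|g i].
  rewrite mxE big1 // => k _; case: (ltnP k i) => ki; first by rewrite u1 ?mul0r.
  by rewrite u2 ?mulr0 // (leq_trans ji).
rewrite /= h1.
transitivity (\sum_j \sum_k c i j * (c' j k * inner g (U k))).
  by apply: eq_bigr => j _; rewrite h2 mulr_sumr.
rewrite exchange_big; apply: eq_bigr => k _; rewrite mxE mulr_suml.
by apply: eq_bigr => j _; rewrite mulrA.
Qed.

Local Notation vtx i := (sk_vertex y (drop i ls)).
Local Notation lam i := (sk_scalar l0 (drop i ls)).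

Lemma upper_on_vertex x :
  upper_on (L (vpath x)) (\matrix_(i, j) ((i == j) && (vtx i == x))%:R).
Proof.
split=> [i j ji|g i]; first by rewrite mxE; case: eqP => // ij; rewrite ij ltnn in ji.
rewrite inner_left_creation left_annihilation_vertex ?sk_small_drop // innerZr.
rewrite (bigD1 i) //= mxE eqxx big1 => [|j ji]; last first.
  by rewrite mxE eq_sym (negbTE ji) mul0r.
by rewrite conjc_nat addr0.
Qed.

Definition edge_mx e : 'M[R[i]]_n := \matrix_(i, j)
  ((if (i == j) && (loop (vtx i) == Some e) then (lam i)%:C else 0) +
   ((i.+1 == j :> nat) && (nth e (unzip1 ls) i == e))%:R).

Lemma upper_on_edge e : upper_on (L (epath e)) (edge_mx e).
Proof.
split=> [i j ji|g i].
  rewrite mxE (_ : (i == j) = false); last by apply/eqP => ij; rewrite ij ltnn in ji.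
  by rewrite (_ : (i.+1 == j :> nat) = false) ?addr0 //; apply/eqP => ij; lia.
rewrite inner_left_creation left_annihilation_edge ?sk_small_drop ?composable_drop //.
rewrite innerDr innerZr.
under [RHS]eq_bigr do rewrite mxE mulrDl.
rewrite big_split /=; congr (_ + _).
  rewrite (bigD1 i) //= eqxx big1 => [|j ji]; last first.
    by rewrite eq_sym (negbTE ji) mul0r.
  by rewrite addr0 /=; case: (loop _ == _); rewrite ?conjc_real ?conjc0.
case: (ltnP i (size ls)) => isz; last first.
  rewrite drop_oversize // inner0r big1 // => j _; case: eqP => [ij|_]; last by rewrite mul0r.
  by have := ltn_ord j; rewrite -ij /n ltnS ltnNge isz.
have lt : (i.+1 < n)%N by [].
rewrite (bigD1 (Ordinal lt)) //= eqxx big1 => [|j ji]; last first.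
  case: eqP => [ij|_]; last by rewrite mul0r.
  by move: ji; rewrite -val_eqE /= ij eqxx.
have lt1 : (i < size (unzip1 ls))%N by rewrite size_map.
rewrite addr0 /sk_covector /=; have := isz; case E : ls => [|el0 ls0] // _; rewrite -E.
rewrite (drop_nth el0) // (nth_map el0) // ; case: (nth el0 ls i) => e' l' /=.
by rewrite innerZr conjc_nat eq_sym.
Qed.

Lemma upper_on_creation p : exists c, upper_on (L p) c.
Proof.
elim: (pedges p) {-2}p (erefl (pedges p)) => [|e es IHes] q qe.
  by rewrite (size0_path qe); eexists; exact: upper_on_vertex.
have [w ew we] := path_cons qe; have [c hc] := IHes w we.
exists (edge_mx e *m c).
have -> : L q = L (epath e) \o L w.
  by apply/funext => f; rewrite /= left_creation_comp ew.
by apply: upper_on_comp => //; exact: upper_on_edge.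
Qed.

(** Both sides are matrix coefficients of A, and they agree for the L_p; so the
    span of the U i is invariant under the adjoint of every A in the algebra.
    Multiplicativity of psi follows. *)
Lemma rep_expand A g i : LG A -> inner (A g) (U i) = \sum_j psi A i j * inner g (U j).
Proof.
move=> hA; have linA := bounded_linear (algebra_bounded hA).
have := @wot_extension R G
  ((g, U i) :: [seq (- inner g (U j) *: Z j, U i) | j <- index_enum 'I_n]) _ A hA.
have sumE (T : H -> H) : linear T ->
    \sum_(fg <- (g, U i) :: [seq (- inner g (U j) *: Z j, U i) | j <- index_enum 'I_n])
      inner (T fg.1) fg.2 =
    inner (T g) (U i) - \sum_j inner (T (Z j)) (U i) * inner g (U j).
  move=> linT; rewrite big_cons big_map -sumrN; congr (_ + _).
  by apply: eq_bigr => j _; rewrite (linZ linT) innerZl mulNr mulrC.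
rewrite (sumE A linA) => h; apply/eqP; rewrite -subr_eq0; apply/eqP.
rewrite -[RHS]h; first by congr (_ - _); apply: eq_bigr => j _; rewrite mxE.
move=> p; rewrite (sumE _ (left_creation_linear p)).
have [c hc] := upper_on_creation p; rewrite (proj2 hc) (upper_on_rep hc).
by apply/eqP; rewrite subr_eq0; apply/eqP; apply: eq_bigr => j _; rewrite mxE.
Qed.

Lemma rep_upper A (i j : 'I_n) : LG A -> (j < i)%N -> psi A i j = 0.
Proof.
move=> hA ji; rewrite mxE.
have := @wot_extension R G [:: (Z j, U i)] _ A hA; rewrite big_seq1; apply => p.
rewrite big_seq1 /=; have [c hc] := upper_on_creation p.
by have := upper_on_rep hc => /matrixP/(_ i j); rewrite mxE (proj1 hc _ _ ji).
Qed.

Lemma rep_mul A B : LG A -> LG B -> psi (A \o B) = psi A *m psi B.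
Proof.
move=> hA hB; apply/matrixP => i l; rewrite !mxE /= rep_expand //.
by apply: eq_bigr => j _; rewrite [psi B _ _]mxE.
Qed.

Lemma rep_add A B : psi (A + B) = psi A + psi B.
Proof. by apply/matrixP => i j; rewrite !mxE -innerDl. Qed.
Lemma rep_scale (c : R[i]) A : psi (c *: A) = c *: psi A.
Proof. by apply/matrixP => i j; rewrite !mxE -innerZl. Qed.

Lemma opnorm_xi (D : H -> H) w : bounded_operator D -> l2norm (D (xi w)) <= opnorm D.
Proof.
move=> bD; have [M M0 hM] := bounded_bound bD; apply: ub_le_sup.
  exists M => _ [f f1 <-]; apply: le_trans (hM f) _.
  by rewrite -[leRHS]mulr1 ler_wpM2l.
by exists (xi w) => //=; rewrite l2norm_xi.
Qed.

Lemma rep_continuous A : LG A -> forall eps : R, 0 < eps ->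
  exists2 delta : R, 0 < delta & forall B, LG B -> opnorm (B - A) < delta ->
    forall i j, normc (psi B i j - psi A i j) < eps.
Proof.
move=> hA eps e0; pose K := \sum_i l2norm (U i) + 1.
have K0 : 0 < K by rewrite ltr_wpDl // sumr_ge0 // => i _; exact: l2norm_ge0.
exists (eps / K); first by rewrite divr_gt0.
move=> B hB lt i j; rewrite !mxE -innerBl -[B _ - A _]/((B - A) (Z j)).
have bBA : bounded_operator (B - A).
  apply: boundedD (algebra_bounded hB) _; rewrite -scaleN1r; apply: boundedZ.
  exact: algebra_bounded.
apply: le_lt_trans (normc_inner_le _ _) _.
rewrite ltr_pdivlMr // in lt; apply: le_lt_trans lt; apply: ler_pM; rewrite ?l2norm_ge0 //.
  exact: opnorm_xi.
rewrite /K (bigD1 i) //= -addrA lerDl addr_ge0 // sumr_ge0 // => k _.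
exact: l2norm_ge0.
Qed.

Let img (M : 'M[R[i]]_n) := exists2 A, path_algebra A & psi A = M.

Lemma img_add M N : img M -> img N -> img (M + N).
Proof.
move=> [A hA <-] [B hB <-]; exists (A + B); last exact: rep_add.
by have [_ SD _ _] := @path_algebra_operator_algebra R G; exact: SD.
Qed.
Lemma img_scale (c : R[i]) M : img M -> img (c *: M).
Proof.
move=> [A hA <-]; exists (c *: A); last exact: rep_scale.
by have [_ _ SZ _] := @path_algebra_operator_algebra R G; exact: SZ.
Qed.
Lemma img_mul M N : img M -> img N -> img (M *m N).
Proof.
move=> [A hA <-] [B hB <-]; exists (A \o B).
  by have [_ _ _ SM] := @path_algebra_operator_algebra R G; exact: SM.
by rewrite rep_mul //; exact: path_algebra_sub.
Qed.
Lemma img_vertex x : img (\matrix_(i, j) ((i == j) && (vtx i == x))%:R).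
Proof.
exists (L (vpath x)); first exact: path_algebra_creation.
by rewrite -(upper_on_rep (upper_on_vertex x)).
Qed.
Lemma img_edge e : img (edge_mx e).
Proof.
exists (L (epath e)); first exact: path_algebra_creation.
by rewrite -(upper_on_rep (upper_on_edge e)).
Qed.

(** The part of the skeleton between two visits to the same vertex is a cycle. *)
Lemma repeated_vertex_loop (i j : 'I_n) : (i < j)%N -> vtx i = vtx j ->
  exists e, loop (vtx j) = Some e.
Proof.
move=> ij vij.
have dE : drop i ls = take (j - i) (drop i ls) ++ drop j ls.
  by rewrite -{1}(cat_take_drop (j - i) (drop i ls)) drop_drop subnK // ltnW.
have := composable_drop i; rewrite dE [unzip1 _]map_cat composable_cat => /andP[cp _].
apply: (@loop_cycle _ (@GPath G (vtx j, unzip1 (take (j - i) (drop i ls))) cp)).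
  rewrite /plen /pedges /= size_map size_take size_drop.
  have jsz : (j <= size ls)%N by have := ltn_ord j.
  by case: ifP => _; rewrite subn_gt0 // (leq_trans ij).
split; rewrite /prng /psrc /pedges //=.
transitivity (vtx i); last exact: vij.
by rewrite [in RHS]dE /sk_vertex [unzip1 (_ ++ _)]map_cat end_of_cat.
Qed.

Lemma lam_inj (i j : 'I_n) : lam i = lam j -> i = j.
Proof.
have lamE (k : 'I_n) : lam k = nth 0 (rcons (unzip2 ls) l0) k.
  rewrite nth_rcons size_map; case: (ltnP k (size ls)) => ks.
    have [el0 _] : exists el : edge G * R, True.
      by case: (ls) ks => [|el s] // _; exists el.
    by rewrite (drop_nth el0 ks) (nth_map el0) //; case: (nth _ _ _).
  have -> : k = size ls :> nat by apply/eqP; rewrite eqn_leq ks andbT -ltnS; exact: ltn_ord k.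
  by rewrite eqxx drop_size.
rewrite !lamE => /eqP; rewrite nth_uniq ?size_rcons ?size_map //.
by move=> /eqP h; apply: val_inj.
Qed.

Definition diag_fun_mx (F : 'I_n -> R[i]) : 'M[R[i]]_n :=
  \matrix_(a, b) ((a == b)%:R * F a).

Lemma diag_fun_mx_mul F F' :
  diag_fun_mx F *m diag_fun_mx F' = diag_fun_mx (fun a => F a * F' a).
Proof.
apply/matrixP => a b; rewrite !mxE (bigD1 a) //= !mxE eqxx big1 => [|k ka].
  by rewrite addr0; case: (a == b); rewrite /= ?mul1r ?mul0r ?mulr0.
by rewrite !mxE eq_sym (negbTE ka) !mul0r.
Qed.

Lemma img_vertex_diag x : img (diag_fun_mx (fun a => (vtx a == x)%:R)).
Proof.
have := img_vertex x; congr img; apply/matrixP => a b; rewrite !mxE.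
by rewrite -natrM mulnb.
Qed.

Lemma img_loop_diag e x : loop x = Some e ->
  img (diag_fun_mx (fun a => (vtx a == x)%:R * (lam a)%:C)).
Proof.
move=> lp; have := img_edge e; congr img; apply/matrixP => a b; rewrite !mxE.
have -> : ((a.+1 == b :> nat) && (nth e (unzip1 ls) a == e)) = false.
  apply/negP => /andP[/eqP ab /eqP ne].
  have asz : (a < size (unzip1 ls))%N.
    by rewrite size_map; have := ltn_ord b; rewrite -ab /n.
  have := allP sk _ (mem_nth e asz); rewrite ne.
  by have [-> _] := loopP lp; rewrite lp eqxx.
rewrite addr0; have -> : (loop (vtx a) == Some e) = (vtx a == x).
  apply/eqP/eqP => [h|-> //]; have [<- _] := loopP h; by have [<- _] := loopP lp.
by case: (a == b); case: (vtx a == x); rewrite /= ?mul1r ?mul0r.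
Qed.

(** If the i-th vertex carries no chosen loop, it occurs only once, and the vertex
    projection is the diagonal unit. Otherwise the loop is diagonal with distinct
    entries at the positions of its vertex, and Lagrange interpolation isolates
    one of them. *)
Lemma img_diag (i : 'I_n) : img (diag_fun_mx (fun a => (a == i)%:R)).
Proof.
case lp : (loop (vtx i)) => [e|]; last first.
  have := img_vertex_diag (vtx i); congr img; apply/matrixP => a b; rewrite !mxE.
  congr (_ * (_ : bool)%:R).
  apply/eqP/eqP => [vai|-> //]; apply: val_inj; apply/eqP/negP => /negP.
  rewrite neq_ltn => /orP[ai|ia].
    by have [e he] := repeated_vertex_loop ai vai; rewrite he in lp.
  by have [e he] := repeated_vertex_loop ia (esym vai); rewrite -vai he in lp.
pose D (s : seq 'I_n) := diag_fun_mx (fun a =>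
  (vtx a == vtx i)%:R * \prod_(k <- s) ((lam a)%:C - (lam k)%:C)).
have imgD s : img (D s).
  elim: s => [|k s IHs].
    have := img_vertex_diag (vtx i); congr img; congr diag_fun_mx; apply/funext => a.
    by rewrite big_nil mulr1.
  have := img_mul (img_add (img_loop_diag lp)
            (img_scale (- (lam k)%:C) (img_vertex_diag (vtx i)))) IHs.
  have -> : diag_fun_mx (fun a => (vtx a == vtx i)%:R * (lam a)%:C) +
      - (lam k)%:C *: diag_fun_mx (fun a => (vtx a == vtx i)%:R) =
      diag_fun_mx (fun a => (vtx a == vtx i)%:R * ((lam a)%:C - (lam k)%:C)).
    by apply/matrixP => a b; rewrite !mxE; ring.
  rewrite diag_fun_mx_mul; congr img; congr diag_fun_mx; apply/funext => a; rewrite big_cons.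
  by case: (vtx a == vtx i); rewrite ?mul1r ?mul0r.
pose s := [seq k <- enum 'I_n | k != i].
pose c : R[i] := \prod_(k <- s) ((lam i)%:C - (lam k)%:C).
have c0 : c != 0.
  rewrite /c prodf_seq_neq0; apply/allP => k; rewrite mem_filter => /andP[ki _] /=.
  rewrite subr_eq0; apply: contra ki => /eqP[h]; apply/eqP.
  exact: lam_inj.
have := img_scale c^-1 (imgD s); congr img; apply/matrixP => a b; rewrite !mxE.
have [->|ai] := eqVneq a i; first by rewrite eqxx mul1r -/c mulrCA mulVf // mulr1.
have ins : a \in s by rewrite mem_filter ai mem_enum.
by rewrite (big_rem a ins) /= subrr mul0r !mulr0.
Qed.

(** The edge leading from position j to position i, cut down by the diagonal
    units. *)
Lemma img_superdiag (i j : 'I_n) : i.+1 = j :> nat -> img (delta_mx i j).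
Proof.
move=> ij; have isz : (i < size ls)%N by have := ltn_ord j; rewrite -ij /n.
have [el0 _] : exists el : edge G * R, True.
  by case: (ls) isz => [|el s] // _; exists el.
pose e := nth el0.1 (unzip1 ls) i.
have := img_mul (img_mul (img_diag i) (img_edge e)) (img_diag j).
congr img; apply/matrixP => a b.
have -> : (diag_fun_mx (fun a => (a == i)%:R) *m edge_mx e *m diag_fun_mx (fun a => (a == j)%:R)) a b
    = (a == i)%:R * edge_mx e a b * (b == j)%:R.
  rewrite mxE (bigD1 b) //= big1 ?addr0 => [|k kb]; last first.
    by rewrite [diag_fun_mx _ k b]mxE (negbTE kb) mul0r mulr0.
  rewrite [diag_fun_mx _ b b]mxE eqxx mul1r mxE (bigD1 a) //= big1 ?addr0 => [|k ka]; last first.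
    by rewrite [diag_fun_mx _ a k]mxE eq_sym (negbTE ka) !mul0r.
  by rewrite [diag_fun_mx _ a a]mxE eqxx mul1r.
rewrite [RHS]mxE; have [->|_] := eqVneq a i; last by rewrite !mul0r.
have [->|_] := eqVneq b j; last by rewrite mulr0.
rewrite !mxE mul1r mulr1 ij eqxx (_ : (i == j) = false); last first.
  by apply/eqP => e_ij; rewrite e_ij in ij; move: ij => /eqP; rewrite eqn_leq ltnn.
by rewrite add0r (set_nth_default el0.1) ?size_map // eqxx.
Qed.

Lemma img_delta (i j : 'I_n) : (i <= j)%N -> img (delta_mx i j).
Proof.
suff H d (k : 'I_n) : (k + d = j)%N -> img (delta_mx k j).
  by move=> ij; apply: (H (j - i)%N); rewrite subnKC.
elim: d k => [|d IHd] k kdj.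
  have -> : k = j by apply: val_inj; rewrite /= -kdj addn0.
  have := img_diag j; congr img; apply/matrixP => a b; rewrite !mxE.
  by have [->|_] := eqVneq a j; rewrite ?mulr0 // mulr1 eq_sym.
have kn : (k.+1 < n)%N.
  by apply: leq_ltn_trans (ltn_ord j); rewrite -kdj addnS ltnS leq_addr.
rewrite -(@mul_delta_mx _ _ _ _ (Ordinal kn)); apply: img_mul.
  exact: img_superdiag.
by apply: IHd; rewrite /= addSnnS.
Qed.

Lemma img_upper (M : 'M[R[i]]_n) : (forall i j : 'I_n, (j < i)%N -> M i j = 0) -> img M.
Proof.
move=> uM; rewrite [M]matrix_sum_delta.
have img0 : img 0.
  by have := img_scale 0 (img_vertex y); rewrite scale0r.
have imgS (I : Type) (s : seq I) (F : I -> 'M[R[i]]_n) :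
    (forall k, img (F k)) -> img (\sum_(k <- s) F k).
  by move=> h; elim/big_ind: _ => // A B; exact: img_add.
apply: (imgS) => i; apply: (imgS) => j; case: (leqP i j) => ij.
  by apply: img_scale; exact: img_delta.
by rewrite uM // scale0r.
Qed.

Lemma skeleton_nest_representation : nest_representation psi.
Proof.
split.
- by move=> A B _ _; exact: rep_add.
- by move=> c A _; exact: rep_scale.
- by move=> A B hA hB; exact: rep_mul.
- by move=> A hA eps e0; exact: rep_continuous.
- apply/seteqP; split=> [_ [A hA <-]|M hM] /=.
    by apply/is_trig_mxP => j i ji; rewrite mxE; exact: rep_upper.
  have [|A hA <-] := @img_upper M; last by exists A => //; exact: path_algebra_sub.
  by move=> i j ji; move/is_trig_mxP: hM => /(_ j i ji); rewrite mxE.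
Qed.

Lemma skeleton_rep_corner A :
  psi A ord0 ord_max = inner (A (xi (vpath y))) (sk_vector loop y l0 ls).
Proof.
have d0 : drop (@ord0 (size ls)) ls = ls by exact: drop0.
have dm : drop (@ord_max (size ls)) ls = [::] by exact: drop_size.
have pE : sk_path y ([::] : seq (edge G * R)) = vpath y.
  by have [h1 h2] := @sk_pathE R G y [::] isT; exact: (@gpath_eq _ _ (vpath y) h1 h2).
by rewrite mxE /sk_unit /sk_covector d0 dm pE.
Qed.

End SkeletonRepresentation.

(** A nonzero A has a nonzero Fourier coefficient; the corner entry of the
    representation of a suitable skeleton detects it. *)
Lemma loops_separate (R : realType) (G : digraph) :
  (forall x : vertex G,
    (exists p : gpath G, (0 < plen p)%N /\ supports_cycle x p) ->
    exists e : edge G, supports_loop_edge x e) ->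
  nest_representations_separate_points R G.
Proof.
move=> hG A hA A0.
pose loop x : option (edge G) :=
  if pselect (exists e, supports_loop_edge x e) is left h then Some (proj1_sig (cid h))
  else None.
have loopP x e : loop x = Some e -> supports_loop_edge x e.
  rewrite /loop; case: pselect => // h [<-]; exact: (proj2_sig (cid h)).
have loop_cycle x p : (0 < plen p)%N -> supports_cycle x p -> exists e, loop x = Some e.
  move=> p0 cp; rewrite /loop; case: pselect => [h|nh]; first by eexists.
  by case: nh; apply: hG; exists p.
have cA := algebra_right_commuting hA.
have [w [v nz]] : exists w v, A (xi R w) v != 0.
  apply: contrapT => no; apply: A0; apply: operator_density.
  - exact: algebra_bounded.
  - exact: bounded0.
  move=> w; apply: l2P => v; apply/eqP/negP => /negP h; apply: no; by exists w, v.
have [q nzq] : exists q, A (xi R (vpath (psrc q))) q != 0.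
  move: nz; rewrite (commuting_coef _ _ cA); case: (rquo w v) => [q|]; last by rewrite eqxx.
  by move=> h; exists q.
have [l0 [ls [/andP[sm _] /andP[cm sk] un _ nz']]] :=
  @skeleton_exists R G loop loopP (psrc q) (pedges q) _ q erefl erefl nzq.
exists (size ls).+1, (sk_rep loop (psrc q) l0 ls); split=> //.
  exact: skeleton_nest_representation.
move=> /matrixP/(_ ord0 ord_max); rewrite skeleton_rep_corner ?mxE //.
exact/eqP.
Qed.

(** * Shift-orthogonality and outer operators *)

Section RightCreations.
Variables (R : realType) (G : digraph).
Local Notation H := (l2 R (gpath G)).
Local Notation Rc u := (@right_creation R G u).
Local Notation xi := (@xi R (gpath G)).
Implicit Types (p q t u v w : gpath G) (x y : vertex G) (e : edge G) (f g : H).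

Lemma right_creation_bounded u : bounded_operator (Rc u).
Proof. exact: pull_bounded. Qed.

Lemma sqn_right_creation u f : sqn (Rc u f) <= sqn f.
Proof. exact: sqn_pull. Qed.

(** The adjoint of the right creation. *)
Definition right_annihilation u : H -> H := pull (@pprod_injl G u).
Local Notation Ra u := (right_annihilation u).

Lemma right_annihilationE u f w : Ra u f w = oapp f 0 (pprod w u).
Proof. by []. Qed.

Lemma inner_right_creation u f g : inner (Rc u f) g = inner f (Ra u g).
Proof.
apply/eqP; rewrite -subr_eq0; apply/eqP; move: f.
apply: (@functional_density _ _ _ (l2norm g + l2norm (Ra u g))) => [a f h|f|w].
- by rewrite right_creation_linear !innerPl; ring.
- apply: le_trans (le_normcD _ _) _; rewrite normcN mulrDl; apply: lerD.
    apply: le_trans (normc_inner_le _ _) _.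
    by rewrite mulrC ler_wpM2l ?l2norm_ge0 // l2norm_pull.
  by apply: le_trans (normc_inner_le _ _) _; rewrite mulrC.
- rewrite right_creation_xi [inner (xi w) _]inner_xil right_annihilationE.
  case: (pprod w u) => [v|]; first by rewrite [oapp _ _ _]/= inner_xil subrr.
  by rewrite inner0l [oapp _ _ _]/= conjc0 subrr.
Qed.

Lemma right_creation_comp w u f :
  Rc u (Rc w f) = oapp (fun v => Rc v f) 0 (pprod w u).
Proof.
have hb : bounded_operator (Rc u \o Rc w).
  by apply: bounded_comp; exact: right_creation_bounded.
have hb' : bounded_operator (oapp (fun v => Rc v) 0 (pprod w u)).
  by case: (pprod w u) => [v|]; [exact: right_creation_bounded|exact: bounded0].
have : Rc u \o Rc w = oapp (fun v => Rc v) 0 (pprod w u).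
  apply: operator_density => // t /=; rewrite right_creation_xi.
  case tw : (pprod t w) => [s|]; have := pprodA t w u; rewrite tw.
    rewrite [oapp _ _ (Some s)]/= right_creation_xi => /= ->.
    by case: (pprod w u) => [v|] //=; rewrite right_creation_xi.
  rewrite /= (lin0 (right_creation_linear u)).
  by case: (pprod w u) => [v|] //= vw; rewrite right_creation_xi -vw.
by move=> /(congr1 (fun T => T f)) /= ->; case: (pprod w u).
Qed.

Lemma right_creation_vertex x f v :
  Rc (vpath x) f v = if psrc v == x then f v else 0.
Proof.
rewrite right_creationE; case vx : (rquo (vpath x) v) => [q|] /=.
  move/rquoP: vx; rewrite pprod_vpathr; case: (eqVneq (psrc q) x) => // qx [<-].
  by rewrite qx eqxx.
case: eqP => // h; suff : rquo (vpath x) v = Some v by rewrite vx.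
by apply/rquoP; rewrite pprod_vpathr h eqxx.
Qed.

Lemma right_annihilation_creation u f :
  Ra u (Rc u f) = Rc (vpath (prng u)) f.
Proof.
apply: l2P => w; rewrite right_annihilationE right_creation_vertex.
case wu : (pprod w u) => [v|].
  rewrite -[LHS]/(Rc u f v) right_creationE; have/rquoP -> := wu.
  by have [-> _ _] := pprod_Some wu; rewrite eqxx.
by case: eqP => // h; have [v] := pprodP h; rewrite wu.
Qed.

(** Two endings of the same path: the longer one ends with the shorter one. Hence
    R_w and R_w' have orthogonal ranges unless one of w, w' ends with the
    other. *)
Lemma right_divisors_comparable t w s w' v :
  pprod t w = Some v -> pprod s w' = Some v ->
  (exists z, pprod z w' = Some w) \/ (exists z, pprod z w = Some w').
Proof.
have half a b c d z : pprod a b = Some z -> pprod c d = Some z ->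
    (size (pedges d) <= size (pedges b))%N -> exists q, pprod q d = Some b.
  move=> /pprod_Some[ab1 ab2 ab3] /pprod_Some[cd1 cd2 cd3] le.
  have bE : pedges b = take (size (pedges b) - size (pedges d)) (pedges b) ++ pedges d.
    rewrite -{1}(cat_take_drop (size (pedges b) - size (pedges d)) (pedges b)).
    congr (_ ++ _); move: cd3; rewrite ab3 => E.
    have := congr1 (drop (size (pedges c))) E.
    rewrite [RHS](@drop_size_cat _ _ (pedges c)) // => <-.
    have sz := congr1 size E; rewrite !size_cat in sz.
    rewrite drop_cat ltnNge (_ : (size (pedges a) <= size (pedges c))%N) /=.
      rewrite size_drop; congr drop; move: le sz; move: (size (pedges a)) (size (pedges b)).
      by move: (size (pedges c)) (size (pedges d)) => *; lia.
    move: le sz; move: (size (pedges a)) (size (pedges b)).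
    by move: (size (pedges c)) (size (pedges d)) => *; lia.
  have := valP b; rewrite /= -[(val b).2]/(pedges b) -[(val b).1]/(psrc b) bE.
  have sbd : psrc b = psrc d by rewrite -ab2.
  rewrite composable_cat sbd -/(prng d) => /andP[cq _].
  by exists (@GPath G (prng d, _) cq); apply/pprodE; split.
move=> h h'; case: (leqP (size (pedges w')) (size (pedges w))) => le.
  by left; exact: half h h' le.
by right; exact: half h' h (ltnW le).
Qed.

End RightCreations.

Section OuterOperator.
Variables (R : realType) (G : digraph) (x : vertex G).
Local Notation H := (l2 R (gpath G)).
Local Notation Rc u := (@right_creation R G u).
Local Notation xi := (@xi R (gpath G)).
Local Notation vx := (vpath x).
Variables (A : H -> H) (kappa : R).
Hypotheses (cA : right_commuting A) (k_gt0 : 0 < kappa).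

Let bA := proj1 cA.
Local Notation Q := (graph_form A kappa).
Local Notation N := (graph_sqn A kappa).

Definition cycle_supported (g : H) :=
  forall w, ~ (psrc w = x /\ prng w = x) -> g w = 0.

Section WithMinimiser.
Variable g : H.
Hypotheses (g1 : g vx = 1) (g2 : cycle_supported g).
Hypothesis g3 : forall k : H, k vx = 0 -> cycle_supported k -> Q k g = 0.

Lemma minimiser_source : Rc vx g = g.
Proof.
apply: l2P => w; rewrite right_creation_vertex; case: eqP => // h.
by rewrite g2 // => -[].
Qed.

(** R_z g has coordinate 0 at the vertex x and is supported on cycles at x, so it
    is an admissible direction at the minimiser g. *)
Lemma orthogonal_shift z : psrc z = x -> (0 < plen z)%N -> Q (Rc z g) g = 0.
Proof.
move=> sz pz; apply: g3 => [|w nw]; rewrite right_creationE.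
  case zv : (rquo z vx) => [q|] //=; move/rquoP: zv => /pprod_Some[_ _].
  move=> /(congr1 size); rewrite size_cat -/(plen z) => /eqP.
  by rewrite eq_sym addn_eq0 [plen z == 0%N]eqn0Ngt pz andbF.
case zw : (rquo z w) => [q|] //=; move/rquoP: zw => zw; apply: g2 => -[h1 h2].
by apply: nw; have [_ -> _] := pprod_Some zw; rewrite (prng_pprod zw).
Qed.

Lemma inner_shift u (a b : H) : prng u = x -> Rc vx b = b ->
  inner (Rc u a) (Rc u b) = inner a b.
Proof. by move=> ux bx; rewrite inner_right_creation right_annihilation_creation ux bx. Qed.

Lemma orthogonal_shifts_div z w w' : pprod z w' = Some w -> prng w' = x -> w != w' ->
  Q (Rc w g) (Rc w' g) = 0.
Proof.
move=> zw w'x ww'.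
have Rw f : Rc w f = Rc w' (Rc z f) by rewrite right_creation_comp zw.
rewrite /graph_form !(proj2 cA) !Rw.
rewrite !inner_shift ?minimiser_source //; last first.
  by rewrite -(proj2 cA) minimiser_source.
rewrite -(proj2 cA); apply: orthogonal_shift.
  by have [-> _ _] := pprod_Some zw.
rewrite /plen lt0n; apply: contra ww' => /nilP ze; apply/eqP.
have [_ h1 h2] := pprod_Some zw; apply: gpath_eq => //.
by rewrite h2 ze.
Qed.

(** As A commutes with the R_w, so does the pair (identity, A); after cancelling
    the common ending, either the ranges are orthogonal or the previous
    orthogonality applies. *)
Lemma orthogonal_shifts w w' : prng w = x -> prng w' = x -> w != w' ->
  Q (Rc w g) (Rc w' g) = 0.
Proof.
move=> wx w'x ww'.
case: (pselect (exists z, pprod z w' = Some w)) => [[z zw]|n1].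
  exact: orthogonal_shifts_div zw w'x ww'.
case: (pselect (exists z, pprod z w = Some w')) => [[z zw]|n2].
  rewrite (graph_form_conj A kappa) (orthogonal_shifts_div zw wx) ?conjc0 //.
  by rewrite eq_sym.
have zero (a b : H) : inner (Rc w a) (Rc w' b) = 0.
  rewrite inner_right_creation (_ : right_annihilation w _ = 0) ?inner0r //.
  apply: l2P => t; rewrite right_annihilationE; case tw : (pprod t w) => [v|] //=.
  case w'v : (rquo w' v) => [s|] //=; move/rquoP: w'v => sw'.
  by case: (right_divisors_comparable tw sw').
by rewrite /graph_form !(proj2 cA) !zero mulr0 addr0.
Qed.

(** Comparison of the minimiser g with the competitor xi_x; for the form that is
    minimised, their difference is orthogonal to g. *)
Lemma minimiser_sqn : N g <= 1 + kappa * sqn (A (xi vx)).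
Proof.
have h0 : Q (xi vx - g) g = 0.
  apply: g3 => [|w nw]; rewrite l2_DE l2_NE xiE.
    by rewrite eqxx g1 subrr.
  rewrite g2 // subr0; case: eqP => // wv; by case: nw; rewrite wv.
have := form_sqD (graph_form_lin kappa bA) (graph_form_conj A kappa)
   (graph_form_diag A kappa) g (xi vx - g) 1.
rewrite scale1r subrK h0 mulr0 normc1 expr1n mul1r.
have := graph_sqn_ge0 A (ltW k_gt0) (xi vx - g).
rewrite [N (xi vx)]/graph_sqn sqn_xi => h1 h2; rewrite h2.
by rewrite mulr0 addr0 lerDl.
Qed.

Let b w : H := if prng w == x then Rc w g else 0.

Lemma image_sqn s (c : gpath G -> R[i]) : uniq s ->
  N (\sum_(w <- s) c w *: b w) <=
  (1 + kappa * sqn (A (xi vx))) * \sum_(w <- s) normc (c w) ^+ 2.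
Proof.
have lin := graph_form_lin kappa bA.
have Q0l f : Q 0 f = 0.
  by have := lin (-1) 0 0 f; rewrite scaler0 addr0 mulN1r addNr.
have Q0r f : Q f 0 = 0 by rewrite (graph_form_conj A kappa) Q0l conjc0.
elim: s => [|w s IHs] us.
  by rewrite !big_nil mulr0 /graph_sqn (lin0 (bounded_linear bA)) !sqn0 mulr0 addr0.
move: us => /andP[ws us]; rewrite !big_cons mulrDr.
rewrite (form_sqD lin (graph_form_conj A kappa) (graph_form_diag A kappa)).
have -> : Q (b w) (\sum_(j <- s) c j *: b j) = 0.
  rewrite (graph_form_conj A kappa).
  suff -> : Q (\sum_(j <- s) c j *: b j) (b w) = 0 by rewrite conjc0.
  elim: (s) ws => [|v r IHr]; first by rewrite big_nil Q0l.
  rewrite inE negb_or big_cons => /andP[wv wr]; rewrite lin IHr // addr0 /b.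
  case: eqP => [vx_|_]; last by rewrite Q0l mulr0.
  case: eqP => [wx_|_]; last by rewrite Q0r mulr0.
  by rewrite orthogonal_shifts ?mulr0 // eq_sym.
rewrite mulr0 mulr0 addr0 addrC; apply: lerD; last exact: IHs.
rewrite mulrC; apply: ler_wpM2r; first exact: sqr_ge0.
apply: le_trans minimiser_sqn; rewrite /b; case: eqP => _.
  rewrite /graph_sqn (proj2 cA); apply: lerD; first exact: sqn_right_creation.
  by apply: ler_wpM2l; [exact: ltW|exact: sqn_right_creation].
rewrite [leLHS]/graph_sqn (lin0 (bounded_linear bA)) !sqn0 mulr0 addr0.
exact: graph_sqn_ge0 (ltW k_gt0) g.
Qed.

End WithMinimiser.

(** F maps xi_w to R_w g if w ends at x and to 0 otherwise, where g minimises
    |g|^2 + kappa |A g|^2 among the vectors with coordinate 1 at x that are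
    supported on cycles at x. The vectors R_w g are orthogonal for the form
    defining the minimum, so F and A F have norms controlled by the minimal value;
    and F commutes with the R_u by construction. For small A xi_x and large kappa,
    F is almost a contraction, has constant coefficient 1 and makes A F small. *)
Lemma outer_operator : exists F : H -> H,
  [/\ right_commuting F, F (xi vx) vx = 1,
      forall f, sqn (F f) <= (1 + kappa * sqn (A (xi vx))) * sqn f &
      forall f, kappa * sqn (A (F f)) <= (1 + kappa * sqn (A (xi vx))) * sqn f].
Proof.
have [g [g1 g2 g3]] := @graph_minimum R (gpath G) A kappa vx
   [set w | psrc w = x /\ prng w = x] bA (ltW k_gt0) (conj erefl erefl).
set m := 1 + kappa * sqn (A (xi vx)).
have m0 : 0 <= m by rewrite addr_ge0 // mulr_ge0 ?sqn_ge0 // ltW.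
pose b w : H := if prng w == x then Rc w g else 0.
have b_le s (c : gpath G -> R[i]) (us : uniq s) := image_sqn g1 g2 g3 c us.
have linA := bounded_linear bA.
have [|F [bF Fxi F_le]] := @operator_of_images R (gpath G) b m m0.
  move=> s c us; apply: le_trans (b_le s c us).
  by rewrite lerDl mulr_ge0 ?sqn_ge0 // ltW.
have mk0 : 0 <= m / kappa by rewrite divr_ge0 // ltW.
have [|F' [bF' F'xi F'_le]] := @operator_of_images R (gpath G) (fun w => A (b w)) _ mk0.
  move=> s c us; have := b_le s c us.
  have -> : \sum_(w <- s) c w *: A (b w) = A (\sum_(w <- s) c w *: b w).
    by rewrite (lin_sum linA); apply: eq_bigr => w _; rewrite (linZ linA).
  move=> le1; rewrite mulrAC ler_pdivlMr // mulrC; apply: le_trans le1.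
  by rewrite lerDr sqn_ge0.
have F'E : F' = A \o F.
  apply: operator_density => //; first exact: bounded_comp.
  by move=> w; rewrite F'xi /= Fxi.
exists F; split=> //.
- split=> // u f.
  have : F \o Rc u = Rc u \o F; last by move=> /(congr1 (fun T => T f)).
  apply: operator_density.
  + by apply: bounded_comp => //; exact: right_creation_bounded.
  + by apply: bounded_comp => //; exact: right_creation_bounded.
  move=> w /=; rewrite right_creation_xi Fxi /b.
  case wu : (pprod w u) => [v|] /=.
    rewrite Fxi /b (prng_pprod wu); case: eqP => _.
      by rewrite right_creation_comp wu.
    by rewrite (lin0 (right_creation_linear u)).
  rewrite (lin0 (bounded_linear bF)); case: eqP => _.
    by rewrite right_creation_comp wu.
  by rewrite (lin0 (right_creation_linear u)).
- by rewrite Fxi /b eqxx right_creation_vertex eqxx.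
- move=> f; have := F'_le f; rewrite F'E /= mulrAC ler_pdivlMr // mulrC.
  exact.
Qed.

End OuterOperator.

(** * Constant coefficients and characters at a vertex without loops *)

Section CommutantAlgebra.
Variables (R : realType) (G : digraph).
Local Notation H := (l2 R (gpath G)).
Local Notation L p := (@left_creation R G p).
Local Notation La p := (@left_annihilation R G p).
Local Notation Rc u := (@right_creation R G u).
Local Notation LG := (@free_semigroupoid_algebra R G).
Local Notation xi := (@xi R (gpath G)).
Implicit Types (p q t u v w : gpath G) (x y : vertex G) (e : edge G) (f g : H).

Lemma algebra_add A B : LG A -> LG B -> LG (A + B).
Proof.
move=> /algebra_commutant[bA cA] /algebra_commutant[bB cB].
apply/algebra_commutant; split=> [|u f]; first exact: boundedD.
rewrite -[(A + B) _]/(A (Rc u f) + B (Rc u f)) cA cB.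
by rewrite -(linD (right_creation_linear u)).
Qed.

Lemma algebra_scale (c : R[i]) A : LG A -> LG (c *: A).
Proof.
move=> /algebra_commutant[bA cA]; apply/algebra_commutant; split=> [|u f].
  exact: boundedZ.
by rewrite -[(c *: A) _]/(c *: A (Rc u f)) cA -(linZ (right_creation_linear u)).
Qed.

Lemma algebra_comp A B : LG A -> LG B -> LG (A \o B).
Proof.
move=> /algebra_commutant[bA cA] /algebra_commutant[bB cB].
apply/algebra_commutant; split=> [|u f]; first exact: bounded_comp.
by rewrite /= cB cA.
Qed.

Lemma algebra_id : LG id.
Proof. by apply/algebra_commutant; split=> //; exact: bounded_id. Qed.

Lemma algebra_sub A B : LG A -> LG B -> LG (A - B).
Proof. by move=> hA hB; apply: algebra_add => //; rewrite -scaleN1r; exact: algebra_scale. Qed.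

Definition starts e v := ohead (pedges v) == Some e.

Lemma starts_prng e v : starts e v -> prng v = erng e.
Proof. by rewrite /starts /prng; case: (pedges v) => // e' es /eqP[->]. Qed.

Lemma left_creation_annihilation e f v :
  L (epath e) (La (epath e) f) v = if starts e v then f v else 0.
Proof.
rewrite left_creationE; case ev : (lquo (epath e) v) => [w|].
  rewrite -[LHS]/(La (epath e) f w) left_annihilationE; move/lquoP: ev => ew.
  have st : starts e v by have [_ _ h] := pprod_Some ew; rewrite /starts h.
  by rewrite st ew.
case: ifP => // /eqP; case ve : (pedges v) => [|e' es] //= -[e'e].
have [w] := path_cons ve; rewrite e'e => /lquoP.
by rewrite ev.
Qed.

(** Removing the leftmost edge commutes with attaching u on the right, except on
    the vertex r(e) itself, where the edge to be removed would be taken from u.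
    The coordinate of g there has to vanish. *)
Lemma left_annihilation_shift e u g : g (vpath (erng e)) = 0 ->
  La (epath e) (Rc u g) = Rc u (La (epath e) g).
Proof.
move=> g0; apply: l2P => w; rewrite left_annihilationE right_creationE.
case uw : (rquo u w) => [q|].
  move/rquoP: uw => qu; rewrite -[RHS]/(La (epath e) g q) left_annihilationE.
  have := pprodA (epath e) q u; rewrite qu /= => <-.
  case eq : (pprod (epath e) q) => [s|] //=.
  case su : (pprod s u) => [t|]; first by rewrite -[LHS]/(Rc u g t) right_creationE;
    have/rquoP -> := su.
  by have [h _ _] := pprod_Some qu; have [_ s1 _] := pprod_Some eq;
     have [t] := pprodP (etrans s1 h); rewrite su.
case ew : (pprod (epath e) w) => [t|] //.
rewrite -[LHS]/(Rc u g t) right_creationE; case ut : (rquo u t) => [q|] //=.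
move/rquoP: ut => qu; case qe : (pedges q) => [|e' es].
  rewrite (size0_path qe) -[in RHS]g0; congr (g (vpath _)).
  have [-> _ _] := pprod_Some qu.
  have tu : t = u.
    by have [_ h1 h2] := pprod_Some qu; apply: gpath_eq => //; rewrite h2 qe.
  by rewrite -tu (prng_pprod ew).
have [q' eq' _] := path_cons qe.
have [_ h1 h2] := pprod_Some qu; have [_ h3 h4] := pprod_Some ew.
have e'E : e' = e by move: h4; rewrite h2 qe => -[].
have := pprodA (epath e') q' u; rewrite eq' /= qu e'E.
case q'u : (pprod q' u) => [w'|] //= ew'.
have ww : w = w' by apply: (pprod_injr ew); rewrite -ew'.
by move/rquoP: q'u; rewrite -ww uw.
Qed.

Section AtVertex.
Variable x : vertex G.
Local Notation vx := (vpath x).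

(** The Fourier coefficient at the path of length 0. It is a character because
    every factorisation of a vertex is trivial. *)
Definition chi (A : H -> H) : R[i] := A (xi vx) vx.

(** The left creations of paths of positive length do not reach a vertex, so only
    the constant coefficient contributes to the coordinate at x. *)
Lemma chi_eval A f : LG A -> A f vx = chi A * f vx.
Proof.
move=> hA; have cA := algebra_right_commuting hA; have [bA _] := cA.
have linA := bounded_linear bA; have [M M0 hM] := bounded_bound bA.
apply/eqP; rewrite -subr_eq0; apply/eqP; move: f.
apply: (@functional_density _ _ _ (M + normc (chi A))) => [a f g|f|w].
- by rewrite linA !l2_DE !l2_ZE; ring.
- apply: le_trans (le_normcD _ _) _; rewrite normcN normcM mulrDl; apply: lerD.
    exact: le_trans (normc_coord_le _ _) (hM f).
  by rewrite ler_wpM2l ?normc_ge0 ?normc_coord_le.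
- rewrite (commuting_coef _ _ cA) xiE.
  have [<-|xw] := eqVneq vx w.
    have -> : rquo vx vx = Some vx by apply/rquoP; rewrite pprod_vpathr eqxx.
    by rewrite /= mulr1 subrr.
  rewrite mulr0 subr0; case wx : (rquo w vx) => [q|] //=.
  move/rquoP: wx => /pprod_Some[_ h1 h2]; case/eqP: xw; apply: gpath_eq => //.
  by move: h2 => /=; case: (pedges q) => //= <-.
Qed.

Lemma chi_comp A B : LG A -> LG B -> chi (A \o B) = chi A * chi B.
Proof. by move=> hA hB; rewrite /chi /= chi_eval. Qed.

(** A without the part of its range spanned by the paths that begin with e. *)
Definition cut e (A : H -> H) : H -> H := A - (L (epath e) \o (La (epath e) \o A)).

Lemma cutE e A f v : cut e A f v = if starts e v then 0 else A f v.
Proof.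
rewrite -[cut e A f v]/(A f v - L (epath e) (La (epath e) (A f)) v).
by rewrite left_creation_annihilation; case: ifP; rewrite ?subrr ?subr0.
Qed.

(** The part of A that is cut off is L_e times an element of the algebra, provided
    that the constant coefficient of A vanishes. *)
Lemma annihilation_algebra e A : erng e = x -> LG A -> chi A = 0 ->
  LG (La (epath e) \o A).
Proof.
move=> ex hA A0; have [bA cA] := algebra_right_commuting hA.
apply/algebra_commutant; split=> [|u f].
  by apply: bounded_comp => //; exact: pull_bounded.
rewrite /= cA left_annihilation_shift //.
by rewrite ex chi_eval // A0 mul0r.
Qed.

Lemma cut_algebra e A : erng e = x -> LG A -> chi A = 0 -> LG (cut e A).
Proof.
move=> ex hA A0; apply: algebra_sub => //.
exact: algebra_comp (creation_in_algebra _ _) (annihilation_algebra ex hA A0).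
Qed.

Lemma l2norm_mono f g : (forall v, normc (f v) <= normc (g v)) -> l2norm f <= l2norm g.
Proof.
move=> fg; rewrite l2norm_le ?l2norm_ge0 // l2norm_sqr; apply: sqn_le => s us.
apply: le_trans (psum_le_sqn g us); apply: ler_sum => v _.
by rewrite ler_pXn2r ?nnegrE ?normc_ge0.
Qed.

Lemma l2norm_cut e A f : l2norm (cut e A f) <= l2norm (A f).
Proof.
by apply: l2norm_mono => v; rewrite cutE; case: ifP; rewrite ?normc0 ?normc_ge0.
Qed.

Section Character.
Hypothesis no_loop : forall e, ~ supports_loop_edge x e.
Variable theta : (H -> H) -> R[i].
Hypotheses (th_add : forall A B, LG A -> LG B -> theta (A + B) = theta A + theta B)
  (th_scale : forall (c : R[i]) A, LG A -> theta (c *: A) = c * theta A)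
  (th_mul : forall A B, LG A -> LG B -> theta (A \o B) = theta A * theta B)
  (th_x : theta (L vx) = 1).

Lemma theta0 : theta 0 = 0.
Proof. by have := th_scale 0 algebra_id; rewrite scale0r mul0r. Qed.

Lemma theta_sub A B : LG A -> LG B -> theta (A - B) = theta A - theta B.
Proof.
move=> hA hB; rewrite -scaleN1r th_add //; last exact: algebra_scale.
by rewrite th_scale // mulN1r.
Qed.

Lemma theta_id : theta id = 1.
Proof.
have := th_mul algebra_id (creation_in_algebra R vx).
by rewrite th_x mulr1 => <-; rewrite -[RHS]th_x.
Qed.

(** A character with theta (L_x) = 1 vanishes on the projection of every other
    vertex, and e starts at another vertex because x has no loops. *)
Lemma theta_edge e : erng e = x -> theta (L (epath e)) = 0.
Proof.
move=> ex; have sx : esrc e != x.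
  by apply/eqP => h; apply: (no_loop (e := e)).
have s0 : theta (L (vpath (esrc e))) = 0.
  have := th_mul (creation_in_algebra R (vpath (esrc e))) (creation_in_algebra R vx).
  rewrite th_x mulr1 => <-; rewrite -[RHS]theta0; congr theta; apply/funext => f.
  by rewrite /= left_creation_comp pprod_vpathl /= eq_sym (negbTE sx).
have := th_mul (creation_in_algebra R (epath e)) (creation_in_algebra R (vpath (esrc e))).
rewrite s0 mulr0 => <-; congr theta; apply/funext => f.
by rewrite /= left_creation_comp pprod_vpathr eqxx.
Qed.

(** The difference is L_e times an element of the algebra, and theta (L_e) = 0. *)
Lemma theta_cut e A : erng e = x -> LG A -> chi A = 0 -> theta (cut e A) = theta A.
Proof.
move=> ex hA A0; rewrite theta_sub //; last first.
  exact: algebra_comp (creation_in_algebra _ _) (annihilation_algebra ex hA A0).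
rewrite th_mul.
- by rewrite theta_edge // mul0r subr0.
- exact: creation_in_algebra.
- exact: annihilation_algebra.
Qed.

Lemma chi_cut e A : chi (cut e A) = chi A.
Proof. by rewrite /chi cutE. Qed.

Lemma cut_edges (S : seq (edge G)) A : all (fun e => erng e == x) S ->
  LG A -> chi A = 0 ->
  exists B, [/\ LG B, chi B = 0, theta B = theta A &
    forall f v, B f v = if has (starts^~ v) S then 0 else A f v].
Proof.
elim: S => [|e S IHS] /=; first by exists A.
move=> /andP[/eqP ex Sx] hA A0; have [B [hB B0 thB BE]] := IHS Sx hA A0.
exists (cut e B); split.
- exact: cut_algebra.
- by rewrite chi_cut.
- by rewrite theta_cut.
- by move=> f v; rewrite cutE BE; case: (starts e v).
Qed.

Lemma theta_range A : LG A -> theta (L vx \o A) = theta A.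
Proof. by move=> hA; rewrite th_mul ?th_x ?mul1r //; exact: creation_in_algebra. Qed.

Lemma left_vertexE f v : L vx f v = if prng v == x then f v else 0.
Proof.
rewrite left_creationE; case xv : (lquo vx v) => [w|].
  move/lquoP: xv; rewrite pprod_vpathl; case: eqP => // wx [<-].
  by rewrite wx eqxx.
case: eqP => // h; have : lquo vx v = Some v by apply/lquoP; rewrite pprod_vpathl h eqxx.
by rewrite xv.
Qed.

(** The vector L_x A xi_x is square summable, hence up to a small error supported
    on finitely many cycles at x. As chi (A) = 0 these have positive length, and
    cutting off their leftmost edges removes them without changing theta. *)
Lemma small_symbol A (eps : R) : LG A -> chi A = 0 -> 0 < eps ->
  exists B, [/\ LG B, chi B = 0, theta B = theta A & l2norm (B (xi vx)) <= eps].
Proof.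
move=> hA A0 eps0; have hLA : LG (L vx \o A).
  by apply: algebra_comp => //; exact: creation_in_algebra.
have LA0 : chi (L vx \o A) = 0.
  by rewrite -[chi _]/(L vx (A (xi vx)) vx) left_vertexE eqxx; exact: A0.
set a := (L vx \o A) (xi vx).
have [s us /(_ s us (fun _ => id)) hs] := trunc_approx a eps0.
pose S := [seq e <- flatten (map (@pedges G) s) | erng e == x].
have [|B [hB B0 thB BE]] := @cut_edges S _ _ hLA LA0; first exact: filter_all.
exists B; split=> //; first by rewrite thB theta_range.
apply: le_trans hs; apply: l2norm_mono => v; rewrite BE -/a.
case: ifPn => [_|nS]; first by rewrite normc0 normc_ge0.
rewrite l2_DE l2_NE truncE //; case: ifPn => vs; last by rewrite subr0.
suff -> : a v = 0 by rewrite subrr.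
apply/eqP; apply: contraNT nS => av; have vr : prng v = x.
  move: av; rewrite /a -[(L vx \o A) _]/(L vx (A (xi vx))) left_vertexE.
  by case: (eqVneq (prng v) x) => // _; rewrite eqxx.
have sv : psrc v = x.
  have := algebra_right_commuting hLA => -[_ /(_ vx (xi vx))].
  have -> : Rc vx (xi vx) = xi vx by rewrite right_creation_xi pprod_vpathr eqxx.
  rewrite -/a => /(congr1 (fun f : H => f v)); rewrite right_creation_vertex.
  by case: eqP => // _ a0; rewrite a0 eqxx in av.
case ve : (pedges v) => [|e es].
  by move: av; rewrite (size0_path ve) sv -[a vx]/(chi (L vx \o A)) LA0 eqxx.
apply/hasP; exists e; last by rewrite /starts ve.
rewrite mem_filter; apply/andP; split.
  by rewrite -vr /prng ve.
by apply/flattenP; exists (pedges v); [exact: map_f|rewrite ve inE eqxx].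
Qed.

End Character.
End AtVertex.
End CommutantAlgebra.

(** * A bounded character is the constant coefficient *)

Section CharacterValue.
Variables (R : realType) (G : digraph) (x : vertex G).
Local Notation H := (l2 R (gpath G)).
Local Notation L p := (@left_creation R G p).
Local Notation LG := (@free_semigroupoid_algebra R G).
Local Notation xi := (@xi R (gpath G)).
Local Notation vx := (vpath x).
Local Notation chi := (@chi R G x).
Implicit Types (f g : H).

Hypothesis no_loop : forall e, ~ supports_loop_edge x e.
Variable theta : (H -> H) -> R[i].
Hypotheses (th_add : forall A B, LG A -> LG B -> theta (A + B) = theta A + theta B)
  (th_scale : forall (c : R[i]) A, LG A -> theta (c *: A) = c * theta A)
  (th_mul : forall A B, LG A -> LG B -> theta (A \o B) = theta A * theta B)
  (th_x : theta (L vx) = 1).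
Variables (p : gpath G) (e0 : edge G) (C : R).
Hypotheses (p_starts : starts e0 p) (e0x : erng e0 = x) (C0 : 0 <= C).
Hypothesis th_le : forall Y (M : R), LG Y -> 0 <= M ->
  (forall f, l2norm (Y (L p f)) <= M * l2norm f) -> normc (theta Y) <= C * M.

Lemma sqn_left_creation q f : sqn (L q f) <= sqn f.
Proof.
rewrite -!l2norm_sqr ler_pXn2r ?nnegrE ?l2norm_ge0 //; exact: l2norm_left_creation.
Qed.

(** The outer operator F for a B as in small_symbol, multiplied by rho. Since
    theta (B F) is bounded by C ||B F L_p||, which is of order kappa^(-1/2), and
    theta (B) = theta (A) is fixed, theta (F) tends to 0 as kappa grows, whereas
    chi (F) = 1. *)
Lemma small_value_contraction A (rho nu : R) : LG A -> chi A = 0 -> theta A != 0 ->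
  0 < rho -> rho < 1 -> 0 < nu ->
  exists T, [/\ LG T, forall f, l2norm (T f) <= l2norm f, chi T = rho%:C &
    normc (theta T) <= nu].
Proof.
move=> hA A0 tA r0 r1 nu0.
have t0 : 0 < normc (theta A) by rewrite lt_def normc_eq0 tA normc_ge0.
have r2 : 0 < 1 - rho ^+ 2 by rewrite subr_gt0 expr_lt1 // ltW.
have nt0 : 0 < (nu * normc (theta A)) ^+ 2 by rewrite exprn_gt0 // mulr_gt0.
(* k1 makes rho F a contraction, k2 bounds theta F by nu *)
pose k1 := rho ^+ 2 / (1 - rho ^+ 2).
pose k2 := 2 * C ^+ 2 / (nu * normc (theta A)) ^+ 2.
have k10 : 0 <= k1 by rewrite divr_ge0 ?sqr_ge0 // ltW.
have k20 : 0 <= k2 by rewrite divr_ge0 ?mulr_ge0 ?sqr_ge0 // ltW.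
pose kappa := 1 + k1 + k2.
have kge1 : 1 <= kappa by rewrite /kappa -addrA lerDl addr_ge0.
have k0 : 0 < kappa by apply: lt_le_trans kge1.
have [|B [hB B0 thB Bxi]] := small_symbol no_loop th_add th_scale th_mul th_x
  hA A0 (_ : 0 < kappa^-1); first by rewrite invr_gt0.
have cB := algebra_right_commuting hB.
have [F [cF F1 F_le BF_le]] := outer_operator x cB k0.
set m := 1 + kappa * sqn (B (xi vx)) in F_le BF_le.
have hF : LG F by apply/algebra_commutant.
have mle : m <= 1 + kappa^-1.
  rewrite lerD2l -l2norm_sqr; have := Bxi.
  rewrite -(@ler_pXn2r _ 2) ?nnegrE ?l2norm_ge0 ?invr_ge0 ?(ltW k0) // => le1.
  apply: le_trans (ler_wpM2l (ltW k0) le1) _.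
  by rewrite expr2 mulrA mulfV ?mul1r // gt_eqF.
have kV1 : kappa^-1 <= 1 by rewrite invf_le1.
have m0 : 0 <= m by rewrite addr_ge0 // mulr_ge0 ?sqn_ge0 // ltW.
have rm : rho ^+ 2 * m <= 1.
  apply: (@le_trans _ _ (rho ^+ 2 * (1 + kappa^-1))).
    by rewrite ler_wpM2l ?sqr_ge0.
  rewrite mulrDr mulr1 -lerBrDl ler_pdivrMr // mulrC -ler_pdivrMr //.
  by rewrite -/k1 /kappa; lra.
have tF : normc (theta A) * normc (theta F) <= C * Num.sqrt (m / kappa).
  rewrite -thB -normcM -th_mul //; apply: th_le; rewrite ?sqrtr_ge0 //.
    exact: algebra_comp.
  move=> f; rewrite /= l2norm_le ?mulr_ge0 ?sqrtr_ge0 ?l2norm_ge0 //.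
  rewrite exprMn sqr_sqrtr ?divr_ge0 ?(ltW k0) // l2norm_sqr.
  have le1 := BF_le (L p f); rewrite mulrAC ler_pdivlMr // mulrC.
  by apply: le_trans le1 _; rewrite ler_wpM2l ?sqn_left_creation.
have thF : normc (theta F) <= nu.
  rewrite -(ler_pM2l t0) [leRHS]mulrC; apply: le_trans tF _.
  rewrite -(@ler_pXn2r _ 2) ?nnegrE ?mulr_ge0 ?sqrtr_ge0 ?normc_ge0 ?(ltW nu0) //.
  rewrite exprMn sqr_sqrtr ?divr_ge0 ?(ltW k0) // mulrA ler_pdivrMr //.
  apply: (@le_trans _ _ (2 * C ^+ 2)).
    by rewrite mulrC ler_wpM2r ?sqr_ge0 //; lra.
  have : k2 <= kappa by rewrite /kappa; lra.
  by rewrite /k2 ler_pdivrMr // [leRHS]mulrC.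
exists (rho%:C *: F); split.
- exact: algebra_scale.
- move=> f; rewrite l2norm_le ?l2norm_ge0 // l2norm_sqr.
  rewrite -[(rho%:C *: F) f]/(rho%:C *: F f) sqnZ normc_real real_normK ?num_real //.
  apply: le_trans (ler_wpM2l (sqr_ge0 _) (F_le f)) _.
  by rewrite mulrA -[leRHS]mul1r ler_wpM2r ?sqn_ge0.
- by rewrite -[chi _]/(rho%:C * chi F) [chi F]F1 mulr1.
- rewrite th_scale // normcM normc_real gtr0_norm //.
  apply: le_trans thF; rewrite -[leRHS]mul1r; apply: ler_wpM2r; first exact: normc_ge0.
  exact: ltW.
Qed.

Section Resolvent.
Variables (T : H -> H) (rho : R).
Hypotheses (hT : LG T) (T1 : forall f, l2norm (T f) <= l2norm f).
Hypotheses (r0 : 0 < rho) (r1 : rho < 1) (chiT : chi T = rho%:C).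

(** A partial sum of the Neumann series of the inverse of 1 - rho T. *)
Fixpoint neumann n : H -> H :=
  if n is n'.+1 then id + ((rho%:C *: T) \o neumann n') else 0.

Lemma neumann_algebra n : LG (neumann n).
Proof.
elim: n => [|n IHn] /=; first by have := algebra_scale 0 (@algebra_id R G); rewrite scale0r.
apply: algebra_add; first exact: algebra_id.
by apply: algebra_comp => //; exact: algebra_scale.
Qed.

Lemma neumann_defect n f : exists2 g, neumann n f - rho%:C *: T (neumann n f) = f - g &
  l2norm g <= rho ^+ n * l2norm f.
Proof.
have linT := bounded_linear (algebra_bounded hT).
elim: n => [|n [g gE gle]].
  exists f; last by rewrite expr0 mul1r.
  by rewrite -[neumann 0 f]/0 (lin0 linT) scaler0 !subrr.
exists (rho%:C *: T g).
  rewrite -[neumann n.+1 f]/(f + rho%:C *: T (neumann n f)).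
  set k := neumann n f in gE *.
  have -> : f + rho%:C *: T k = k + g.
    by move/eqP: gE; rewrite subr_eq addrAC eq_sym subr_eq => /eqP.
  by rewrite (linD linT) scalerDr opprD addrACA gE addrA subrK.
rewrite l2normZ normc_real gtr0_norm // exprS -mulrA ler_wpM2l ?(ltW r0) //.
exact: le_trans (T1 _) gle.
Qed.

Lemma theta_neumann n : (1 - rho%:C * theta T) * theta (neumann n) =
  1 - (rho%:C * theta T) ^+ n.
Proof.
elim: n => [|n IHn].
  by rewrite (theta0 th_scale) mulr0 expr0 subrr.
have -> : theta (neumann n.+1) = 1 + rho%:C * theta T * theta (neumann n).
  rewrite -[neumann n.+1]/(id + ((rho%:C *: T) \o neumann n)) th_add.
  - rewrite (theta_id th_mul th_x) th_mul ?th_scale //; first exact: algebra_scale.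
    exact: neumann_algebra.
  - exact: algebra_id.
  - by apply: algebra_comp; [exact: algebra_scale|exact: neumann_algebra].
rewrite exprS; set t := rho%:C * theta T in IHn *.
rewrite mulrDr mulr1 [(1 - t) * (t * _)]mulrCA IHn; ring.
Qed.

(** An approximation by elements of the algebra to (rho - T) (1 - rho T)^(-1), the
    disc automorphism exchanging rho and 0; by von Neumann's inequality the latter
    is a contraction when T is one. *)
Definition moebius n : H -> H := (rho%:C *: id - T) \o neumann n.

Lemma moebius_algebra n : LG (moebius n).
Proof.
apply: algebra_comp; last exact: neumann_algebra.
by apply: algebra_sub => //; apply: algebra_scale; exact: algebra_id.
Qed.

Lemma chi_moebius n : chi (moebius n) = 0.
Proof.
have hrT : LG (rho%:C *: id - T).
  by apply: algebra_sub => //; apply: algebra_scale; exact: algebra_id.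
rewrite chi_comp //; last exact: neumann_algebra.
rewrite -[chi (rho%:C *: id - T)]/(rho%:C * (xi vx) vx - chi T) chiT xiE eqxx.
by rewrite mulr1 subrr mul0r.
Qed.

(** For k = neumann n f, expanding the squares gives |k - rho T k|^2 - |rho k - T
    k|^2 = (1 - rho^2) (|k|^2 - |T k|^2) >= 0, and k - rho T k is f up to an error
    of norm rho^n |f|. *)
Lemma l2norm_moebius n f : l2norm (moebius n f) <= (1 + rho ^+ n) * l2norm f.
Proof.
have [g gE gle] := neumann_defect n f; set k := neumann n f in gE.
apply: (@le_trans _ _ (l2norm (k - rho%:C *: T k))); last first.
  rewrite gE; apply: le_trans (le_l2normD _ _) _.
  by rewrite l2normN mulrDl mul1r lerD2l.
rewrite -[moebius n f]/(rho%:C *: k - T k) l2norm_le ?l2norm_ge0 // l2norm_sqr.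
rewrite !sqnD !sqnN !sqnZ normc_real real_normK ?num_real // !innerNr innerZl innerZr.
rewrite conjc_real; have Tk : sqn (T k) <= sqn k.
  by rewrite -!l2norm_sqr ler_pXn2r ?nnegrE ?l2norm_ge0.
have r2 : rho ^+ 2 <= 1 by rewrite expr_le1 // ltW.
have : 0 <= (1 - rho ^+ 2) * (sqn k - sqn (T k)).
  by rewrite mulr_ge0 // subr_ge0.
rewrite mulrBl mul1r mulrBr; move: (complex.Re _) => z.
move: (sqn k) (sqn (T k)) => a b; lra.
Qed.

Lemma theta_moebius n : (1 - rho%:C * theta T) * theta (moebius n) =
  (rho%:C - theta T) * (1 - (rho%:C * theta T) ^+ n).
Proof.
have hr : LG (rho%:C *: (id : H -> H)) by apply: algebra_scale; exact: algebra_id.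
have hrT : LG (rho%:C *: id - T) by exact: algebra_sub.
rewrite /moebius (th_mul hrT (neumann_algebra n)).
rewrite (theta_sub th_add th_scale) // th_scale; last exact: algebra_id.
by rewrite (theta_id th_mul th_x) mulr1 mulrCA theta_neumann.
Qed.

End Resolvent.

(** The Moebius transform exchanges the values rho and 0, so it turns T, with chi
    (T) = rho and theta (T) nearly 0, into B with chi (B) = 0 and theta (B) nearly
    rho. As chi (B) = 0, the paths beginning with e0 can be cut off; a scalar then
    makes the norm at most 1 and the value of theta positive. *)
Lemma near_unit_value_contraction A (a : R) : LG A -> chi A = 0 -> theta A != 0 ->
  0 < a -> a <= 8^-1 ->
  exists D (d : R), [/\ LG D, forall f, l2norm (D f) <= l2norm f,
    forall f v, starts e0 v -> D f v = 0, theta D = d%:C & 1 - 8 * a <= d].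
Proof.
move=> hA A0 tA a0 a8.
have r0 : 0 < 1 - a by lra.
have r1 : 1 - a < 1 by lra.
have [T [hT T1 chiT thT]] := small_value_contraction hA A0 tA r0 r1 a0.
have [N hN] := small_power (ltW r0) r1 a0.
set rho := 1 - a in r0 r1 chiT hN; pose n := N.+1.
have rn : rho ^+ n <= a by apply: hN; exact: leqnSn.
pose B := moebius T rho n.
have hB : LG B by exact: moebius_algebra.
have B0 : chi B = 0 by exact: chi_moebius.
have := @theta_moebius T rho hT n; rewrite -/B; set tau := theta T in thT *.
move=> /(congr1 (@normc R)); rewrite !normcM => thB.
have tau0 := normc_ge0 tau; have thB0 := normc_ge0 (theta B).
have rtau : normc (rho%:C * tau) <= a.
  rewrite normcM normc_real gtr0_norm //; apply: le_trans thT.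
  by rewrite -[leRHS]mul1r; apply: ler_wpM2r => //; exact: ltW.
have rtau1 : normc (rho%:C * tau) <= 1 by apply: le_trans rtau _; lra.
have h1 : normc (1 - rho%:C * tau) <= 1 + a.
  by apply: le_trans (le_normcD _ _) _; rewrite normc1 normcN lerD2l.
have h2 : 1 - 2 * a <= normc (rho%:C - tau).
  apply: le_trans (le_normcB _ _); rewrite normc_real gtr0_norm // /rho; lra.
have h3 : 1 - a <= normc (1 - (rho%:C * tau) ^+ n).
  apply: le_trans (le_normcB _ _); rewrite normc1 normcX lerD2l lerN2.
  rewrite exprS; apply: le_trans rtau; rewrite -[leRHS]mulr1.
  apply: ler_wpM2l; first exact: normc_ge0.
  by apply: exprn_ile1; [exact: normc_ge0|exact: rtau1].
have key : (1 - 2 * a) * (1 - a) <= (1 + a) * normc (theta B).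
  apply: (@le_trans _ _ (normc (1 - rho%:C * tau) * normc (theta B))).
    by rewrite thB; apply: ler_pM => //; lra.
  exact: ler_wpM2r.
have b0 : 0 < normc (theta B).
  rewrite lt_def thB0 andbT; apply: contraTneq key => ->.
  rewrite mulr0 -ltNge mulr_gt0 //; lra.
have a1 : 0 < 1 + a by lra.
pose c : R[i] := ((1 + a)^-1 * (normc (theta B))^-1)%:C * ((theta B)^*)%C.
have nc : normc c = (1 + a)^-1.
  rewrite normcM normc_real normc_conj ger0_norm; first by rewrite mulfVK // gt_eqF.
  by rewrite mulr_ge0 ?invr_ge0 // ltW.
exists (c *: cut e0 B), (normc (theta B) / (1 + a)); split.
- by apply: algebra_scale; exact: (cut_algebra e0x).
- move=> f; rewrite -[(c *: _) f]/(c *: cut e0 B f) l2normZ nc.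
  rewrite mulrC ler_pdivrMr // mulrC; apply: le_trans (l2norm_cut _ _ _) _.
  apply: le_trans (l2norm_moebius hT T1 r0 r1 n f) _.
  by apply: ler_wpM2r; [exact: l2norm_ge0|rewrite lerD2l].
- move=> f v v0; rewrite -[(c *: _) f]/(c *: cut e0 B f) l2_ZE cutE v0 mulr0 //.
- rewrite th_scale; last exact: (cut_algebra e0x).
  rewrite (theta_cut no_loop th_add th_scale th_mul th_x e0x hB B0).
  rewrite /c -mulrA [_^*%C * _]mulrC mulc_conj -realcM; congr (_%:C).
  by field; rewrite !gt_eqF.
- rewrite ler_pdivlMr // -(ler_pM2l a1); apply: le_trans key.
  rewrite -subr_ge0.
  have -> : (1 - 2 * a) * (1 - a) - (1 + a) * ((1 - 8 * a) * (1 + a)) =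
    a * (3 + 17 * a + 8 * a ^+ 2) by ring.
  rewrite mulr_ge0 ?(ltW a0) // !addr_ge0 ?mulr_ge0 ?exprn_ge0 ?(ltW a0) //.
Qed.

Section Averaging.
Variables (D : H -> H) (d : R).
Hypotheses (hD : LG D) (D1 : forall f, l2norm (D f) <= l2norm f).
Hypotheses (D_starts : forall f v, starts e0 v -> D f v = 0) (thD : theta D = d%:C).

Fixpoint orbit_sum n : H -> H := if n is n'.+1 then id + (D \o orbit_sum n') else id.

Lemma orbit_sum_algebra n : LG (orbit_sum n).
Proof.
elim: n => [|n IHn] /=; first exact: algebra_id.
by apply: algebra_add; [exact: algebra_id|exact: algebra_comp].
Qed.

Lemma inner_disjoint f g : (forall w, f w * ((g w)^*)%C = 0) -> inner f g = 0.
Proof.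
move=> fg0; apply: net_sum_unique (inner_net_sum f g) _.
have := @net_sum_finite R (gpath G) (fun w => f w * ((g w)^*)%C) [::] isT.
by rewrite big_nil; apply.
Qed.

(** The range of L_p consists of vectors supported on paths that begin with e0,
    and the range of D of vectors vanishing there. So each step L_p f + D
    (orbit_sum n (L_p f)) is an orthogonal sum and adds at most |f|^2. *)
Lemma sqn_orbit_sum n f : sqn (orbit_sum n (L p f)) <= n.+1%:R * sqn f.
Proof.
elim: n => [|n IHn]; first by rewrite mul1r sqn_left_creation.
rewrite -[orbit_sum n.+1 _]/(L p f + D (orbit_sum n (L p f))) sqnD.
rewrite inner_disjoint => [|w].
  have -> : complex.Re (0 : R[i]) = 0 by [].
  rewrite mulr0 addr0 -[n.+2%:R]natr1 mulrDl mul1r addrC; apply: lerD.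
    by apply: le_trans IHn; rewrite -!l2norm_sqr ler_pXn2r ?nnegrE ?l2norm_ge0.
  exact: sqn_left_creation.
case: (boolP (starts e0 w)) => [w0|nw]; first by rewrite D_starts // conjc0 mulr0.
rewrite left_creationE; case pw : (lquo p w) => [t|]; last by rewrite mul0r.
move/lquoP: pw => /pprod_Some[_ _ h]; move: nw p_starts; rewrite /starts h.
by case: (pedges p) => //= e es /negP.
Qed.

(** A Bernoulli inequality: for d >= 1 - z the geometric sum is at least (n+1) (1
    - n z). *)
Lemma theta_orbit_sum n : exists2 y : R, theta (orbit_sum n) = y%:C &
  forall z : R, 0 <= z -> n%:R * z <= 1 -> 1 - z <= d -> n.+1%:R * (1 - n%:R * z) <= y.
Proof.
elim: n => [|n [y yE hy]].
  exists 1; first by rewrite (theta_id th_mul th_x).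
  by move=> z _ _ _; rewrite mul0r subr0 mulr1.
exists (1 + d * y).
  rewrite -[orbit_sum n.+1]/(id + (D \o orbit_sum n)) th_add ?(theta_id th_mul th_x).
  - by rewrite (th_mul hD (orbit_sum_algebra n)) thD yE -realcM -realcD.
  - exact: algebra_id.
  - by apply: algebra_comp => //; exact: orbit_sum_algebra.
move=> z z0 nz zd; have nz' : n%:R * z <= 1.
  by apply: le_trans nz; rewrite ler_wpM2r // ler_nat.
have := hy z z0 nz' zd.
have n0 : 0 <= (n%:R : R) by [].
rewrite -!natr1 in nz *; move: (n%:R : R) n0 nz nz' => m m0 nz nz' le1.
have y0 : 0 <= y by apply: le_trans le1; rewrite mulr_ge0 //; lra.
have le2 : (1 - z) * ((m + 1) * (1 - m * z)) <= d * y.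
  apply: (@le_trans _ _ ((1 - z) * y)); last exact: ler_wpM2r.
  apply: ler_wpM2l => //; nra.
nra.
Qed.

End Averaging.

(** Otherwise the value of theta on the orbit sums grows like n + 1, while its
    bound C ||Y L_p|| grows like the square root of n + 1. *)
Lemma character_zero A : LG A -> chi A = 0 -> theta A = 0.
Proof.
move=> hA A0; apply/eqP/negPn/negP => tA.
(* (n + 1) / 2 <= theta <= C sqrt (n + 1) would force n + 1 <= 4 C^2 *)
pose n := Num.bound (4 * C ^+ 2).
have n0 : 0 < (n.+1%:R : R) by rewrite ltr0n.
have [||D [d [hD D1 Ds thD dge]]] := @near_unit_value_contraction A (16 * n.+1%:R)^-1 hA A0 tA.
- by rewrite invr_gt0 mulr_gt0.
- rewrite lef_pV2 ?posrE ?mulr_gt0 //.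
  have : 1 <= (n.+1%:R : R) by rewrite ler1n.
  lra.
have [y yE hy] := theta_orbit_sum hD thD n.
have z0 : 0 <= (2 * n.+1%:R)^-1 :> R by rewrite invr_ge0 mulr_ge0.
have nz : n%:R * (2 * n.+1%:R)^-1 <= 2^-1 :> R.
  rewrite invfM mulrCA -[leRHS]mulr1 ler_wpM2l // ler_pdivrMr // mul1r ler_nat //.
have zd : 1 - (2 * n.+1%:R)^-1 <= d.
  apply: le_trans dge; rewrite lerD2l lerN2 (_ : 16 = 8 * 2); last by ring.
  by rewrite -mulrA [(8 * _)^-1]invfM mulrA mulfV ?mul1r // pnatr_eq0.
have yle : n.+1%:R / 2 <= y.
  apply: le_trans (hy _ z0 _ zd); last by apply: le_trans nz _; lra.
  by apply: ler_wpM2l => //; move: nz; move: (n%:R / _) => q; lra.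
have := @th_le (orbit_sum D n) (Num.sqrt n.+1%:R) (orbit_sum_algebra hD n) (sqrtr_ge0 _).
rewrite yE normc_real ger0_norm; last by apply: le_trans yle; rewrite divr_ge0.
have bnd f : l2norm (orbit_sum D n (L p f)) <= Num.sqrt n.+1%:R * l2norm f.
  rewrite l2norm_le ?mulr_ge0 ?sqrtr_ge0 ?l2norm_ge0 // exprMn sqr_sqrtr //.
  by rewrite l2norm_sqr; apply: sqn_orbit_sum.
move=> /(_ bnd) le1.
have s0 : 0 < Num.sqrt (n.+1%:R : R) by rewrite sqrtr_gt0.
have le2 : Num.sqrt n.+1%:R <= 2 * C.
  have := le_trans yle le1; rewrite -{1}(sqr_sqrtr (ltW n0)) expr2.
  by rewrite mulrAC ler_pM2r // ler_pdivrMr // mulrC.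
have : (n.+1%:R : R) <= 4 * C ^+ 2.
  rewrite -(sqr_sqrtr (ltW n0)) (_ : 4 * C ^+ 2 = (2 * C) ^+ 2); last by ring.
  by rewrite ler_pXn2r ?nnegrE ?(ltW s0) // mulr_ge0.
apply/negP; rewrite -ltNge; apply: (@lt_trans _ _ n%:R); last by rewrite ltr_nat.
by apply: archi_boundP; rewrite mulr_ge0 // sqr_ge0.
Qed.

Lemma character_value A : LG A -> theta A = chi A.
Proof.
move=> hA; have hid : LG (chi A *: id) by apply: algebra_scale; exact: algebra_id.
have := @character_zero (A - chi A *: id) (algebra_sub hA hid).
rewrite (theta_sub th_add th_scale) // th_scale ?(theta_id th_mul th_x); last exact: algebra_id.
rewrite mulr1 => h; apply/eqP; rewrite -subr_eq0; apply/eqP; apply: h.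
rewrite -[chi _]/(chi A - chi A * xi vx vx) xiE eqxx mulr1 subrr //.
Qed.

End CharacterValue.

(** * Nest representations and necessity *)

Section NestRepresentations.
Variables (R : realType) (G : digraph) (n : nat).
Local Notation H := (l2 R (gpath G)).
Local Notation L p := (@left_creation R G p).
Local Notation LG := (@free_semigroupoid_algebra R G).
Local Notation xi := (@xi R (gpath G)).
Variable psi : (H -> H) -> 'M[R[i]]_n.
Hypothesis hpsi : nest_representation psi.
Implicit Types (f g : H).

Lemma nest_upper A (i j : 'I_n) : LG A -> (j < i)%N -> psi A i j = 0.
Proof.
move=> hA ji; have : [set M : 'M[R[i]]_n | is_trig_mx M^T] (psi A).
  by rewrite -(nest_rep_onto hpsi); exists A.
by move=> /is_trig_mxP/(_ j i ji); rewrite mxE.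
Qed.

Lemma ord_lt_neq (i k : 'I_n) : (i <= k)%N -> k != i -> (i < k)%N.
Proof.
move=> ik; rewrite ltn_neqAle ik andbT; apply: contra => /eqP e.
by apply/eqP/val_inj.
Qed.

Lemma nest_diag_mul A B i : LG A -> LG B -> psi (A \o B) i i = psi A i i * psi B i i.
Proof.
move=> hA hB; rewrite (nest_rep_mul hpsi hA hB) mxE (bigD1 i) //= big1 ?addr0 // => k ki.
case: (ltnP k i) => lt; first by rewrite nest_upper ?mul0r.
by rewrite (nest_upper hB) ?mulr0 //; exact: ord_lt_neq lt ki.
Qed.

Lemma nest0 : psi 0 = 0.
Proof. by have := nest_rep_scale hpsi 0 (@algebra_id R G); rewrite !scale0r. Qed.

(** Continuity at 0 of a linear map gives a bound; it is stated with an upper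
    bound M for the norm of A because the operator norm is a supremum. *)
Lemma nest_bound : exists2 K : R, 0 <= K & forall A (M : R), LG A -> 0 <= M ->
  (forall f, l2norm (A f) <= M * l2norm f) -> forall i j, normc (psi A i j) <= K * M.
Proof.
have h0 : LG 0 by have := algebra_scale 0 (@algebra_id R G); rewrite scale0r.
have [d d0 hd] := nest_rep_continuous hpsi h0 ltr01.
exists (2 / d); first by rewrite divr_ge0 // ltW.
move=> A M hA; rewrite le_eqVlt => /orP[/eqP <-|M0] hM i j.
  have -> : A = 0.
    apply/funext => f; apply: l2norm_eq0; apply/eqP.
    by rewrite eq_le l2norm_ge0 andbT; have := hM f; rewrite mul0r.
  by rewrite nest0 mxE normc0 mulr0.
pose c : R := d / (2 * M).
have c0 : 0 < c by rewrite divr_gt0 ?mulr_gt0.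
have hcA : LG (c%:C *: A) by exact: algebra_scale.
have : opnorm (c%:C *: A - 0) < d.
  rewrite subr0; apply: (@le_lt_trans _ _ (d / 2)); last first.
    by rewrite ltr_pdivrMr // mulr_natr mulr2n ltrDl.
  apply: ge_sup; first by exists (l2norm ((c%:C *: A) 0)), 0 => //=; rewrite l2norm0.
  move=> _ [f f1 <-]; rewrite -[(c%:C *: A) f]/(c%:C *: A f) l2normZ normc_real gtr0_norm //.
  apply: (@le_trans _ _ (c * M)).
    rewrite ler_pM2l //; apply: le_trans (hM f) _.
    by rewrite -[leRHS]mulr1 ler_pM2l.
  by rewrite /c invfM mulrA mulfVK ?gt_eqF.
move=> /(hd _ hcA)/(_ i j); rewrite nest0 mxE subr0 (nest_rep_scale hpsi) // mxE.
rewrite normcM normc_real gtr0_norm // => /ltW; rewrite -ler_pdivlMl // mulr1.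
by rewrite /c invf_div mulrAC.
Qed.

(** In the column j, left multiplication by A acts on the last nonzero entry by
    the diagonal entry psi(A)_rr. This gives theta (L_x) = 1, since L_x L_p = L_p,
    and, dividing by the entry, the bound of theta (Y) by the norm of Y L_p. *)
Lemma top_entry_character x p Z (r j : 'I_n) :
  (forall e, ~ supports_loop_edge x e) -> (0 < plen p)%N -> supports_cycle x p ->
  LG Z -> (forall f, l2norm (Z f) <= l2norm f) ->
  psi (L p \o Z) r j != 0 -> (forall k : 'I_n, (r < k)%N -> psi (L p \o Z) k j = 0) ->
  forall A, LG A -> psi A r r = chi x A.
Proof.
move=> nl p0 [px _] hZ Z1 wr wk.
have hp := creation_in_algebra R p.
have hpZ : LG (L p \o Z) by exact: algebra_comp.
have row A : LG A -> psi (A \o (L p \o Z)) r j = psi A r r * psi (L p \o Z) r j.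
  move=> hA; rewrite (nest_rep_mul hpsi hA hpZ) mxE (bigD1 r) //= big1 ?addr0 // => k kr.
  case: (ltnP k r) => lt; first by rewrite nest_upper ?mul0r.
  by rewrite wk ?mulr0 //; exact: ord_lt_neq lt kr.
have [K K0 hK] := nest_bound.
have thx : psi (L (vpath x)) r r = 1.
  apply: (mulIf wr); rewrite -row ?mul1r; last exact: creation_in_algebra.
  congr (psi _ r j); apply/funext => f /=.
  by rewrite left_creation_comp pprod_vpathl px eqxx.
case pe : (pedges p) => [|e0 es]; first by rewrite /plen pe in p0.
have st : starts e0 p by rewrite /starts pe.
have e0x : erng e0 = x by rewrite -px (starts_prng st).
have w0 : 0 < normc (psi (L p \o Z) r j) by rewrite lt_def normc_eq0 wr normc_ge0.
apply: (@character_value R G x nl (fun A => psi A r r) _ _ _ thx p e0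
   (K / normc (psi (L p \o Z) r j)) st e0x).
- by move=> A B hA hB; rewrite (nest_rep_add hpsi) // mxE.
- by move=> c A hA; rewrite (nest_rep_scale hpsi) // mxE.
- by move=> A B hA hB; exact: nest_diag_mul.
- by rewrite divr_ge0 // ltW.
move=> Y M hY M0 hM; rewrite mulrAC ler_pdivlMr // -normcM -row //.
apply: hK => //; first exact: algebra_comp.
move=> f /=; apply: le_trans (hM (Z f)) _; exact: ler_wpM2l.
Qed.

Lemma last_nonzero (w : 'I_n -> R[i]) k0 : w k0 != 0 ->
  exists2 r, w r != 0 & forall k : 'I_n, (r < k)%N -> w k = 0.
Proof.
move=> wk0; have [r wr hr] := @arg_maxnP _ k0 (fun k => w k != 0) (@nat_of_ord n) wk0.
exists r => // k rk; apply/eqP; apply: contraTT rk => wk.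
by rewrite -leqNgt; exact: hr.
Qed.

(** A nonzero column j of psi (L_p L_p) = psi (L_p) psi (L_p) has its last nonzero
    entry strictly above that of psi (L_p), because the diagonal of psi (L_p)
    vanishes where the diagonal entry is the constant coefficient. So the diagonal
    entries at two different rows r and s are the same character, which
    contradicts surjectivity. *)
Lemma nest_kills_square x p :
  (forall e, ~ supports_loop_edge x e) -> (0 < plen p)%N -> supports_cycle x p ->
  psi (L p \o L p) = 0.
Proof.
move=> nl p0 cp; apply/matrixP => i j; rewrite [RHS]mxE; apply/eqP/negPn/negP => nz.
have hp := creation_in_algebra R p.
have Lp1 f : l2norm (L p f) <= l2norm f := l2norm_left_creation p f.
have [s ws hs] := @last_nonzero (fun k => psi (L p \o L p) k j) i nz.
have chis := top_entry_character nl p0 cp hp Lp1 ws hs.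
have idp : L p \o id = L p by [].
have ppE k : psi (L p \o L p) k j = \sum_l psi (L p) k l * psi (L p) l j.
  by rewrite (nest_rep_mul hpsi hp hp) mxE.
have [k1 k1nz] : exists k, psi (L p) k j != 0.
  apply: contrapT => no; move: nz; rewrite ppE big1 ?eqxx // => l _.
  have -> : psi (L p) l j = 0; last by rewrite mulr0.
  by apply/eqP/negPn/negP => h; apply: no; exists l.
have [r wr hr] := @last_nonzero (fun k => psi (L p \o id) k j) k1 k1nz.
have chir := top_entry_character nl p0 cp (@algebra_id R G) (fun f => lexx _) wr hr.
have sr : (s < r)%N.
  rewrite ltnNge; apply/negP => rs; move: ws => /=; rewrite ppE big1 ?eqxx // => l _.
  case: (ltngtP l s) => ls.
  - by rewrite nest_upper ?mul0r.
  - by rewrite (hr l) ?mulr0 // (leq_ltn_trans rs).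
  (* psi (L p) s s is the constant coefficient of L p, hence zero *)
  have -> : l = s by exact: val_inj.
  rewrite chis // (_ : chi x (L p) = 0) ?mul0r //.
  rewrite /chi left_creationE; case lq : (lquo p (vpath x)) => [w|] //.
  move/lquoP: lq => /pprod_Some[_ _] /(congr1 size).
  by rewrite size_cat /= => /eqP; rewrite eq_sym addn_eq0 eqn0Ngt [(0 < _)%N]p0.
(* an element on which the two equal characters differ *)
have [A hA psiA] : exists2 A, LG A & psi A = delta_mx r r.
  have : [set M : 'M[R[i]]_n | is_trig_mx M^T] (delta_mx r r).
    apply/is_trig_mxP => a b ab; rewrite !mxE.
    case: (b =P r) => [br|//]; case: (a =P r) => [ar|//].
    by rewrite ar br ltnn in ab.
  by rewrite -(nest_rep_onto hpsi) => -[A hA <-]; exists A.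
have h1 := chir A hA; have h2 := chis A hA.
move: h1; rewrite -h2 psiA !mxE !eqxx /=.
have -> : (s == r) = false by apply/eqP => e; rewrite e ltnn in sr.
by move=> /eqP; rewrite oner_eq0.
Qed.

End NestRepresentations.

Theorem theorem4p10 (R : realType) (G : digraph) :
  nest_representations_separate_points R G <->
  (forall x : vertex G,
    (exists p : gpath G, (0 < plen p)%N /\ supports_cycle x p) ->
    exists e : edge G, supports_loop_edge x e).
Proof.
split; last exact: loops_separate.
move=> sep x [p [p0 cp]]; apply: contrapT => nl.
have {}nl e : ~ supports_loop_edge x e by move=> h; apply: nl; exists e.
pose Z : l2 R (gpath G) -> l2 R (gpath G) := left_creation p \o left_creation p.
have hZ : free_semigroupoid_algebra Z by apply: algebra_comp; exact: creation_in_algebra.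
have Z0 : Z <> 0.
  move=> /(congr1 (fun T => T (xi R (vpath x)))); rewrite /Z /= left_creation_xi.
  have [px sx] := cp; rewrite pprod_vpathr sx eqxx /= left_creation_xi.
  have [v -> _] := @pprodP G p p (etrans sx (esym px)).
  move=> /(congr1 (fun f : l2 R (gpath G) => f v)).
  by rewrite [LHS]/= /xi_fun eqxx => /eqP; rewrite oner_eq0.
have [n [psi [_ hpsi]]] := sep Z hZ Z0; apply.
exact: nest_kills_square hpsi _ _ nl p0 cp.
Qed.
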